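(* Let $0<p_i\le\infty$, $0<p<\infty$ and $s_i>0$ for $1\le i\le m$. Suppose that there is a constant $C$ such that the estimate $$\|T_\sigma(f_1,\ldots,f_m)\|_{L^p}\le C\,\sup_{j\in\mathbb Z}\big\|\sigma(2^j\cdot)\widehat\psi\big\|_{W^{(s_1,\ldots,s_m)}}\prod_{i=1}^m\|f_i\|_{H^{p_i}}$$ holds for all $f_i\in H^{p_i}$ $(1\le i\le m)$ and all $\sigma\in W^{(s_1,\ldots,s_m)}$. Then necessarily $$s_i\ge\frac n2\qquad\text{for all }1\le i\le m,$$ and $$\sum_{i\in J}\Big(\frac{s_i}n-\frac1{p_i}\Big)\ge-\frac12$$ for every subset $J\subset\{1,\ldots,m\}$.
   Context: $\mathbb R^{mn}=\mathbb R^n\times\cdots\times\mathbb R^n$. The $m$-linear Fourier multiplier operator with symbol $\sigma$ on $\mathbb R^{mn}$ is, for Schwartz functions $f_1,\ldots,f_m$ on $\mathbb R^n$, $$T_\sigma(f_1,\ldots,f_m)(x)=\int_{\mathbb R^{mn}}e^{2\pi i x\cdot(\xi_1+\cdots+\xi_m)}\sigma(\xi_1,\ldots,\xi_m)\widehat{f_1}(\xi_1)\cdots\widehat{f_m}(\xi_m)\,d\xi_1\cdots d\xi_m ,$$ and the estimate for $T_\sigma$ is understood for Schwartz functions $f_i$ lying in $H^{p_i}$. $\langle y\rangle=\sqrt{1+|y|^2}$ for $y\in\mathbb R^n$. For $s_1,\ldots,s_m>0$, $W^{(s_1,\ldots,s_m)}$ is the space of functions $f$ on $\mathbb R^{mn}$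 with $$\|f\|_{W^{(s_1,\ldots,s_m)}}=\Big(\int_{\mathbb R^{mn}}\big|\widehat f(y_1,\ldots,y_m)\langle y_1\rangle^{s_1}\cdots\langle y_m\rangle^{s_m}\big|^2dy_1\cdots dy_m\Big)^{1/2}<\infty .$$ Here $\psi$ is a fixed smooth function on $\mathbb R^{mn}$ whose Fourier transform $\widehat\psi$ is smooth, supported in $\{2^{-3/4}\le|\xi|\le2^{3/4}\}$, satisfies $\widehat\psi(\xi)=1$ for $2^{-1/4}\le|\xi|\le2^{1/4}$, and, for some nonzero constant $c$, $\sum_{j\in\mathbb Z}\widehat\psi(2^{-j}\xi)=c$ for all $\xi\ne0$. For $0<p\le1$, $H^p$ is the real Hardy space on $\mathbb R^n$, with $\|f\|_{H^p}=\|\sup_{t>0}|\Phi_t*f|\|_{L^p}$ for a fixed Schwartz function $\Phi$ with $\widehat\Phi(0)\neq0$, $\Phi_t=t^{-n}\Phi(\cdot/t)$; for $1<p\le\infty$, $H^p=L^p$. The convention $1/\infty=0$ is used. *)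

(* Defs.v *)
From HB Require Import structures.
From mathcomp Require Import all_boot all_order all_algebra.
From mathcomp Require Import all_classical all_reals all_analysis.
From mathcomp Require Import complex.

Set Implicit Arguments.
Unset Strict Implicit.
Unset Printing Implicit Defensive.

Import Order.TTheory GRing.Theory Num.Theory.
Import numFieldNormedType.Exports.

Local Open Scope classical_set_scope.
Local Open Scope ring_scope.

(* The pushforward of m along f, packaged with the left inverse that makes it
   sigma-finite. *)
Section image_sigma_finite.
Context d1 d2 (T1 : measurableType d1) (T2 : measurableType d2) (R : realType).
Variables (m : {sigma_finite_measure set T1 -> \bar R}).
Variables (f : T1 -> T2) (g : T2 -> T1).
Hypotheses (mf : measurable_fun [set: T1] f) (mg : measurable_fun [set: T2] g).
Hypothesis fK : cancel f g.

Definition image_measure of measurable_fun setT f & measurable_fun setT g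
  & cancel f g : set T2 -> \bar R := pushforward m f.

Local Notation im := (image_measure mf mg fK).

Let im_sigma_finite : sigma_finite setT im.
Proof.
have [F TF Foo] := sigma_finiteT m.
exists (fun n => g @^-1` F n); first by rewrite -preimage_bigcup -TF preimage_setT.
move=> n; have [mF ltF] := Foo n; split.
  by rewrite -[X in measurable X]setTI; exact: mg.
rewrite /image_measure /pushforward -comp_preimage.
by rewrite (_ : g \o f = id) //; apply/funext => x /=; exact: fK.
Qed.

Let im0 : (im set0 = 0)%E.
Proof. by rewrite /image_measure /pushforward preimage_set0 measure0. Qed.

Let im_ge0 A : (0 <= im A)%E.
Proof. exact: measure_ge0. Qed.

Let im_sigma_additive : semi_sigma_additive im.
Proof.
move=> F mF tF mUF; rewrite /image_measure /pushforward preimage_bigcup.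
apply: measure_semi_sigma_additive.
- by move=> n; rewrite -[X in measurable X]setTI; exact: mf.
- apply/trivIsetP => /= i j _ _ ij; rewrite -preimage_setI.
  by move/trivIsetP : tF => /(_ _ _ _ _ ij) ->//; rewrite preimage_set0.
- by rewrite -preimage_bigcup -[X in measurable X]setTI; exact: mf.
Qed.

HB.instance Definition _ := isMeasure.Build _ _ _ im
  im0 im_ge0 im_sigma_additive.
HB.instance Definition _ := Measure_isSigmaFinite.Build _ _ _ im
  im_sigma_finite.

End image_sigma_finite.

(* The library proves sigma-finiteness of products without providing it as an
   instance. *)
Section sf_product.
Context d1 d2 (T1 : measurableType d1) (T2 : measurableType d2) (R : realType).
Variables (m1 : {sigma_finite_measure set T1 -> \bar R}).
Variables (m2 : {sigma_finite_measure set T2 -> \bar R}).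

Definition sf_product : set (T1 * T2) -> \bar R := (m1 \x m2)%E.

HB.instance Definition _ := Measure.on sf_product.

Let sf_product_sigma_finite : sigma_finite setT sf_product.
Proof.
have /sigma_finiteP[F [TF ndF Foo]] := sigma_finiteT m1.
have /sigma_finiteP[G [TG ndG Goo]] := sigma_finiteT m2.
exists (fun n => F n `*` G n).
  rewrite -setXTT TF TG predeqE => -[x y]; split.
    move=> [/= [n _ Fnx] [k _ Gky]]; exists (maxn n k) => //; split.
    - by move: x Fnx; exact/subsetPset/ndF/leq_maxl.
    - by move: y Gky; exact/subsetPset/ndG/leq_maxr.
  by move=> [n _ []/= ? ?]; split; exists n.
move=> k; have [? ?] := Foo k; have [? ?] := Goo k.
split; first exact: measurableX.
by rewrite /sf_product product_measure1E// lte_mul_pinfty// ge0_fin_numE.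
Qed.

HB.instance Definition _ := Measure_isSigmaFinite.Build _ _ _ sf_product
  sf_product_sigma_finite.

End sf_product.

Section lebesgue_tuple.
Variable R : realType.
Local Notation RM := (measurableTypeR R).

Definition tcons k (x : RM * k.-tuple RM) : k.+1.-tuple RM :=
  [tuple of x.1 :: x.2].
Definition tuncons k (t : k.+1.-tuple RM) : RM * k.-tuple RM :=
  (thead t, [tuple of behead t]).

Lemma tconsK k : cancel (@tcons k) (@tuncons k).
Proof. by case=> x t; rewrite /tuncons theadE; congr pair; exact: val_inj. Qed.

Lemma measurable_tcons k : measurable_fun setT (@tcons k).
Proof. exact: measurable_cons. Qed.

Lemma measurable_tuncons k : measurable_fun setT (@tuncons k).
Proof.
apply/measurable_fun_pairP; split; last exact: measurable_behead.
exact: measurable_tnth.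
Qed.

Definition dirac_nil : {sigma_finite_measure set (0.-tuple RM) -> \bar R} :=
  \d_([tuple] : 0.-tuple RM).

Fixpoint lebesgue_tuple k : {sigma_finite_measure set (k.-tuple RM) -> \bar R} :=
  match k with
  | 0 => dirac_nil
  | k.+1 => image_measure (sf_product (@lebesgue_measure R) (lebesgue_tuple k))
              (@measurable_tcons k) (@measurable_tuncons k) (@tconsK k)
  end.

Lemma lebesgue_tuple_box k (A : 'I_k -> set RM) :
  (forall i, measurable (A i)) ->
  lebesgue_tuple k [set t | forall i, A i (tnth t i)] =
  (\prod_i lebesgue_measure (A i))%E.
Proof.
elim: k A => [|k IH] A mA.
  rewrite big_ord0 /= diracE mem_set//; by case.
rewrite big_ord_recl -IH; last by move=> i; exact: mA.
have -> : lebesgue_tuple k.+1 [set t | forall i, A i (tnth t i)] =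
  (@lebesgue_measure R \x lebesgue_tuple k)%E (A ord0 `*`
    [set t | forall i, A (lift ord0 i) (tnth t i)]).
  change (lebesgue_tuple k.+1 [set t | forall i, A i (tnth t i)]) with
   ((@lebesgue_measure R \x lebesgue_tuple k)%E (@tcons k @^-1` [set t | forall i, A i (tnth t i)])).
  congr product_measure1; apply/seteqP; split => -[x t] /=.
    by move=> H; split; [have := H ord0|move=> i; have := H (lift ord0 i); rewrite tnthS].
  move=> [H0 H] i; case: (unliftP ord0 i) => [j ->|->//]; rewrite tnthS; exact: H.
rewrite product_measure1E //.
rewrite (_ : [set t | _] = \bigcap_(i in [set: 'I_k]) ((fun t : k.-tuple RM => tnth t i) @^-1` A (lift ord0 i))).
  apply: fin_bigcap_measurable => // i _. rewrite -[X in measurable X]setTI. apply: measurable_tnth => //.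
by apply/seteqP; split => t /= H i => [_|]; exact: H.
Qed.

End lebesgue_tuple.

(* A point (x_1, ..., x_m) of (R^n)^m is an m x n matrix whose rows are the
   x_i; in particular R^n is 'rV[R]_n = 'M[R]_(1, n). *)
Section lebesgue_mx.
Variables (R : realType) (m n : nat).
Local Notation RM := (measurableTypeR R).

Definition mx_cylinders : set (set 'M[R]_(m, n)) :=
  [set B | exists i j, exists2 A : set RM,
     measurable A & B = [set M : 'M[R]_(m, n) | A (M i j)]].

HB.instance Definition _ := @isMeasurable.Build (sigma_display mx_cylinders)
  'M[R]_(m, n) <<s mx_cylinders >> (@sigma_algebra0 _ setT mx_cylinders)
  (@sigma_algebraC _ mx_cylinders)
  (@sigma_algebra_bigcup _ setT mx_cylinders).

Definition mx_of_tuple (t : (m * n).-tuple RM) : 'M[R]_(m, n) :=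
  \matrix_(i, j) tnth t (mxvec_index i j).
Definition tuple_of_mx (M : 'M[R]_(m, n)) : (m * n).-tuple RM :=
  [tuple mxvec M ord0 k | k < m * n].

Lemma mx_of_tupleK : cancel mx_of_tuple tuple_of_mx.
Proof.
move=> t; apply: eq_from_tnth => k; rewrite tnth_mktuple.
by case/mxvec_indexP: k => i j; rewrite mxvecE mxE.
Qed.

Lemma measurable_mx_of_tuple : measurable_fun setT mx_of_tuple.
Proof.
apply: (@measurability _ _ _ _ setT _ mx_cylinders) => //.
move=> _ [_ [i [j [A mA ->]]] <-].
rewrite (_ : _ @^-1` _ = (fun t => tnth t (mxvec_index i j)) @^-1` A).
  exact: measurable_tnth.
by apply/funext => t /=; rewrite mxE.
Qed.

Lemma measurable_tuple_of_mx : measurable_fun setT tuple_of_mx.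
Proof.
apply/measurable_fun_tnthP => k; case/mxvec_indexP: k => i j _ A mA.
rewrite setTI; apply: sub_sigma_algebra; exists i, j, A => //.
by apply/funext => M /=; rewrite tnth_mktuple mxvecE.
Qed.

Definition lebesgue_mx : {sigma_finite_measure set 'M[R]_(m, n) -> \bar R} :=
  image_measure (lebesgue_tuple R (m * n))
    measurable_mx_of_tuple measurable_tuple_of_mx mx_of_tupleK.

Lemma lebesgue_mx_box (A : 'I_m -> 'I_n -> set RM) :
  (forall i j, measurable (A i j)) ->
  lebesgue_mx [set M | forall i j, A i j (M i j)] =
  (\prod_i \prod_j lebesgue_measure (A i j))%E.
Proof.
move=> mA.
pose B k := mxvec (\matrix_(i, j) A i j) ord0 k.
have BE i j : B (mxvec_index i j) = A i j by rewrite /B mxvecE mxE.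
transitivity (lebesgue_tuple R (m * n) [set t | forall k, B k (tnth t k)]).
  congr (lebesgue_tuple R (m * n) _); apply/seteqP; split => t /= H.
    by move=> k; case/mxvec_indexP: k => i j; have := H i j; rewrite BE mxE.
  by move=> i j; have := H (mxvec_index i j); rewrite BE mxE.
rewrite lebesgue_tuple_box; last by move=> k; case/mxvec_indexP: k => i j; rewrite BE.
rewrite pair_bigA /= (reindex _ (curry_mxvec_bij m n)) /=.
by apply: eq_bigr => -[i j] _ /=; rewrite BE.
Qed.

End lebesgue_mx.

Section analysis.
Variable R : realType.
Implicit Types (m n : nat) (p : \bar R).

Definition cmod (z : R[i]) : R := ComplexField.Normc.normc z.

Definition expi (t : R) : R[i] := Complex (cos t) (sin t).

Definition mxdot m n (x y : 'M[R]_(m, n)) : R := \sum_i \sum_j x i j * y i j.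

(* The Euclidean norm: the norm `|x| of the library on matrices is the
   maximum norm. *)
Definition enorm m n (x : 'M[R]_(m, n)) : R := Num.sqrt (mxdot x x).

Definition japan n (y : 'rV[R]_n) : R := Num.sqrt (1 + enorm y ^+ 2).

Definition cintegral m n (f : 'M[R]_(m, n) -> R[i]) : R[i] :=
  Complex (\int[lebesgue_mx R m n]_x complex.Re (f x))
          (\int[lebesgue_mx R m n]_x complex.Im (f x)).

Definition cmeasurable m n (f : 'M[R]_(m, n) -> R[i]) : Prop :=
  measurable_fun setT (fun x => complex.Re (f x) : measurableTypeR R) /\
  measurable_fun setT (fun x => complex.Im (f x) : measurableTypeR R).

Definition cLnorm m n p (f : 'M[R]_(m, n) -> R[i]) : \bar R :=
  Lnorm (lebesgue_mx R m n) p (fun x => (cmod (f x))%:E).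

Definition pderiv m n (l : seq ('I_m * 'I_n)) (f : 'M[R]_(m, n) -> R) :
    'M[R]_(m, n) -> R :=
  foldr (fun k g x => 'D_(delta_mx k.1 k.2) g x) f l.

Definition smooth m n (f : 'M[R]_(m, n) -> R) : Prop :=
  forall l, continuous (pderiv l f) /\
    forall x i j, derivable (pderiv l f) x (delta_mx i j).

Definition csmooth m n (f : 'M[R]_(m, n) -> R[i]) : Prop :=
  smooth (fun x => complex.Re (f x)) /\ smooth (fun x => complex.Im (f x)).

Definition cpderiv m n (l : seq ('I_m * 'I_n)) (f : 'M[R]_(m, n) -> R[i])
    (x : 'M[R]_(m, n)) : R[i] :=
  Complex (pderiv l (fun y => complex.Re (f y)) x) (pderiv l (fun y => complex.Im (f y)) x).

Definition schwartz m n (f : 'M[R]_(m, n) -> R[i]) : Prop :=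
  csmooth f /\
  forall (k : nat) l, exists B : R, forall x,
    (1 + enorm x) ^+ k * cmod (cpderiv l f x) <= B.

Definition fourier m n (f : 'M[R]_(m, n) -> R[i]) (xi : 'M[R]_(m, n)) : R[i] :=
  cintegral (fun x => f x * expi (- (2 * pi * mxdot x xi))).

Definition square_integrable m n (f : 'M[R]_(m, n) -> R[i]) : Prop :=
  cmeasurable f /\ (cLnorm 2%:E f < +oo)%E.

(* The Fourier transform on L^2 is the one of tempered distributions, defined
   by duality with Schwartz functions. It is not given by an absolutely
   convergent integral and is determined only up to a null set, whence a
   relation. *)
Definition is_fourierL2 m n (f g : 'M[R]_(m, n) -> R[i]) : Prop :=
  [/\ square_integrable f, square_integrable g &
      forall phi, schwartz phi ->
        cintegral (fun x => f x * fourier phi x) =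
        cintegral (fun x => g x * phi x)].

(* As all s_i are positive, an f whose Fourier transform has finite weighted L^2 norm
   is in L^2. The set below is empty, with infimum +oo, when f is not in L^2;
   otherwise it is a singleton, the Fourier transform being unique up to a
   null set. *)
Definition Wnorm m n (s : 'I_m -> R) (f : 'M[R]_(m, n) -> R[i]) : \bar R :=
  ereal_inf [set N | exists2 g, is_fourierL2 f g &
    N = Lnorm (lebesgue_mx R m n) 2%:E
          (fun y => (cmod (g y) * \prod_i japan (row i y) `^ s i)%:E)].

Definition in_W m n (s : 'I_m -> R) (f : 'M[R]_(m, n) -> R[i]) : Prop :=
  (Wnorm s f < +oo)%E.

Definition multiplier_op m n (sigma : 'M[R]_(m, n) -> R[i])
    (f : 'I_m -> 'rV[R]_n -> R[i]) (x : 'rV[R]_n) : R[i] :=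
  cintegral (fun xi : 'M[R]_(m, n) =>
    expi (2 * pi * mxdot x (\sum_i row i xi)) * sigma xi *
    \prod_i fourier (f i) (row i xi)).

Definition dilate n (Phi : 'rV[R]_n -> R[i]) (t : R) (x : 'rV[R]_n) : R[i] :=
  Complex (t ^- n) 0 * Phi (t^-1 *: x).

Definition convolution n (f g : 'rV[R]_n -> R[i]) (x : 'rV[R]_n) : R[i] :=
  cintegral (fun y => f (x - y) * g y).

Definition maximal n (Phi f : 'rV[R]_n -> R[i]) (x : 'rV[R]_n) : \bar R :=
  ereal_sup [set (cmod (convolution (dilate Phi t) f x))%:E
            | t in [set t : R | 0 < t]].

Definition Hnorm n (Phi : 'rV[R]_n -> R[i]) p (f : 'rV[R]_n -> R[i]) : \bar R :=
  if (p <= 1)%E then Lnorm (lebesgue_mx R 1 n) p (maximal Phi f)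
  else cLnorm p f.

(* A smooth psi whose Fourier transform is smooth with compact support is a
   Schwartz function, so that `fourier psi` is an absolutely convergent
   integral. The sum over j has finite support when xi != 0, by the support condition. *)
Definition dyadic_cutoff m n (psi : 'M[R]_(m, n) -> R[i]) : Prop :=
  [/\ schwartz psi,
      csmooth (fourier psi),
      forall xi, fourier psi xi != 0 ->
        2 `^ (- (3 / 4)) <= enorm xi <= 2 `^ (3 / 4),
      forall xi, 2 `^ (- (1 / 4)) <= enorm xi <= 2 `^ (1 / 4) ->
        fourier psi xi = 1 &
      exists2 c : R[i], c != 0 & forall xi, xi != 0 ->
        \sum_(j \in [set: int]) fourier psi ((2%:R ^ (- j)) *: xi) = c].

Definition sup_Wnorm m n (psi : 'M[R]_(m, n) -> R[i]) (s : 'I_m -> R)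
    (sigma : 'M[R]_(m, n) -> R[i]) : \bar R :=
  ereal_sup [set Wnorm s (fun xi => sigma ((2%:R ^ j) *: xi) * fourier psi xi)
            | j in [set: int]].

End analysis.

(* Main.v *)
(* Fix i0, a set J not containing i0 and N = 2^k, put S = i0 |: J, and let a be
   the point of (R^n)^m all of whose coordinates are alpha, with m n alpha^2 = 1,
   so that |a| = 1. Let sigma be the product of a bump of width delta in
   sum_(i in S) (xi_i - N a_i) and of bumps of width N delta in the xi_i - N a_i,
   i <> i0. Only the dyadic piece of sigma at scale N is nonzero. In the
   coordinates in which the first bump depends on one block only, its Fourier
   transform is a product, and the W-norm of this piece is
   O(N^(sum_(i in S) s_i - n/2)).
   Let f_i be a Gaussian wave packet of width w_i and frequency N a_i, to which
   a second difference of step about 1 / N has been applied many times. The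
   differences make the H^(p_i) (quasi-)norm O(w_i^(n / p_i)) however small p_i
   is, while the Fourier transform of f_i stays nonnegative. Hence, up to a
   unimodular factor, the integrand of T_sigma(f)(x) is nonnegative for x = 0
   and has nearly constant phase for |x| <= rho, whence
   |T_sigma(f)(x)| >= c w_i0^n there, with rho and c independent of N.
   Letting N go to infinity with J empty and w = 1 gives s_i0 >= n/2; taking
   w_i = 1 / N on S and w_i = 1 elsewhere gives the condition on S. *)

Require Import Defs.
From mathcomp Require Import all_boot all_order all_algebra.
From mathcomp Require Import all_classical all_reals all_analysis complex.
From mathcomp Require Import measurable_realfun ess_sup_inf.
From mathcomp Require Import ring lra.

Set Implicit Arguments.
Unset Strict Implicit.
Unset Printing Implicit Defensive.

Import Order.TTheory GRing.Theory Num.Theory.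
Import numFieldNormedType.Exports.

Local Open Scope classical_set_scope.
Local Open Scope ring_scope.

(** * Lebesgue measure on matrices *)

(** Only the sum of the frequencies enters the phase in [x], so [T_sigma(f)] stays large on a fixed
    cube as soon as that sum is confined to a bounded set, while each [xi_i] with [i] in [S] may
    spread over a region of size N. Rescaled to unit frequency, this confinement is a bump of width
    1/N in one block of the sheared coordinates. Its transform has height N^-n on a region of size
    N, hence L^2 norm of order N^(-n/2); and in the dual coordinates every [y_i] with [i] in [S]
    contains the long block, whence the weight N^(sum of the [s_i]). A Gaussian packet has nonzero
    integral, so it lies in no H^p with p <= 1. The differences give its transform a zero of order
    2M at the origin; their multiplier is a power of a squared sine, so positivity is kept. Finite
    orders suffice: the smoothness K of the bumps is chosen from the [s_i], the number M of
    differences from the [p_i]. For w_i = 1/N on [S] the tested estimate reads N^-n <= B N^(sum s_i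
    - n/2 - n sum 1/p_i), sums over [S]. *)

Section measure_preserving.
Context d1 d2 (X : measurableType d1) (Y : measurableType d2) (R : realType).
Variables (mu : {measure set X -> \bar R}) (nu : {measure set Y -> \bar R}).
Variable phi : X -> Y.
Hypothesis mphi : measurable_fun setT phi.
Hypothesis muphi : forall A, measurable A -> mu (phi @^-1` A) = nu A.

Lemma ge0_integral_preserving (f : Y -> \bar R) :
  measurable_fun setT f -> (forall x, 0 <= f x)%E ->
  (\int[mu]_x f (phi x) = \int[nu]_x f x)%E.
Proof.
move=> mf f0; have := @ge0_integral_pushforward _ _ _ _ _ phi mphi mu setT f.
rewrite preimage_setT => <-//.
by apply: eq_measure_integral => A mA _; exact: muphi.
Qed.

Lemma integral_preserving (f : Y -> \bar R) :
  measurable_fun setT f -> (\int[mu]_x f (phi x) = \int[nu]_x f x)%E.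
Proof.
move=> mf; rewrite integralE [in RHS]integralE; congr (_ - _)%E.
  rewrite -(@ge0_integral_preserving f^\+%E)//.
    by apply: eq_integral => x _; rewrite !funeposE.
  exact/measurable_funepos.
rewrite -(@ge0_integral_preserving f^\-%E)//.
  by apply: eq_integral => x _; rewrite !funenegE.
exact/measurable_funeneg.
Qed.

Lemma Rintegral_preserving (f : Y -> R) :
  measurable_fun setT f -> \int[mu]_x f (phi x) = \int[nu]_x f x.
Proof.
by move=> mf; rewrite /Rintegral -integral_preserving//; exact/measurable_EFinP.
Qed.

Lemma integrable_preserving (f : Y -> \bar R) : measurable_fun setT f ->
  mu.-integrable setT (f \o phi) <-> nu.-integrable setT f.
Proof.
move=> mf; have mfp : measurable_fun setT (f \o phi) by exact: measurableT_comp.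
have E : (\int[mu]_x `|f (phi x)| = \int[nu]_x `|f x|)%E.
  have maf : measurable_fun setT (abse \o f) by exact: measurableT_comp.
  exact: (ge0_integral_preserving maf (fun x => abse_ge0 (f x))).
by split=> /integrableP[_ h]; apply/integrableP; split => //;
  move: h; rewrite /= E.
Qed.

End measure_preserving.

Lemma ler_mx_norm_entry (R : realType) m n (M : 'M[R]_(m, n)) i j :
  `|M i j| <= `|M|.
Proof.
rewrite -[`|M|]/(mx_norm M) mx_normrE.
exact: (@le_bigmax _ _ _ 0 (fun k : 'I_m * 'I_n => `|M k.1 k.2|) (i, j)).
Qed.

Section mx_measurable.
Variables (R : realType) (m n : nat).
Local Notation RM := (measurableTypeR R).

Lemma measurable_entry i j :
  measurable_fun setT (fun M : 'M[R]_(m, n) => M i j : RM).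
Proof.
move=> _ A mA; rewrite setTI; apply: sub_sigma_algebra.
by exists i, j; exists A.
Qed.

Lemma measurable_mxP d (T : measurableType d) (f : T -> 'M[R]_(m, n)) :
  (forall i j, measurable_fun setT (fun x => f x i j : RM)) ->
  measurable_fun setT f.
Proof.
move=> mf; apply: (@measurability _ _ _ _ setT _ (@mx_cylinders R m n)) => //.
move=> _ [_ [i [j [A mA ->]]] <-]; exact: mf.
Qed.

Definition mx_box (A : 'I_m -> 'I_n -> set RM) : set 'M[R]_(m, n) :=
  [set M | forall i j, A i j (M i j)].

Definition mx_boxes : set (set 'M[R]_(m, n)) :=
  [set B | exists2 A, (forall i j, measurable (A i j)) & B = mx_box A].

Lemma measurable_mx_box A : (forall i j, measurable (A i j)) ->
  measurable (mx_box A).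
Proof.
move=> mA; rewrite (_ : mx_box A = \bigcap_(i in [set: 'I_m])
    \bigcap_(j in [set: 'I_n]) ((fun M : 'M[R]_(m, n) => M i j : RM) @^-1` A i j)).
  apply: fin_bigcap_measurable => // i _; apply: fin_bigcap_measurable => // j _.
  by rewrite -[X in measurable X]setTI; exact: measurable_entry.
apply/seteqP; split => M /= H.
  by move=> i _ j _; exact: H.
by move=> i j; exact: H.
Qed.

Lemma lebesgue_mx_boxE A : (forall i j, measurable (A i j)) ->
  lebesgue_mx R m n (mx_box A) = (\prod_i \prod_j lebesgue_measure (A i j))%E.
Proof. exact: lebesgue_mx_box. Qed.

Lemma mx_boxesE : measurable = <<s mx_boxes >>.
Proof.
apply/seteqP; split => [A|A].
  apply: smallest_sub; first exact: smallest_sigma_algebra.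
  move=> _ [i [j [B mB ->]]]; apply: sub_sigma_algebra.
  exists (fun k l => if (k == i) && (l == j) then B else setT).
    by move=> k l; case: ifP.
  apply/seteqP; split => M /=.
    by move=> MB k l /=; case: ifPn => // /andP[/eqP -> /eqP ->].
  by move=> /(_ i j); rewrite !eqxx.
apply: smallest_sub; first exact: sigma_algebra_measurable.
by move=> _ [B mB ->]; exact: measurable_mx_box.
Qed.

(** Boxes form a generating pi-system exhausted by the cubes [-k, k] of finite measure. This settles
    maps that pull boxes back to boxes, such as translations; shears do not, and need the averaging
    argument of [lebesgue_mx_shear]. *)
Lemma lebesgue_mx_unique (mu : {measure set 'M[R]_(m, n) -> \bar R}) :
  (forall A, (forall i j, measurable (A i j)) ->
     mu (mx_box A) = (\prod_i \prod_j lebesgue_measure (A i j))%E) ->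
  forall X, measurable X -> mu X = lebesgue_mx R m n X.
Proof.
move=> muE X mX; apply/esym.
pose g k : set 'M[R]_(m, n) := mx_box (fun _ _ => `[- k%:R, k%:R]%classic).
apply: (@measure_unique _ _ _ mx_boxes g) => //.
- exact: mx_boxesE.
- move=> _ _ [A mA ->] [B mB ->]; exists (fun i j => A i j `&` B i j).
    by move=> i j; exact: measurableI.
  apply/seteqP; split => M /=; first by move=> [MA MB] i j; split.
  by move=> MAB; split => i j; have [] := MAB i j.
- by move=> k; exists (fun _ _ => `[- k%:R, k%:R]%classic).
- apply/seteqP; split => // M _.
  exists (Num.bound `|M|) => // i j /=; rewrite in_itv /= -ler_norml.
  by rewrite (le_trans (ler_mx_norm_entry _ _ _))// ltW// archi_boundP.
- by move=> _ [A mA ->]; rewrite [RHS]muE//; exact: lebesgue_mx_boxE.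
- move=> k; apply: (@le_lt_trans _ _ (\prod_(i < m) \prod_(j < n)
      lebesgue_measure `[(- k%:R)%R, k%:R : R]%classic)%E).
    by rewrite -lebesgue_mx_boxE.
  suff -> : (\prod_(i < m) \prod_(j < n)
      lebesgue_measure `[(- k%:R)%R, k%:R : R]%classic)%E =
      (\prod_(i < m) \prod_(j < n) (k%:R - - k%:R))%:E by rewrite ltry.
  rewrite -prodEFin; apply: eq_bigr => i _; rewrite -prodEFin.
  apply: eq_bigr => j _; rewrite lebesgue_measure_itv /= lte_fin.
  (* For k = 0 the interval is a point; the degenerate branch of the length formula then agrees with
     k - (-k). *)
  case: ltP => // k0; have /eqP -> : k%:R == 0 :> R by rewrite eq_le ler0n; lra.
  by rewrite oppr0 subrr.
Qed.

End mx_measurable.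

Section translation.
Variables (R : realType).
Local Notation RM := (measurableTypeR R).

Lemma lebesgue_measureD (t : R) (A : set RM) : measurable A ->
  lebesgue_measure ((fun x => x + t) @^-1` A) = lebesgue_measure A.
Proof.
move=> mA; have mt : measurable_fun setT ((fun x => x + t) : RM -> RM).
  exact: measurable_funD.
apply/esym/(@lebesgue_measure_unique R (measure_function_pushforward__canonical__measure_function_Measure lebesgue_measure mt)) => //.
move=> _ [[a b] _ <-] /=; rewrite /pushforward.
rewrite (_ : _ @^-1` _ = `]a - t, b - t]%classic); last first.
  apply/seteqP; split => x /=; rewrite !in_itv /=; lra.
rewrite !lebesgue_measure_itv /= !lte_fin ltrD2r; case: ifP => // _.
by rewrite -!EFinD; congr EFin; ring.
Qed.

Lemma lebesgue_mxD m n (T : 'M[R]_(m, n)) A : measurable A ->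
  lebesgue_mx R m n ((fun M => M + T) @^-1` A) = lebesgue_mx R m n A.
Proof.
have mT : measurable_fun setT (fun M : 'M[R]_(m, n) => M + T).
  apply: measurable_mxP => i j; under eq_fun do rewrite mxE.
  by apply: measurable_funD => //; exact: measurable_entry.
move=> mA; apply: (@lebesgue_mx_unique R m n (measure_function_pushforward__canonical__measure_function_Measure (lebesgue_mx R m n) mT)) => // B mB.
rewrite /= /pushforward (_ : _ @^-1` _ =
    mx_box (fun i j => (fun x => x + T i j) @^-1` B i j)); last first.
  by apply/seteqP; split => M /= H i j; have := H i j; rewrite mxE.
rewrite lebesgue_mx_boxE.
  by apply: eq_bigr => i _; apply: eq_bigr => j _; exact: lebesgue_measureD.
move=> i j; rewrite -[X in measurable X]setTI.
have mt : measurable_fun setT ((fun x => x + T i j) : RM -> RM).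
  exact: measurable_funD.
exact: mt.
Qed.

Lemma measurable_addmx d (X : measurableType d) m n (f g : X -> 'M[R]_(m, n)) :
  measurable_fun setT f -> measurable_fun setT g ->
  measurable_fun setT (fun x => f x + g x).
Proof.
move=> mf mg; apply: measurable_mxP => i j; under eq_fun do rewrite mxE.
apply: measurable_funD.
  exact: (measurableT_comp (measurable_entry i j)).
exact: (measurableT_comp (measurable_entry i j)).
Qed.

Lemma measurable_mulmx d (X : measurableType d) m n k (U : 'M[R]_(k, m))
    (f : X -> 'M[R]_(m, n)) :
  measurable_fun setT f -> measurable_fun setT (fun x => U *m f x).
Proof.
move=> mf; apply: measurable_mxP => i j; under eq_fun do rewrite mxE.
apply: measurable_sum => l; apply: measurable_funM => //.
exact: (measurableT_comp (measurable_entry l j)).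
Qed.

End translation.

(** * Invariance of Lebesgue measure under shears *)

Section shear.
Variables (R : realType) (m n : nat).
Notation mu := (lebesgue_mx R m n).
Variables (U D : 'M[R]_m).
(** [D] fixes the range of [U] and [U] kills the range of [D]: the rows changed by the shear are not
    among those it reads. Hence [U] has square zero, and translations by [D *m T] commute with the
    shear. *)
Hypotheses (DU : D *m U = U) (UD : U *m D = 0).

Definition unit_box : set 'M[R]_(m, n) := mx_box (fun _ _ => `[0, 1]%classic).

Lemma measurable_unit_box : measurable unit_box.
Proof. exact: measurable_mx_box. Qed.

Lemma lebesgue_unit_box : mu unit_box = 1%E.
Proof.
rewrite lebesgue_mx_boxE// big1// => i _; rewrite big1// => j _.
by rewrite lebesgue_measure_itv /= lte_fin ltr01 sube0.
Qed.

(* Average the integral over the translations by D *m T, which change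
   neither U *m M nor the Lebesgue measure, T ranging over the unit box. *)
Lemma lebesgue_mx_shear A : measurable A ->
  mu ((fun M => M + U *m M) @^-1` A) = mu A.
Proof.
move=> mA.
pose F : 'M[R]_(m, n) -> \bar R := fun M => (\1_A M)%:E.
pose w : 'M[R]_(m, n) -> \bar R := fun M => (\1_unit_box M)%:E.
have mF : measurable_fun setT F by exact/measurable_EFinP/measurable_indic.
have mw : measurable_fun setT w.
  by apply/measurable_EFinP; apply: measurable_indic; exact: measurable_unit_box.
have F0 M : (0 <= F M)%E by rewrite lee_fin.
have w0 M : (0 <= w M)%E by rewrite lee_fin.
have mU : measurable_fun setT (fun M : 'M[R]_(m, n) => M + U *m M).
  by apply: measurable_addmx => //; exact: measurable_mulmx.
have intF : (\int[mu]_M F M = mu A)%E.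
  by rewrite integral_indic// setIT.
have intw T : (\int[mu]_M w (M + T)%R = 1)%E.
  have mT : measurable_fun setT (fun M : 'M[R]_(m, n) => M + T).
    exact: measurable_addmx.
  rewrite (ge0_integral_preserving mT (@lebesgue_mxD _ _ _ T) mw w0).
  by rewrite integral_indic ?setIT; [exact: lebesgue_unit_box|..|exact: measurable_unit_box].
transitivity (\int[mu]_M F (M + U *m M)%R)%E.
  rewrite -[X in mu X]setIT -integral_indic//.
  by rewrite -[X in measurable X]setTI; exact: mU.
have mFU : measurable_fun setT (fun M : 'M[R]_(m, n) => F (M + U *m M)%R).
  exact: (measurableT_comp mF).
have mTr (T : 'M[R]_(m, n)) : measurable_fun setT (fun M : 'M[R]_(m, n) => M + T).
  exact: measurable_addmx.
have trE (f : 'M[R]_(m, n) -> \bar R) T : measurable_fun setT f ->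
    (forall M, 0 <= f M)%E -> (\int[mu]_M f (M + T)%R = \int[mu]_M f M)%E.
  by move=> mf f0; exact: (ge0_integral_preserving (mTr T) (@lebesgue_mxD _ _ _ T) mf f0).
have m1 : measurable_fun setT (fun z : 'M[R]_(m, n) * 'M[R]_(m, n) =>
    w z.2 * F (z.1 + D *m z.2 + U *m z.1)%R)%E.
  apply: emeasurable_funM; first exact: (measurableT_comp mw).
  apply: (measurableT_comp mF).
  apply: measurable_addmx; last exact: measurable_mulmx.
  by apply: measurable_addmx => //; exact: measurable_mulmx.
have m2 : measurable_fun setT (fun z : 'M[R]_(m, n) * 'M[R]_(m, n) =>
    w (z.2 - U *m z.1)%R * F (z.1 + D *m z.2)%R)%E.
  apply: emeasurable_funM.
    apply: (measurableT_comp mw); under eq_fun do rewrite -mulNmx.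
    by apply: measurable_addmx => //; exact: measurable_mulmx.
  apply: (measurableT_comp mF).
  by apply: measurable_addmx => //; exact: measurable_mulmx.
have m3 : measurable_fun setT (fun z : 'M[R]_(m, n) * 'M[R]_(m, n) =>
    w (z.2 - U *m z.1)%R * F z.1)%E.
  apply: emeasurable_funM; last exact: (measurableT_comp mF).
  apply: (measurableT_comp mw); under eq_fun do rewrite -mulNmx.
  by apply: measurable_addmx => //; exact: measurable_mulmx.
rewrite -intF.
(* As [U D = 0], translating [M] by [D *m T] leaves [U *m M] alone, so the inner integral of [F]
   does not depend on [T] and averaging against [w] changes nothing. *)
transitivity (\int[mu]_T \int[mu]_M (w T * F (M + D *m T + U *m M)%R))%E.
  rewrite -[LHS]mul1e -(intw 0) -ge0_integralZr//.
    apply: eq_integral => T _; rewrite addr0 ge0_integralZl//.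
      congr (_ * _)%E; rewrite -(trE _ (D *m T))//; apply: eq_integral => M _.
      by rewrite mulmxDr mulmxA UD mul0mx addr0.
    apply: (measurableT_comp mF); apply: measurable_addmx; last exact: measurable_mulmx.
    exact: measurable_addmx.
  - by under eq_fun do rewrite addr0.
  - exact: integral_ge0.
transitivity (\int[mu]_M \int[mu]_T (w T * F (M + D *m T + U *m M)%R))%E.
  apply/esym; refine (@fubini_tonelli _ _ _ _ R mu mu (fun z => w z.2 * F (z.1 + D *m z.2 + U *m z.1)%R)%E _ _) => //.
  by move=> z; rewrite mule_ge0.
(* Replacing [T] by [T - U *m M] subtracts exactly [U *m M] inside [F], because [D U = U]: the shear
   leaves [F] and survives only in the weight. *)
transitivity (\int[mu]_M \int[mu]_T (w (T - U *m M)%R * F (M + D *m T)%R))%E.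
  apply: eq_integral => M _.
  rewrite -[RHS](trE _ (U *m M)).
  - apply: eq_integral => T _; rewrite addrK mulmxDr mulmxA DU addrA.
    by [].
  - exact: (measurable_fun_pair2 M m2).
  - by move=> T; rewrite mule_ge0.
transitivity (\int[mu]_T \int[mu]_M (w (T - U *m M)%R * F (M + D *m T)%R))%E.
  refine (@fubini_tonelli _ _ _ _ R mu mu (fun z => w (z.2 - U *m z.1)%R * F (z.1 + D *m z.2)%R)%E _ _) => //.
  by move=> z; rewrite mule_ge0.
(* Replacing [M] by [M - D *m T] removes the translation from [F] without touching the weight, again
   by [U D = 0]. *)
transitivity (\int[mu]_T \int[mu]_M (w (T - U *m M)%R * F M))%E.
  apply: eq_integral => T _.
  rewrite -[RHS](trE _ (D *m T)).
  - by apply: eq_integral => M _; rewrite mulmxDr mulmxA UD mul0mx addr0.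
  - exact: (measurable_fun_pair1 T m3).
  - by move=> M; rewrite mule_ge0.
transitivity (\int[mu]_M \int[mu]_T (w (T - U *m M)%R * F M))%E.
  apply/esym; refine (@fubini_tonelli _ _ _ _ R mu mu (fun z => w (z.2 - U *m z.1)%R * F z.1)%E _ _) => //.
  by move=> z; rewrite mule_ge0.
apply: eq_integral => M _; rewrite ge0_integralZr//.
  by rewrite intw mul1e.
exact: (measurableT_comp mw).
Qed.

End shear.

(** * Complex-valued integrals *)

Section complex_integral.
Context d (T : measurableType d) (R : realType) (mu : {measure set T -> \bar R}).
Implicit Types f g : T -> R[i].

Definition cint f : R[i] :=
  Complex (\int[mu]_x complex.Re (f x)) (\int[mu]_x complex.Im (f x)).

Definition cintegrable f : Prop :=
  mu.-integrable setT (fun x => (complex.Re (f x))%:E) /\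
  mu.-integrable setT (fun x => (complex.Im (f x))%:E).

Lemma cmodE (z : R[i]) :
  cmod z = Num.sqrt (complex.Re z ^+ 2 + complex.Im z ^+ 2).
Proof. by case: z. Qed.

Lemma ReM (z w : R[i]) : complex.Re (z * w) =
  complex.Re z * complex.Re w - complex.Im z * complex.Im w.
Proof. by case: z; case: w. Qed.

Lemma ImM (z w : R[i]) : complex.Im (z * w) =
  complex.Re z * complex.Im w + complex.Im z * complex.Re w.
Proof. by case: z; case: w. Qed.

Lemma ReD (z w : R[i]) : complex.Re (z + w) = complex.Re z + complex.Re w.
Proof. by case: z; case: w. Qed.

Lemma ImD (z w : R[i]) : complex.Im (z + w) = complex.Im z + complex.Im w.
Proof. by case: z; case: w. Qed.

Lemma cmodM (z w : R[i]) : cmod (z * w) = cmod z * cmod w.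
Proof. exact: ComplexField.Normc.normcM. Qed.

Lemma cmod_ge0 (z : R[i]) : 0 <= cmod z.
Proof. by case: z => a b; exact: sqrtr_ge0. Qed.

Lemma ler_cmodD (z w : R[i]) : cmod (z + w) <= cmod z + cmod w.
Proof. exact: le_normcD. Qed.

Lemma ler_Re_cmod (z : R[i]) : `|complex.Re z| <= cmod z.
Proof. by rewrite cmodE -sqrtr_sqr ler_sqrt ?addr_ge0 ?sqr_ge0// lerDl sqr_ge0. Qed.

Lemma ler_Im_cmod (z : R[i]) : `|complex.Im z| <= cmod z.
Proof. by rewrite cmodE -sqrtr_sqr ler_sqrt ?addr_ge0 ?sqr_ge0// lerDr sqr_ge0. Qed.

Lemma ler_cmod_ReIm (z : R[i]) : cmod z <= `|complex.Re z| + `|complex.Im z|.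
Proof.
rewrite cmodE -[leRHS]ger0_norm ?addr_ge0// -sqrtr_sqr ler_sqrt ?sqr_ge0//.
rewrite sqrrD !real_normK ?num_real// lerD2r lerDl.
by rewrite mulrn_wge0// mulr_ge0.
Qed.

Lemma cmod_real (x : R) : cmod (Complex x 0) = `|x|.
Proof. by rewrite cmodE /= expr0n addr0 sqrtr_sqr. Qed.

Lemma cmod_expi (t : R) : cmod (expi t) = 1.
Proof. by rewrite cmodE /= cos2Dsin2 sqrtr1. Qed.

Lemma expiD (s t : R) : expi (s + t) = expi s * expi t.
Proof.
by apply/eqP; rewrite eq_complex ReM ImM /= cosD sinD !eqxx /= addrC mulrC [sin t * _]mulrC.
Qed.

Lemma expi0 : expi 0 = 1 :> R[i].
Proof. by rewrite /expi cos0 sin0. Qed.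

Definition cmfun f : Prop :=
  measurable_fun setT (fun x => complex.Re (f x)) /\
  measurable_fun setT (fun x => complex.Im (f x)).

Lemma cmfun_cst z : cmfun (fun=> z).
Proof. by split; exact: measurable_cst. Qed.

Lemma cmfunM f g : cmfun f -> cmfun g -> cmfun (fun x => f x * g x).
Proof.
move=> [mf1 mf2] [mg1 mg2]; split.
  under eq_fun do rewrite ReM.
  by apply: measurable_funB; apply: measurable_funM.
under eq_fun do rewrite ImM.
by apply: measurable_funD; apply: measurable_funM.
Qed.

Lemma cmfunD f g : cmfun f -> cmfun g -> cmfun (fun x => f x + g x).
Proof.
move=> [mf1 mf2] [mg1 mg2]; split.
  by under eq_fun do rewrite ReD; apply: measurable_funD.
by under eq_fun do rewrite ImD; apply: measurable_funD.
Qed.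

Lemma cmfun_prod (I : Type) (r : seq I) (P : pred I) (F : I -> T -> R[i]) :
  (forall i, cmfun (F i)) -> cmfun (fun x => \prod_(i <- r | P i) F i x).
Proof.
move=> mF; elim: r => [|i r IH].
  by under eq_fun do rewrite big_nil; exact: cmfun_cst.
have -> : (fun x => \prod_(j <- i :: r | P j) F j x) =
   fun x => (if P i then F i x else 1) * \prod_(j <- r | P j) F j x.
  by apply/funext => x; rewrite big_cons; case: ifP => //; rewrite mul1r.
by apply: cmfunM => //; case: (P i) => //; exact: cmfun_cst.
Qed.

Lemma cmfun_expi (h : T -> R) : measurable_fun setT h -> cmfun (fun x => expi (h x)).
Proof.
by move=> mh; split => /=; apply: measurableT_comp => //;
  apply: continuous_measurable_fun; [exact: continuous_cos|exact: continuous_sin].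
Qed.

Lemma cmfun_real (h : T -> R) : measurable_fun setT h ->
  cmfun (fun x => Complex (h x) 0).
Proof. by move=> mh; split => //=; exact: measurable_cst. Qed.

Lemma measurable_cmod f : cmfun f -> measurable_fun setT (fun x => cmod (f x)).
Proof.
move=> [m1 m2]; under eq_fun do rewrite cmodE.
apply: (@measurableT_comp _ _ _ _ _ _ (@Num.sqrt R)).
  by apply: continuous_measurable_fun; exact: sqrt_continuous.
by apply: measurable_funD; apply: measurable_funX.
Qed.

Lemma cintegrable_cmfun f : cintegrable f -> cmfun f.
Proof.
by move=> [/integrableP[/measurable_EFinP m1 _] /integrableP[/measurable_EFinP m2 _]].
Qed.

Lemma cintegrable_le f (g : T -> R) : cmfun f ->
  mu.-integrable setT (EFin \o g) -> (forall x, cmod (f x) <= g x) ->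
  cintegrable f.
Proof.
move=> [m1 m2] ig fg; split; apply: (le_integrable measurableT _ _ ig) => //.
- exact/measurable_EFinP.
- move=> x _ /=; rewrite lee_fin (le_trans (ler_Re_cmod _))//.
  by rewrite (le_trans (fg x))// ler_norm.
- exact/measurable_EFinP.
- move=> x _ /=; rewrite lee_fin (le_trans (ler_Im_cmod _))//.
  by rewrite (le_trans (fg x))// ler_norm.
Qed.

Lemma cintegrable_cmod f : cintegrable f ->
  mu.-integrable setT (fun x => (cmod (f x))%:E).
Proof.
move=> fi; have [i1 i2] := fi.
apply: (le_integrable measurableT _ _ (integrableD measurableT
  (integrable_abse i1) (integrable_abse i2))).
  exact/measurable_EFinP/measurable_cmod/cintegrable_cmfun.
move=> x _ /=; rewrite lee_fin ger0_norm ?cmod_ge0// ger0_norm ?addr_ge0//.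
exact: ler_cmod_ReIm.
Qed.

Lemma cintegrableZ f z : cintegrable f -> cintegrable (fun x => z * f x).
Proof.
move=> fi; have ci := integrableZl measurableT (cmod z) (cintegrable_cmod fi).
apply: (@cintegrable_le _ (fun x => cmod z * cmod (f x))) => //.
  exact: cmfunM (cmfun_cst _) (cintegrable_cmfun fi).
by move=> x; rewrite cmodM.
Qed.

Lemma cintegrableD f g : cintegrable f -> cintegrable g ->
  cintegrable (fun x => f x + g x).
Proof.
move=> fi gi.
have ci := integrableD measurableT (cintegrable_cmod fi) (cintegrable_cmod gi).
apply: (@cintegrable_le _ (fun x => cmod (f x) + cmod (g x))) => //.
  exact: cmfunD (cintegrable_cmfun fi) (cintegrable_cmfun gi).
by move=> x; exact: ler_cmodD.
Qed.

Lemma cintD f g : cintegrable f -> cintegrable g ->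
  cint (fun x => f x + g x) = cint f + cint g.
Proof.
move=> [f1 f2] [g1 g2]; apply/eqP; rewrite eq_complex /=; apply/andP; split; apply/eqP.
  by under eq_Rintegral do rewrite ReD; rewrite RintegralD.
by under eq_Rintegral do rewrite ImD; rewrite RintegralD.
Qed.

Lemma cintZ f z : cintegrable f -> cint (fun x => z * f x) = z * cint f.
Proof.
move=> [f1 f2]; apply/eqP; rewrite eq_complex ReM ImM /=.
apply/andP; split; apply/eqP.
  under eq_Rintegral do rewrite ReM.
  rewrite RintegralB// ?RintegralZl//.
    exact: (integrableZl measurableT (complex.Re z) f1).
  exact: (integrableZl measurableT (complex.Im z) f2).
under eq_Rintegral do rewrite ImM.
rewrite RintegralD// ?RintegralZl//.
  exact: (integrableZl measurableT (complex.Re z) f2).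
exact: (integrableZl measurableT (complex.Im z) f1).
Qed.

Lemma eq_cint f g : f =1 g -> cint f = cint g.
Proof. by move=> /funext ->. Qed.

(** Real and imaginary parts are estimated separately, which produces the factor 2; constants are
    immaterial later. *)
Lemma cmod_cint_le f : cintegrable f ->
  ((cmod (cint f))%:E <= 2%:E * \int[mu]_x (cmod (f x))%:E)%E.
Proof.
move=> fi; have [i1 i2] := fi; have ic := cintegrable_cmod fi.
rewrite -[X in (_ * X)%E]fineK; last exact: integrable_fin_num.
rewrite -EFinM lee_fin (le_trans (ler_cmod_ReIm _))//= mulrDl !mul1r lerD//.
  rewrite (le_trans (le_normr_Rintegral _ _))//; apply: le_Rintegral => //.
    exact: (integrable_abse i1).
  by move=> x _; exact: ler_Re_cmod.
rewrite (le_trans (le_normr_Rintegral _ _))//; apply: le_Rintegral => //.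
  exact: (integrable_abse i2).
by move=> x _; exact: ler_Im_cmod.
Qed.

End complex_integral.

Section complex_preserving.
Context d1 d2 (X : measurableType d1) (Y : measurableType d2) (R : realType).
Variables (mu : {measure set X -> \bar R}) (nu : {measure set Y -> \bar R}).
Variable phi : X -> Y.
Hypothesis mphi : measurable_fun setT phi.
Hypothesis muphi : forall A, measurable A -> mu (phi @^-1` A) = nu A.

Lemma cint_preserving (f : Y -> R[i]) : cmfun f ->
  cint mu (fun x => f (phi x)) = cint nu f.
Proof.
move=> [m1 m2]; rewrite /cint.
by rewrite (Rintegral_preserving mphi muphi m1) (Rintegral_preserving mphi muphi m2).
Qed.

Lemma cintegrable_preserving (f : Y -> R[i]) : cmfun f ->
  cintegrable mu (fun x => f (phi x)) <-> cintegrable nu f.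
Proof.
move=> [/measurable_EFinP m1 /measurable_EFinP m2].
have [a1 b1] := integrable_preserving mphi muphi m1.
have [a2 b2] := integrable_preserving mphi muphi m2.
split=> -[i1 i2]; split; [exact: a1|exact: a2|exact: b1|exact: b2].
Qed.

End complex_preserving.

(** * Integrals of tensor products *)

Section tensor.
Context d1 d2 (X : measurableType d1) (Y : measurableType d2) (R : realType).
Variables (m1 : {sigma_finite_measure set X -> \bar R}).
Variables (m2 : {sigma_finite_measure set Y -> \bar R}).

Lemma ge0_integral_tensor (f : X -> \bar R) (g : Y -> \bar R) :
  measurable_fun setT f -> measurable_fun setT g ->
  (forall x, 0 <= f x)%E -> (forall y, 0 <= g y)%E ->
  (\int[m1 \x m2]_z (f z.1 * g z.2) = \int[m1]_x f x * \int[m2]_y g y)%E.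
Proof.
move=> mf mg f0 g0; rewrite (fubini_tonelli1 (fun z => f z.1 * g z.2)%E)/=; last 2 first.
- apply: emeasurable_funM; first exact: (measurableT_comp mf).
  exact: (measurableT_comp mg).
- by move=> z; rewrite mule_ge0.
rewrite -(ge0_integralZr _ measurableT mf)//; last exact: integral_ge0.
by apply: eq_integral => x _; rewrite /fubini_F/= (ge0_integralZl _ measurableT mg).
Qed.

Lemma integrable_tensor (f : X -> R) (g : Y -> R) :
  m1.-integrable setT (EFin \o f) -> m2.-integrable setT (EFin \o g) ->
  (m1 \x m2)%E.-integrable setT (fun z => (f z.1 * g z.2)%:E).
Proof.
move=> /integrableP[mf fi] /integrableP[mg gi].
have mf' : measurable_fun setT f by exact/measurable_EFinP.
have mg' : measurable_fun setT g by exact/measurable_EFinP.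
apply/integrableP; split.
  apply/measurable_EFinP/measurable_funM.
    exact: (measurableT_comp mf').
  exact: (measurableT_comp mg').
under eq_integral do rewrite EFinM abseM.
rewrite (@ge0_integral_tensor (fun x => `|(f x)%:E|)%E (fun x => `|(g x)%:E|)%E)//.
- by rewrite lte_mul_pinfty//; [exact: integral_ge0|rewrite ge0_fin_numE//; exact: integral_ge0].
- exact: measurableT_comp.
- exact: measurableT_comp.
Qed.

Lemma Rintegral_tensor (f : X -> R) (g : Y -> R) :
  m1.-integrable setT (EFin \o f) -> m2.-integrable setT (EFin \o g) ->
  \int[(m1 \x m2)%E]_z (f z.1 * g z.2) = (\int[m1]_x f x) * (\int[m2]_y g y).
Proof.
move=> fi gi; rewrite /Rintegral -(integral12_prod_meas1 (integrable_tensor fi gi)) /=.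
have -> : (fun x => \int[m2]_y (f x * g y)%:E)%E =
          (fun x => (f x)%:E * (\int[m2]_y g y)%:E)%E.
  apply/funext => x; under eq_integral do rewrite EFinM.
  rewrite integralZl//; congr (_ * _)%E.
  by rewrite fineK//; exact: integrable_fin_num.
rewrite integralZr// fineM//; first exact: integrable_fin_num.
Qed.

Lemma cintegrable_tensor (f : X -> R[i]) (g : Y -> R[i]) :
  cintegrable m1 f -> cintegrable m2 g ->
  cintegrable (m1 \x m2)%E (fun z => f z.1 * g z.2).
Proof.
move=> fi gi; have [mf1 mf2] := cintegrable_cmfun fi.
have [mg1 mg2] := cintegrable_cmfun gi.
apply: cintegrable_le (integrable_tensor (cintegrable_cmod fi) (cintegrable_cmod gi)) _.
  apply: cmfunM; split.
  - exact: (measurableT_comp mf1).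
  - exact: (measurableT_comp mf2).
  - exact: (measurableT_comp mg1).
  - exact: (measurableT_comp mg2).
by move=> z; rewrite cmodM.
Qed.

Lemma cint_tensor (f : X -> R[i]) (g : Y -> R[i]) :
  cintegrable m1 f -> cintegrable m2 g ->
  cint (m1 \x m2)%E (fun z => f z.1 * g z.2) = cint m1 f * cint m2 g.
Proof.
move=> [f1 f2] [g1 g2]; apply/eqP; rewrite eq_complex ReM ImM.
apply/andP; split; apply/eqP.
  transitivity (\int[(m1 \x m2)%E]_z complex.Re (f z.1 * g z.2)) => //.
  under eq_Rintegral do rewrite ReM.
  rewrite (RintegralB _ (integrable_tensor f1 g1) (integrable_tensor f2 g2))//.
  by rewrite (Rintegral_tensor f1 g1) (Rintegral_tensor f2 g2).
transitivity (\int[(m1 \x m2)%E]_z complex.Im (f z.1 * g z.2)) => //.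
under eq_Rintegral do rewrite ImM.
rewrite (RintegralD _ (integrable_tensor f1 g2) (integrable_tensor f2 g1))//.
by rewrite (Rintegral_tensor f1 g2) (Rintegral_tensor f2 g1).
Qed.

End tensor.

Section tuple_tensor.
Variable R : realType.
Local Notation RM := (measurableTypeR R).
Local Notation leb := (@lebesgue_measure R).

Let tcons_preserving k A : measurable A ->
  sf_product leb (lebesgue_tuple R k) (@tcons R k @^-1` A) = lebesgue_tuple R k.+1 A.
Proof. by []. Qed.

Lemma ge0_integral_tuple_prod k (F : 'I_k -> RM -> \bar R) :
  (forall i, measurable_fun setT (F i)) -> (forall i x, 0 <= F i x)%E ->
  (\int[lebesgue_tuple R k]_t \prod_i F i (tnth t i) = \prod_i \int[leb]_x F i x)%E.
Proof.
elim: k F => [|k IH] F mF F0.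
  rewrite big_ord0; under eq_integral do rewrite big_ord0.
  by rewrite integral_cst//= diracT mule1.
have mprod : measurable_fun setT (fun t : k.+1.-tuple RM => \prod_i F i (tnth t i))%E.
  suff : forall (r : seq 'I_k.+1), measurable_fun setT
      (fun t : k.+1.-tuple RM => \prod_(i <- r) F i (tnth t i))%E by apply.
  elim=> [|i r IHr]; first by under eq_fun do rewrite big_nil; exact: measurable_cst.
  under eq_fun do rewrite big_cons; apply: emeasurable_funM => //.
  exact: (measurableT_comp (mF i) (measurable_tnth i)).
have mprod' : measurable_fun setT
    (fun t : k.-tuple RM => \prod_i F (lift ord0 i) (tnth t i))%E.
  suff : forall (r : seq 'I_k), measurable_fun setT
      (fun t : k.-tuple RM => \prod_(i <- r) F (lift ord0 i) (tnth t i))%E by apply.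
  elim=> [|i r IHr]; first by under eq_fun do rewrite big_nil; exact: measurable_cst.
  under eq_fun do rewrite big_cons; apply: emeasurable_funM => //.
  exact: (measurableT_comp (mF _) (measurable_tnth i)).
rewrite -(ge0_integral_preserving (@measurable_tcons R k) (@tcons_preserving k) mprod);
  last by move=> t; exact: prode_ge0.
rewrite big_ord_recl -IH//.
rewrite -(@ge0_integral_tensor _ _ _ _ _ leb (lebesgue_tuple R k))//.
  by apply: eq_integral => -[x t] _ /=; rewrite big_ord_recl; congr (_ * _)%E;
     apply: eq_bigr => i _; rewrite tnthS.
by move=> t; exact: prode_ge0.
Qed.

Lemma cint_tuple_prod k (F : 'I_k -> RM -> R[i]) :
  (forall i, cintegrable leb (F i)) ->
  cintegrable (lebesgue_tuple R k) (fun t => \prod_i F i (tnth t i)) /\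
  cint (lebesgue_tuple R k) (fun t => \prod_i F i (tnth t i)) =
    \prod_i cint leb (F i).
Proof.
elim: k F => [|k IH] F iF.
  have -> : (fun t : 0.-tuple RM => \prod_i F i (tnth t i)) = fun=> 1.
    by apply/funext => t; rewrite big_ord0.
  rewrite big_ord0; split.
    split => /=; exact: finite_measure_integrable_cst.
  transitivity (Complex (\int[lebesgue_tuple R 0]_t 1) (\int[lebesgue_tuple R 0]_t 0)) => //.
  rewrite !Rintegral_cst// mul0r mul1r; congr Complex.
  by rewrite -[RHS]/(fine 1%E); congr fine; exact: diracT.
have mprod : cmfun (fun t : k.+1.-tuple RM => \prod_i F i (tnth t i)).
  apply: cmfun_prod => i; have [m1 m2] := cintegrable_cmfun (iF i).
  by split; [exact: (measurableT_comp m1 (measurable_tnth i))|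
             exact: (measurableT_comp m2 (measurable_tnth i))].
have [i1 e1] := IH _ (fun i => iF (lift ord0 i)).
have E : (fun z => \prod_i F i (tnth (@tcons R k z) i)) =
   (fun z : RM * k.-tuple RM => F ord0 z.1 * \prod_i F (lift ord0 i) (tnth z.2 i)).
  apply/funext => -[x t]; rewrite big_ord_recl /=; congr (_ * _).
  by apply: eq_bigr => i _; rewrite tnthS.
split.
  apply/(cintegrable_preserving (@measurable_tcons R k) (@tcons_preserving k) mprod).
  by rewrite E; exact: (cintegrable_tensor (iF ord0) i1).
rewrite -(cint_preserving (@measurable_tcons R k) (@tcons_preserving k) mprod).
rewrite E big_ord_recl -e1.
exact: (cint_tensor (iF ord0) i1).
Qed.

End tuple_tensor.

Section mx_tensor.
Variables (R : realType) (m n : nat).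
Local Notation RM := (measurableTypeR R).
Local Notation leb := (@lebesgue_measure R).
Local Notation mu := (lebesgue_mx R m n).

Let mx_preserving A : measurable A ->
  lebesgue_tuple R (m * n) (@mx_of_tuple R m n @^-1` A) = mu A.
Proof. by []. Qed.

Lemma prod_mxvec (A : Type) (S : comPzSemiRingType) (F : 'I_m -> 'I_n -> A -> S)
    (c : 'I_(m * n) -> A) :
  \prod_i \prod_j F i j (c (mxvec_index i j)) =
  \prod_k mxvec (\matrix_(i, j) F i j) ord0 k (c k).
Proof.
rewrite pair_bigA /= [RHS](reindex _ (curry_mxvec_bij m n)) /=.
by apply: eq_bigr => -[i j] _ /=; rewrite mxvecE mxE.
Qed.

(** The packets, and the symbol after a shear, are products of functions of single entries; this
    reduces their Fourier transforms to the line. *)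
Lemma cint_mx_prod (F : 'I_m -> 'I_n -> RM -> R[i]) :
  (forall i j, cintegrable leb (F i j)) ->
  cintegrable mu (fun M => \prod_i \prod_j F i j (M i j)) /\
  cint mu (fun M => \prod_i \prod_j F i j (M i j)) =
    \prod_i \prod_j cint leb (F i j).
Proof.
move=> iF; pose F' k := mxvec (\matrix_(i, j) F i j) ord0 k.
have iF' k : cintegrable leb (F' k).
  by rewrite /F'; case/mxvec_indexP: k => i j; rewrite mxvecE mxE.
have mprod : cmfun (fun M : 'M[R]_(m, n) => \prod_i \prod_j F i j (M i j)).
  apply: cmfun_prod => i; apply: cmfun_prod => j.
  have [m1 m2] := cintegrable_cmfun (iF i j).
  by split; [exact: (measurableT_comp m1 (measurable_entry i j))|
             exact: (measurableT_comp m2 (measurable_entry i j))].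
have E : (fun t => \prod_i \prod_j F i j (@mx_of_tuple R m n t i j)) =
    (fun t => \prod_k F' k (tnth t k)).
  apply/funext => t; rewrite -prod_mxvec.
  by apply: eq_bigr => i _; apply: eq_bigr => j _; rewrite mxE.
have [i1 e1] := cint_tuple_prod iF'.
split.
  apply/(cintegrable_preserving (@measurable_mx_of_tuple R m n) mx_preserving mprod).
  by rewrite E.
rewrite -(cint_preserving (@measurable_mx_of_tuple R m n) mx_preserving mprod) E e1.
rewrite pair_bigA /= (reindex _ (curry_mxvec_bij m n)) /=.
by apply: eq_bigr => -[i j] _ /=; rewrite /F' mxvecE mxE.
Qed.

Lemma ge0_integral_mx_prod (F : 'I_m -> 'I_n -> RM -> \bar R) :
  (forall i j, measurable_fun setT (F i j)) -> (forall i j x, 0 <= F i j x)%E ->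
  (\int[mu]_M \prod_i \prod_j F i j (M i j) = \prod_i \prod_j \int[leb]_x F i j x)%E.
Proof.
move=> mF F0; pose F' k := mxvec (\matrix_(i, j) F i j) ord0 k.
have mF' k : measurable_fun setT (F' k).
  by rewrite /F'; case/mxvec_indexP: k => i j; rewrite mxvecE mxE.
have F'0 k x : (0 <= F' k x)%E.
  by rewrite /F'; case/mxvec_indexP: k => i j; rewrite mxvecE mxE.
have mrow i : measurable_fun setT (fun M : 'M[R]_(m, n) => \prod_j F i j (M i j))%E.
  suff : forall (r : seq 'I_n), measurable_fun setT
      (fun M : 'M[R]_(m, n) => \prod_(j <- r) F i j (M i j))%E by apply.
  elim=> [|j r IHr]; first by under eq_fun do rewrite big_nil; exact: measurable_cst.
  under eq_fun do rewrite big_cons; apply: emeasurable_funM => //.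
  exact: (measurableT_comp (mF i j) (measurable_entry i j)).
have mprod : measurable_fun setT (fun M : 'M[R]_(m, n) => \prod_i \prod_j F i j (M i j))%E.
  suff : forall (r : seq 'I_m), measurable_fun setT
      (fun M : 'M[R]_(m, n) => \prod_(i <- r) \prod_j F i j (M i j))%E by apply.
  elim=> [|i r IHr]; first by under eq_fun do rewrite big_nil; exact: measurable_cst.
  by under eq_fun do rewrite big_cons; apply: emeasurable_funM.
rewrite -(ge0_integral_preserving (@measurable_mx_of_tuple R m n) mx_preserving mprod);
  last by move=> M; apply: prode_ge0 => i _; exact: prode_ge0.
transitivity (\int[lebesgue_tuple R (m * n)]_t \prod_k F' k (tnth t k))%E.
  apply: eq_integral => t _.
  rewrite pair_bigA /= [RHS](reindex _ (curry_mxvec_bij m n)) /=.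
  by apply: eq_bigr => -[i j] _ /=; rewrite /F' mxvecE !mxE.
rewrite ge0_integral_tuple_prod// [RHS]pair_bigA /= (reindex _ (curry_mxvec_bij m n)) /=.
by apply: eq_bigr => -[i j] _ /=; rewrite /F' mxvecE mxE.
Qed.

End mx_tensor.

(** * Fourier transforms on the line *)

Section real_line.
Variable R : realType.
Local Notation RM := (measurableTypeR R).
Local Notation leb := (@lebesgue_measure R).

Lemma is_derive_continuous (F f : R -> R) :
  (forall x : R, is_derive x 1 F (f x)) -> continuous F.
Proof.
move=> dF x; have [dx _] := dF x.
by apply: differentiable_continuous; apply/derivable1_diffP.
Qed.

Lemma continuous_FTC2_is_derive (F f : R -> R) a b : a < b ->
  continuous f -> (forall x : R, is_derive x 1 F (f x)) ->
  \int[leb]_(x in `[a, b]) f x = F b - F a.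
Proof.
move=> ab cf dF; have cF := is_derive_continuous dF.
rewrite /Rintegral (@continuous_FTC2 R f F)//.
- by apply: continuous_subspaceT => x; exact: cf.
- split; first by move=> x _; have [] := dF x.
  + by apply: cvg_at_right_filter; exact: cF.
  + by apply: cvg_at_left_filter; exact: cF.
- by move=> x _; rewrite derive1E; have [_ ->] := dF x.
Qed.

Lemma ge0_integral_scale (G : R -> R) (t x0 : R) : 0 < t ->
  continuous G -> (forall x, 0 <= G x) ->
  (\int[leb]_x (G ((x - x0) / t))%:E = t%:E * \int[leb]_x (G x)%:E)%E.
Proof.
move=> t0 cG G0.
suff -> : (\int[leb]_x (G x)%:E = (t^-1)%:E * \int[leb]_x (G ((x - x0) / t))%:E)%E.
  by rewrite muleA -EFinM divff ?gt_eqF// mul1e.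
pose F (x : R) := (x - x0) / t.
have dF (x : R) : is_derive x 1 F t^-1.
  rewrite /F; apply: is_derive_eq; rewrite ?scaler0 ?add0r ?subr0 /GRing.scale /=.
  ring.
have F1 : derive1 F = cst t^-1 by apply/funext => x; rewrite derive1E; have [_ ->] := dF x.
rewrite (@increasing_ge0_integration_by_substitutionT R F)//.
- rewrite F1 -ge0_integralZl_EFin//; last 2 first.
  + by apply/measurable_EFinP; apply: continuous_measurable_fun => x;
      apply: continuous_comp; [exact: (is_derive_continuous dF)|exact: cG].
  + by rewrite invr_ge0 ltW.
  + by apply: eq_integral => x _; rewrite /= mulrC EFinM.
  + by move=> x _; rewrite lee_fin.
- by move=> x y xy; rewrite /F ltr_pM2r ?invr_gt0// ltrD2r.
- by rewrite F1; exact: cst_continuous.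
- by rewrite F1; exact: is_cvg_cst.
- by rewrite F1; exact: is_cvg_cst.
- apply/cvgrNyPle => A; near=> x; rewrite /F ler_pdivrMr// lerBlDr.
  by near: x; apply: nbhs_ninfty_le; exact: num_real.
- apply/cvgryPge => A; near=> x; rewrite /F ler_pdivlMr// lerBrDr.
  by near: x; apply: nbhs_pinfty_ge; exact: num_real.
Unshelve. all: by end_near. Qed.

Lemma integral_oneDsqrV :
  (\int[leb]_x ((1 + x ^+ 2)^-1)%:E = (pi : R)%:E)%E.
Proof.
rewrite (@ge0_symfun_integralT R (fun x => (1 + x ^+ 2)^-1)).
- rewrite (_ : [set x | _] = `[0, +oo[%classic); last first.
    by apply/seteqP; split => x/=; rewrite in_itv/= andbT.
  rewrite (@integral0y_oneDsqr R) -EFinM; congr EFin.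
  by rewrite mulrC divfK.
- by move=> x; rewrite invr_ge0 addr_ge0// sqr_ge0.
- exact: continuous_oneDsqrV.
- by move=> x /=; rewrite sqrrN.
Qed.

(** This rational weight is the integrable majorant of the whole development: its integral is
    explicit and linear in the width [t]. *)
Lemma integral_cauchy (t x0 : R) : 0 < t ->
  (\int[leb]_x ((1 + ((x - x0) / t) ^+ 2)^-1)%:E = (pi * t)%:E)%E.
Proof.
move=> t0; have := @ge0_integral_scale (fun x => (1 + x ^+ 2)^-1) _ x0 t0
  (@continuous_oneDsqrV R) _.
by rewrite integral_oneDsqrV EFinM muleC => ->// x; rewrite invr_ge0 addr_ge0// sqr_ge0.
Qed.

Lemma integrable_cauchy (t x0 : R) : 0 < t ->
  leb.-integrable setT (fun x => ((1 + ((x - x0) / t) ^+ 2)^-1)%:E).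
Proof.
move=> t0; have mf : measurable_fun setT (fun x : RM => (1 + ((x - x0) / t) ^+ 2)^-1).
  apply: continuous_measurable_fun => x; apply: (@continuous_comp _ _ _ (fun x => (x - x0) / t)
    (fun x => (1 + x ^+ 2)^-1)); last exact: continuous_oneDsqrV.
  by apply: cvgMl; apply: cvgB; [exact: cvg_id|exact: cvg_cst].
apply/integrableP; split; first exact/measurable_EFinP.
under eq_integral do rewrite gee0_abs ?lee_fin ?invr_ge0 ?addr_ge0 ?sqr_ge0//.
by rewrite integral_cauchy// ltry.
Qed.

(** The fundamental theorem on [-k, k] followed by dominated convergence; it stands for integration
    by parts on the line. *)
Lemma Rintegral_is_derive0 (F f : R -> R) :
  continuous f -> (forall x : R, is_derive x 1 F (f x)) ->
  leb.-integrable setT (EFin \o f) ->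
  F n%:R @[n --> \oo] --> (0 : R) -> F (- n%:R) @[n --> \oo] --> (0 : R) ->
  \int[leb]_x f x = 0.
Proof.
move=> cf dF fi F0 F0'; have mf : measurable_fun setT f by exact: continuous_measurable_fun.
pose f_ (k : nat) (x : RM) := ((f x) * \1_(`[- k%:R, k%:R]%classic) x)%:E.
have [] := @dominated_convergence _ _ R leb setT measurableT f_ (EFin \o f)
  (fun x => `|f x|%:E).
- move=> k; apply/measurable_EFinP; apply: measurable_funM => //.
- exact/measurable_EFinP.
- apply: aeW => x _; apply: cvg_near_cst.
  near=> k; rewrite /f_ /= indicE mem_set ?mulr1//= in_itv /= -ler_norml.
  near: k; exact: nbhs_infty_ger.
- exact: (integrable_abse fi).
- apply: aeW => x k _; rewrite /f_ abse_EFin lee_fin normrM ler_piMr//.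
  by rewrite indicE; case: (_ \in _); rewrite ?normr1 ?normr0.
move=> _ _ H.
have E k : (0 < k)%N -> (\int[leb]_x f_ k x = (F k%:R - F (- k%:R))%:E)%E.
  move=> k0; rewrite -(@continuous_FTC2_is_derive F f)//; last first.
    by rewrite gtrN// ltr0n.
  rewrite /Rintegral fineK.
    rewrite [RHS]integral_mkcond; apply: eq_integral => x _.
    by rewrite /f_ patchE indicE; case: ifP; rewrite ?mulr1 ?mulr0.
  by apply: integrable_fin_num => //; exact: (integrableS measurableT).
have H0 : (\int[leb]_x f_ k x)%E @[k --> \oo] --> 0%:E.
  apply: (@cvg_trans _ ((F k%:R - F (- k%:R))%:E @[k --> \oo])).
    apply: near_eq_cvg; near=> k; rewrite E//.
    by near: k; exact: nbhs_infty_gt.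
  apply/fine_cvgP; split; first exact: nearW.
  by rewrite -(subrr (0 : R)); apply: cvgB.
rewrite /Rintegral -[RHS]/(fine 0%:E) -(cvg_lim _ H)// (cvg_lim _ H0)//.
Unshelve. all: by end_near. Qed.

Lemma integrable_le_oneDsqrV (h : RM -> R) (B : R) : measurable_fun setT h ->
  (forall x, `|h x| * (1 + x ^+ 2) <= B) -> leb.-integrable setT (EFin \o h).
Proof.
move=> mh hB.
have i1 := integrableZl measurableT B (integrable_cauchy 0 (@ltr01 R)).
apply: (le_integrable measurableT _ _ i1); first exact/measurable_EFinP.
have p (x : R) : 0 < 1 + x ^+ 2 by rewrite ltr_pwDl// sqr_ge0.
have B0 : 0 <= B.
  by apply: le_trans (hB 0); rewrite mulr_ge0// ltW.
move=> x _; rewrite /= lee_fin subr0 divr1 [leRHS]ger0_norm.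
  by rewrite ler_pdivlMr.
by rewrite mulr_ge0// invr_ge0 ltW.
Qed.

Definition gau (c x : R) : R := expR (- (c * x ^+ 2)).

Lemma gau_ge0 c x : 0 <= gau c x. Proof. exact: expR_ge0. Qed.

Lemma is_derive_gau c (x : R) : is_derive x 1 (gau c) (- (2 * c * x) * gau c x).
Proof.
rewrite /gau; apply: is_derive_eq; rewrite /GRing.scale /= ?expr1 ?mulr0 ?add0r.
ring.
Qed.

Lemma continuous_gau c : continuous (gau c).
Proof. exact: is_derive_continuous (is_derive_gau c). Qed.

(** Use y^k <= k! e^y with y = c (1 + x^2): the factor exp(- c x^2) cancels all of e^y except
    e^c. *)
Lemma gau_decay c (x : R) k : 0 < c ->
  (1 + x ^+ 2) ^+ k * gau c x <= (1 + expR c) * k`!%:R / c ^+ k.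
Proof.
move=> c0; have k0 : 0 < k`!%:R :> R by rewrite ltr0n fact_gt0.
have ck : 0 < c ^+ k by rewrite exprn_gt0.
have p : 0 <= 1 + x ^+ 2 by rewrite addr_ge0// sqr_ge0.
rewrite ler_pdivlMr// mulrAC -exprMn.
have E : ((1 + x ^+ 2) * c) ^+ k <= k`!%:R * expR ((1 + x ^+ 2) * c).
  case: k k0 ck => [|k] k0 ck.
    by rewrite expr0 mul1r; apply: le_trans (expR_ge1Dx _); rewrite lerDl mulr_ge0// ltW.
  rewrite -ler_pdivrMl//; apply: le_trans (expR_ge1Dxn k (mulr_ge0 p (ltW c0))).
  by rewrite mulrC lerDr.
apply: le_trans (ler_wpM2r (gau_ge0 c x) E) _.
rewrite /gau -mulrA -expRD [leRHS]mulrC ler_pM2l//.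
by rewrite (_ : _ + _ = c) ?lerDr//; ring.
Qed.

Lemma gau_le1 c x : 0 <= c -> gau c x <= 1.
Proof. by move=> c0; rewrite /gau expR_le1 oppr_le0 mulr_ge0// sqr_ge0. Qed.

Lemma integrable_gauM c (h : R -> R) (A : R) : 0 < c ->
  measurable_fun setT h -> (forall x, `|h x| <= A * (1 + x ^+ 2)) ->
  leb.-integrable setT (fun x => (h x * gau c x)%:E).
Proof.
move=> c0 mh hA.
have A0 : 0 <= A by have := le_trans (normr_ge0 _) (hA 0); rewrite expr0n addr0 mulr1.
apply: (@integrable_le_oneDsqrV _ (A * ((1 + expR c) * 2%:R / c ^+ 2))).
  apply: measurable_funM => //; apply: continuous_measurable_fun; exact: continuous_gau.
move=> x; rewrite normrM (ger0_norm (gau_ge0 c x)).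
have p : 0 <= 1 + x ^+ 2 by rewrite addr_ge0// sqr_ge0.
apply: le_trans (_ : A * ((1 + x ^+ 2) ^+ 2 * gau c x) <= _).
  rewrite expr2 -!mulrA [gau c x * _]mulrC !mulrA.
  by rewrite ler_wpM2r ?gau_ge0// ler_wpM2r// hA.
by rewrite ler_wpM2l// gau_decay.
Qed.

Definition gau_cos c (w : R) : R := \int[leb]_x (cos (w * x) * gau c x).

Lemma continuous_lin (w : R) : continuous (fun x : R => w * x).
Proof. by move=> x; apply: cvgMr; exact: cvg_id. Qed.

Lemma measurable_cos_lin (w : R) : measurable_fun setT (fun x : R => cos (w * x)).
Proof.
by apply: continuous_measurable_fun => x; apply: continuous_comp;
  [exact: continuous_lin|exact: continuous_cos].
Qed.

Lemma measurable_sin_lin (w : R) : measurable_fun setT (fun x : R => sin (w * x)).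
Proof.
by apply: continuous_measurable_fun => x; apply: continuous_comp;
  [exact: continuous_lin|exact: continuous_sin].
Qed.

Lemma ler_norm_oneDsqr (x : R) : `|x| <= 1 * (1 + x ^+ 2).
Proof.
rewrite -[x ^+ 2]real_normK ?num_real//.
have := normr_ge0 x; move: `|x| => y y0; nra.
Qed.

(** The classical differential equation for the transform of a Gaussian: differentiate under the
    integral, then integrate by parts. *)
Lemma is_derive_gau_cos c (w : R) : 0 < c ->
  is_derive w 1 (gau_cos c) (- (w / (2 * c)) * gau_cos c w).
Proof.
move=> c0.
pose f (w x : R) := cos (w * x) * gau c x.
have fi w' : leb.-integrable setT (EFin \o f w').
  apply: (@integrable_gauM _ _ 1) => //; first exact: measurable_cos_lin.
  by move=> x; rewrite (le_trans (cos_max _))// mul1r lerDl sqr_ge0.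
have df (w' x : R) : is_derive w' (1 : R) (f ^~ x) (- x * sin (w' * x) * gau c x).
  rewrite /f; apply: is_derive_eq; rewrite /GRing.scale /= ?mulr0 ?addr0 ?add0r.
  ring.
have d1 (w' x : R) : partial1of2 f w' x = - x * sin (w' * x) * gau c x.
  by rewrite partial1of2E; have [_ ->] := df w' x.
have iG : leb.-integrable setT (EFin \o (fun x => `|x| * gau c x)).
  apply: (@integrable_gauM _ _ 1) => //.
  by move=> x; rewrite normr_id; exact: ler_norm_oneDsqr.
have ww : `]w - 1, w + 1[%classic w by rewrite /= in_itv /=; lra.
have H := @cvg_differentiation_under_integral R _ RM leb f setT measurableT
  w (w - 1) (w + 1) ww (fun x _ => fi x) _ (fun x => `|x| * gau c x) _ iG _.
have {H} : h^-1 *: (gau_cos c (h + w) - gau_cos c w) @[h --> 0^'] -->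
    \int[leb]_x (- x * sin (w * x) * gau c x).
  under eq_Rintegral do rewrite -d1.
  apply: H.
  - by move=> x y _ _; have [] := df x y.
  - by move=> x; rewrite mulr_ge0// gau_ge0.
  - move=> w' x _ _; rewrite d1 !normrM normrN (ger0_norm (gau_ge0 c x)).
    by rewrite ler_wpM2r ?gau_ge0// ler_piMr// sin_max.
move=> H.
have is1 : leb.-integrable setT (EFin \o (fun x => - x * sin (w * x) * gau c x)).
  apply: (@integrable_gauM _ _ 1) => //.
    by apply: measurable_funM; [exact: oppr_measurable|exact: measurable_sin_lin].
  move=> x; rewrite normrM normrN (le_trans _ (ler_norm_oneDsqr x))//.
  by rewrite ler_piMr// sin_max.
have E : \int[leb]_x (- x * sin (w * x) * gau c x) = - (w / (2 * c)) * gau_cos c w.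
  (* Its derivative combines the two integrands, so the vanishing of the total integral of that
     derivative is the differential equation. *)
  pose F x := sin (w * x) * gau c x.
  have dF (x : R) : is_derive x 1 F
      (2 * c * (- x * sin (w * x) * gau c x) + w * f w x).
    have dg := is_derive_gau c x.
    rewrite /F; apply: is_derive_eq; rewrite /GRing.scale /= /f ?mulr0 ?addr0 ?add0r.
    ring.
  have := @Rintegral_is_derive0 F _ _ dF.
  rewrite RintegralD//; last 2 first.
  - exact: (integrableZl measurableT (2 * c) is1).
  - exact: (integrableZl measurableT w (fi w)).
  rewrite RintegralZl// RintegralZl// -/(gau_cos c w) => K.
  suff : 2 * c * \int[leb]_x (- x * sin (w * x) * gau c x) + w * gau_cos c w = 0.
    move/eqP; rewrite addr_eq0 => /eqP K2.
    apply: (@mulfI _ (2 * c)); first by rewrite mulf_neq0// ?gt_eqF.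
    by rewrite K2 mulrA mulrN [X in - X * _](_ : _ = w) ?mulNr// mulrC divfK// mulf_neq0// gt_eqF.
  (* Stated for every sequence with n <= u_n^2, so as to serve both ends of the line. *)
  have F0 (u : nat -> R) : (forall n, n%:R <= u n ^+ 2) -> F (u n) @[n --> \oo] --> (0 : R).
    move=> hu; pose B := (1 + expR c) * 1`!%:R / c ^+ 1.
    apply: norm_cvg0; apply: (@squeeze_cvgr _ _ _ _ (cst 0) (fun n => B * harmonic n)).
    - apply: nearW => n; rewrite normr_ge0 /= /harmonic /= ler_pdivlMr// /F normrM.
      rewrite (ger0_norm (gau_ge0 c (u n))).
      apply: le_trans (gau_decay (u n) 1 c0); rewrite expr1 mulrC.
      rewrite ler_pM ?mulr_ge0 ?gau_ge0//.
      + by rewrite -natr1 addrC lerD2l.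
      + by rewrite ler_piMl ?gau_ge0// sin_max.
    - exact: cvg_cst.
    - by rewrite -(mulr0 B); apply: cvgMr; exact: cvg_harmonic.
  have nn (n : nat) : n%:R <= n%:R ^+ 2 :> R by rewrite -natrX ler_nat; case: n => // n; exact: leq_pmulr.
  apply: K.
  - have cl : continuous (fun x : R => w * x) by exact: continuous_lin.
    have cc : continuous (fun x : R => cos (w * x)).
      by move=> x; apply: continuous_comp; [exact: cl|exact: continuous_cos].
    have cs : continuous (fun x : R => sin (w * x)).
      by move=> x; apply: continuous_comp; [exact: cl|exact: continuous_sin].
    move=> x; apply: cvgD; apply: cvgMr.
      apply: cvgM; last exact: continuous_gau.
      by apply: cvgM; [apply: cvgN; exact: cvg_id|exact: cs].
    by apply: cvgM; [exact: cc|exact: continuous_gau].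
  - have := integrableD measurableT (integrableZl measurableT (2 * c) is1)
      (integrableZl measurableT w (fi w)).
    by [].
  - exact: F0.
  - by apply: F0 => n; rewrite sqrrN.
have dd : (fun h => h^-1 *: (gau_cos c (h *: 1 + w) - gau_cos c w)) =
          (fun h => h^-1 *: (gau_cos c (h + w) - gau_cos c w)).
  by apply/funext => h; rewrite scaler1.
apply: DeriveDef.
  by apply/cvg_ex; eexists; rewrite dd; exact: H.
by apply/cvg_lim => //; rewrite dd -E.
Qed.

Lemma gau_cos0 (t : R) : 0 < t -> gau_cos (pi / t ^+ 2) 0 = t.
Proof.
move=> t0; have sp : 0 < Num.sqrt pi :> R by rewrite sqrtr_gt0 pi_gt0.
have := @ge0_integral_scale (@gauss_fun R) (t / Num.sqrt pi) 0
  (divr_gt0 t0 sp) (@continuous_gauss_fun R) (@gauss_fun_ge0 R).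
rewrite integralT_gauss -EFinM divfK ?gt_eqF// => /(congr1 fine) /= E; rewrite -[RHS]E.
congr fine; apply: eq_integral => x _; rewrite mul0r cos0 mul1r; congr EFin.
rewrite /gau /gauss_fun; congr expR; rewrite subr0 invf_div !exprMn exprVn.
by rewrite sqr_sqrtr ?pi_ge0//; ring.
Qed.

(** Multiplying the transform by exp(w^2 / (4 c)) gives a function of zero derivative, whose value
    at 0 is the Gaussian integral. *)
Lemma gau_cosE (t w : R) : 0 < t ->
  gau_cos (pi / t ^+ 2) w = t * expR (- (t ^+ 2 * w ^+ 2 / (4 * pi))).
Proof.
move=> t0; set c := pi / t ^+ 2.
have c0 : 0 < c by rewrite divr_gt0 ?pi_gt0 ?exprn_gt0.
pose H w := gau_cos c w * expR (w ^+ 2 / (4 * c)).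
have dH (x : R) : is_derive x (1 : R) H 0.
  have d1 := is_derive_gau_cos x c0.
  rewrite /H; apply: is_derive_eq; rewrite /GRing.scale /= ?expr1 ?mulr0 ?addr0 ?add0r.
  field.
  by rewrite gt_eqF.
have := is_derive_0_is_cst w 0 dH.
rewrite /H expr0n mul0r expR0 mulr1 gau_cos0// => E; rewrite -{1}E.
rewrite -mulrA -expRD [X in expR X](_ : _ = 0) ?expR0 ?mulr1//.
have A (P : R) : 0 < P -> w ^+ 2 / (4 * (P / t ^+ 2)) + - (t ^+ 2 * w ^+ 2 / (4 * P)) = 0.
  by move=> P0; field; rewrite (gt_eqF P0) (gt_eqF t0).
exact: A (@pi_gt0 R).
Qed.
End real_line.

(** * Compactly supported bumps and the decay of their transforms *)

Section bump.
Variable R : realType.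
Local Notation RM := (measurableTypeR R).
Local Notation leb := (@lebesgue_measure R).

Lemma cmod_realM (a : R) (z : R[i]) : cmod (Complex a 0 * z) = `|a| * cmod z.
Proof. by rewrite cmodM cmod_real. Qed.

(** The sine part is odd, hence equal to its own opposite under the reflection of the line. *)
Lemma cint_even_expi (h : RM -> R) (w : R) :
  leb.-integrable setT (EFin \o h) -> (forall x, h (- x) = h x) ->
  cintegrable leb (fun x => Complex (h x) 0 * expi (w * x)) /\
  cint leb (fun x => Complex (h x) 0 * expi (w * x)) =
    Complex (\int[leb]_x (cos (w * x) * h x)) 0.
Proof.
move=> hi heven; have /integrableP[/measurable_EFinP mh _] := hi.
have mw : measurable_fun setT (fun x : RM => w * x).
  by apply: continuous_measurable_fun; exact: continuous_lin.
have ci : cintegrable leb (fun x => Complex (h x) 0 * expi (w * x)).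
  apply: (@cintegrable_le _ _ _ _ _ (fun x => `|h x|)).
  - by apply: cmfunM; [exact: cmfun_real|exact: cmfun_expi].
  - exact: (integrable_abse hi).
  - by move=> x; rewrite cmod_realM cmod_expi mulr1.
split=> //; apply/eqP; rewrite eq_complex; apply/andP; split; apply/eqP => /=.
  by apply: eq_Rintegral => x _; rewrite mul0r subr0 mulrC.
pose s (x : RM) := sin (w * x) * h x.
have ms : measurable_fun setT s by apply: measurable_funM => //; exact: measurable_sin_lin.
have mN : measurable_fun setT (-%R : RM -> RM) by exact: oppr_measurable.
have E := Rintegral_preserving (mu := leb) (nu := leb) mN (@lebesgue_measureN R) ms.
have -> : \int[leb]_x (h x * sin (w * x) + 0 * cos (w * x)) = \int[leb]_x s x.
  by apply: eq_Rintegral => x _; rewrite mul0r addr0 mulrC.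
have A (a : R) : a = - a -> a = 0 by move=> H; lra.
apply: A.
rewrite -{1}E -mulN1r -RintegralZl//.
  by apply: eq_Rintegral => x _; rewrite /s mulrN sinN heven; ring.
apply: (le_integrable measurableT _ _ hi).
  exact/measurable_EFinP.
by move=> x _; rewrite /= lee_fin normrM ler_piMl// sin_max.
Qed.

(* A power of a cosine rather than a smooth bump: its Fourier transform obeys
   a two-term recursion in K, which gives its decay; see bumphat_rec. *)
Definition bump (r : R) (K : nat) (x : R) : R :=
  if `|x| <= r then cos (pi / (2 * r) * x) ^+ (2 * K) else 0.

Lemma bump_ge0 r K x : 0 <= bump r K x.
Proof. by rewrite /bump; case: ifP => // _; rewrite exprM exprn_ge0// sqr_ge0. Qed.

Lemma bump_le1 r K x : bump r K x <= 1.
Proof.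
by rewrite /bump; case: ifP => // _; rewrite exprM exprn_ile1// sqr_ge0.
Qed.

Lemma bump_even r K x : bump r K (- x) = bump r K x.
Proof. by rewrite /bump normrN mulrN cosN. Qed.

Lemma bump_out r K x : r < `|x| -> bump r K x = 0.
Proof. by rewrite /bump ltNge => /negbTE ->. Qed.

Lemma cos_sqr_ge_half (x : R) : `|x| <= pi / 4 -> 1 / 2 <= cos x ^+ 2.
Proof.
move=> x4; have := cos_mulr2n x; rewrite -[x *+ 2]mulr_natr.
have : 0 <= cos (x * 2).
  apply: cos_ge0_pihalf; rewrite -ler_norml normrM [`|2|]ger0_norm//.
  have A (P y : R) : y <= P / 4 -> y * 2 <= P / 2 by lra.
  exact: A.
by rewrite -mulr_natr; lra.
Qed.

(** On half of the support the angle is at most pi / 4, where the squared cosine is at least 1/2. *)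
Lemma bump_ge r K x : 0 < r -> `|x| <= r / 2 -> (1 / 2) ^+ K <= bump r K x.
Proof.
move=> r0 xr; rewrite /bump ifT; last by move: xr; lra.
rewrite exprM lerXn2r ?nnegrE ?sqr_ge0 ?divr_ge0//.
apply: cos_sqr_ge_half; rewrite normrM ger0_norm; last first.
  by rewrite divr_ge0 ?pi_ge0// mulr_ge0// ltW.
apply: le_trans (_ : pi / (2 * r) * (r / 2) <= _).
  by rewrite ler_wpM2l// divr_ge0 ?pi_ge0// mulr_ge0// ltW.
have A (P : R) : P / (2 * r) * (r / 2) = P / 4 by field; rewrite gt_eqF.
by rewrite A.
Qed.

Lemma bumpE r K : bump r K = (fun x => cos (pi / (2 * r) * x) ^+ (2 * K)) \_ `[- r, r].
Proof.
apply/funext => x; rewrite /bump patchE mem_setE in_itv /= -ler_norml.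
by case: ifP.
Qed.

Lemma continuous_cosX (k : R) (K : nat) : continuous (fun x : R => cos (k * x) ^+ K).
Proof.
move=> x; apply: (@continuous_comp _ _ _ (fun x : R => cos (k * x)) (fun y => y ^+ K)).
  by apply: continuous_comp; [exact: continuous_lin|exact: continuous_cos].
exact: exprn_continuous.
Qed.

Lemma measurable_bump r K : measurable_fun setT (bump r K).
Proof.
rewrite bumpE; apply/(measurable_restrictT _ _).1 => //.
by apply: measurable_funTS; apply: continuous_measurable_fun; exact: continuous_cosX.
Qed.

Lemma integral_bump_le r K : 0 < r -> (\int[leb]_x (bump r K x)%:E <= (2 * r)%:E)%E.
Proof.
move=> r0; apply: (@le_trans _ _ (\int[leb]_x (\1_(`[- r, r]%classic) x)%:E)%E).
  apply: ge0_le_integral => //.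
  - by move=> x _; rewrite lee_fin bump_ge0.
  - by apply/measurable_EFinP; exact: measurable_bump.
  - by apply/measurable_EFinP; exact: measurable_indic.
  - move=> x _; rewrite lee_fin bumpE patchE indicE.
    by case: ifP => // _; rewrite exprM exprn_ile1// sqr_ge0.
rewrite integral_indic// setIT.
apply: (@le_trans _ _ (lebesgue_measure `[- r, r]%classic)) => //.
by rewrite lebesgue_measure_itv /= lte_fin gtrN// -EFinD lee_fin; lra.
Qed.

Lemma integrable_bump r K : 0 < r -> leb.-integrable setT (EFin \o bump r K).
Proof.
move=> r0; apply/integrableP; split; first by apply/measurable_EFinP; exact: measurable_bump.
under eq_integral do rewrite /= ger0_norm ?bump_ge0//.
by rewrite (le_lt_trans (integral_bump_le K r0))// ltry.
Qed.

(** The Fourier transform of the even function [bump], by [cint_even_expi], with the factor 2 pi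
    absorbed in [w]. *)
Definition bumphat r K (w : R) : R := \int[leb]_x (cos (w * x) * bump r K x).

Lemma bumphatE r K w : bumphat r K w =
  \int[leb]_(x in `[- r, r]) (cos (w * x) * cos (pi / (2 * r) * x) ^+ (2 * K)).
Proof.
rewrite [RHS]Rintegral_mkcond; apply: eq_Rintegral => x _.
by rewrite bumpE !patchE; case: ifP; rewrite // mulr0.
Qed.

Lemma bumphat_le r K w : 0 < r -> `|bumphat r K w| <= 2 * r.
Proof.
move=> r0; have bi := integrable_bump K r0.
have ci : leb.-integrable setT (EFin \o (fun x => cos (w * x) * bump r K x)).
  apply: (le_integrable measurableT _ _ bi) => //.
    apply/measurable_EFinP/measurable_funM; first exact: measurable_cos_lin.
    exact: measurable_bump.
  by move=> x _; rewrite /= lee_fin normrM ler_piMl// cos_max.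
rewrite (le_trans (le_normr_Rintegral measurableT ci))//.
rewrite -lee_fin (le_trans _ (integral_bump_le K r0))// /Rintegral fineK.
  apply: ge0_le_integral => //.
  - by have /integrableP[m _] := integrable_abse ci.
  - by apply/measurable_EFinP; exact: measurable_bump.
  - move=> x _; rewrite lee_fin normrM (ger0_norm (bump_ge0 r K x)).
    by rewrite ler_piMl ?bump_ge0// cos_max.
by apply: integrable_fin_num => //; exact: (integrable_abse ci).
Qed.

(** Two integrations by parts: the second derivative of cos(k x)^a is a combination of its powers a
    and a - 2, and the boundary terms vanish because cos(k r) = 0. *)
Lemma bumphat_rec r K w : 0 < r ->
  ((r * w) ^+ 2 - (K.+1%:R * pi) ^+ 2) * bumphat r K.+1 w =
  - ((2 * K.+1)%:R * (2 * K.+1).-1%:R * (pi / 2) ^+ 2) * bumphat r K w.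
Proof.
move=> r0; pose k := pi / (2 * r).
have rk : r * k = pi / 2.
  by rewrite /k; have A (P : R) : r * (P / (2 * r)) = P / 2 by field; rewrite gt_eqF.
set a := (2 * K.+1)%:R; set b := (2 * K.+1).-1%:R.
have ab : a = b + 1 by rewrite /a /b natr1 prednK.
pose C j (x : R) := cos (w * x) * cos (k * x) ^+ j.
(* The Wronskian of cos(k x)^(2K+2) and cos(w x). *)
pose F (x : R) := - (a * k) * (cos (k * x) ^+ (2 * K).+1 * sin (k * x) * cos (w * x))
                  + w * (cos (k * x) ^+ (2 * K).+2 * sin (w * x)).
pose f (x : R) := (w ^+ 2 - (a * k) ^+ 2) * C (2 * K).+2 x + a * b * k ^+ 2 * C (2 * K)%N x.
have dF (x : R) : is_derive x (1 : R) F (f x).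
  have dck : is_derive x (1 : R) (fun y => cos (k * y)) (- (k * sin (k * x))).
    by apply: is_derive_eq; rewrite /GRing.scale /= ?mulr0 ?addr0; ring.
  have dsk : is_derive x (1 : R) (fun y => sin (k * y)) (k * cos (k * x)).
    by apply: is_derive_eq; rewrite /GRing.scale /= ?mulr0 ?addr0; ring.
  have dcw : is_derive x (1 : R) (fun y => cos (w * y)) (- (w * sin (w * x))).
    by apply: is_derive_eq; rewrite /GRing.scale /= ?mulr0 ?addr0; ring.
  have dsw : is_derive x (1 : R) (fun y => sin (w * y)) (w * cos (w * x)).
    by apply: is_derive_eq; rewrite /GRing.scale /= ?mulr0 ?addr0; ring.
  have dX j : is_derive x (1 : R) (fun y => cos (k * y) ^+ j.+1)
      (j.+1%:R * cos (k * x) ^+ j * - (k * sin (k * x))).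
    have := @is_deriveX _ _ (fun y => cos (k * y)) j.+1 x 1 _ dck.
    by rewrite exprfctE.
  have d1 := is_deriveM (is_deriveM (dX (2 * K)%N) dsk) dcw.
  have d2 := is_deriveM (dX (2 * K).+1) dsw.
  apply: (is_derive_eq (is_deriveD (is_deriveZ (- (a * k)) d1) (is_deriveZ w d2))).
  rewrite /GRing.scale /= /f /C !mulrfctE.
  have S : sin (k * x) ^+ 2 = 1 - cos (k * x) ^+ 2 by rewrite sin2cos2.
  have E1 : (2 * K).+1%:R = b :> R by rewrite /b mulnS.
  have E2 : (2 * K).+2%:R = a :> R by rewrite /a mulnS.
  rewrite ?E1 ?E2.
  move: S; set c := cos (k * x); set s := sin (k * x).
  set c' := cos (w * x); set s' := sin (w * x) => S.
  rewrite !(exprS c); set cc := c ^+ (2 * K).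
  rewrite ab; apply/eqP; rewrite -subr_eq0; apply/eqP.
  transitivity ((b + 1) * b * k ^+ 2 * c' * cc * (s ^+ 2 - (1 - c ^+ 2))); first by ring.
  by rewrite S subrr mulr0.
have cC j : continuous (C j).
  move=> x; apply: cvgM; last exact: continuous_cosX.
  by apply: continuous_comp; [exact: continuous_lin|exact: continuous_cos].
have iC j : leb.-integrable `[- r, r] (EFin \o C j).
  apply: continuous_compact_integrable; first exact: segment_compact.
  by apply: continuous_subspaceT => x; exact: cC.
have cf : continuous f.
  by move=> x; apply: cvgD; apply: cvgMr; exact: cC.
have rr : - r < r by lra.
have := continuous_FTC2_is_derive rr cf dF.
have ckr : cos (k * r) = 0 by rewrite mulrC rk cos_pihalf.
rewrite /F (mulrN k r) cosN ckr !expr0n /= !mul0r !mulr0 addr0 subrr.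
rewrite RintegralD//; last 2 first.
- exact: (integrableZl _ (w ^+ 2 - (a * k) ^+ 2) (iC (2 * K).+2)).
- exact: (integrableZl _ (a * b * k ^+ 2) (iC (2 * K)%N)).
rewrite (RintegralZl _ _ (iC (2 * K).+2))// (RintegralZl _ _ (iC (2 * K)%N))//.
have -> : \int[leb]_(x in `[(- r)%R, r]) C (2 * K).+2 x = bumphat r K.+1 w.
  by rewrite bumphatE mulnS.
rewrite -bumphatE.
move: (bumphat r K.+1 w) (bumphat r K w) => X Y H.
have -> : (K.+1%:R * pi) = a * (pi / 2) :> R.
  rewrite /a natrM; have A (P Q : R) : Q * P = 2 * Q * (P / 2) by field.
  exact: A.
rewrite -rk; transitivity (r ^+ 2 * ((w ^+ 2 - (a * k) ^+ 2) * X + a * b * k ^+ 2 * Y)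
   - a * b * (r * k) ^+ 2 * Y); first by ring.
by rewrite H mulr0 add0r mulNr.
Qed.

(** Away from the zero of its left coefficient, the recursion gains one factor 1 + (r w)^2 per step;
    near that zero the trivial bound 2 r suffices. Since only r w enters, the constant depends on
    neither. *)
Lemma bumphat_decay K : exists2 C, 0 <= C & forall r w, 0 < r ->
  `|bumphat r K w| * (1 + (r * w) ^+ 2) ^+ K <= C * r.
Proof.
elim: K => [|K [C C0 IH]].
  by exists 2 => // r w r0; rewrite expr0 mulr1 bumphat_le.
set A := (K.+1%:R * pi) ^+ 2 : R.
have A0 : 0 <= A by exact: sqr_ge0.
pose D := (2 * K.+1)%:R * (2 * K.+1).-1%:R * (pi / 2) ^+ 2 : R.
have D0 : 0 <= D by rewrite /D mulr_ge0 ?sqr_ge0// mulr_ge0.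
have AA : 0 <= 2 + 2 * A by lra.
exists (2 * (2 + 2 * A) ^+ K.+1 + 4 * D * C).
  have AK : 0 <= (2 + 2 * A) ^+ K.+1 by exact: exprn_ge0.
  have DC : 0 <= D * C by exact: mulr_ge0.
  by rewrite -(mulrA 4); lra.
move=> r w r0; have := bumphat_rec K w r0; rewrite -/A -/D.
have := IH r w r0; have := bumphat_le K.+1 w r0.
have := sqr_ge0 (r * w); move: ((r * w) ^+ 2) => u u0.
(* Below this threshold 1 + u <= 2 + 2 A; above it u - A >= (1 + u) / 4, which is the source of the
   factor 4. *)
have [uA|uA] := ltP u (2 * A + 1).
  move=> b1 _ _; apply: le_trans (_ : (2 * r) * (2 + 2 * A) ^+ K.+1 <= _).
    apply: ler_pM => //; first by apply: exprn_ge0; lra.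
    by rewrite lerXn2r ?nnegrE; lra.
  have AK : 0 <= (2 + 2 * A) ^+ K.+1 by exact: exprn_ge0.
  have DC : 0 <= D * C by exact: mulr_ge0.
  by move: AK; move: (_ ^+ K.+1) => Z Z0; nra.
move=> _ b0 rec.
have H : `|bumphat r K.+1 w| * (1 + u) <= 4 * D * `|bumphat r K w|.
  apply: le_trans (_ : 4 * (`|bumphat r K.+1 w| * (u - A)) <= _).
    rewrite mulrCA ler_wpM2l//; lra.
  rewrite -mulrA ler_wpM2l//.
  rewrite -[X in _ * X <= _]ger0_norm; last by lra.
  by rewrite -normrM mulrC rec normrM normrN (ger0_norm D0).
have u1 : 0 <= (1 + u) ^+ K by rewrite exprn_ge0// addr_ge0.
have AK : 0 <= (2 + 2 * A) ^+ K.+1 by exact: exprn_ge0.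
have DC : 0 <= D * C by exact: mulr_ge0.
have h1 := ler_wpM2r u1 H.
have h2 : 4 * D * (`|bumphat r K w| * (1 + u) ^+ K) <= 4 * D * (C * r).
  by rewrite ler_wpM2l// mulr_ge0.
have h3 : 0 <= 2 * (2 + 2 * A) ^+ K.+1 * r by rewrite !mulr_ge0// ltW.
rewrite exprS; move: h1 h2 h3.
move: `|_| `|_| ((1 + u) ^+ K) ((2 + 2 * A) ^+ K.+1) => X Y Z W.
by rewrite mulrA mulrDl; lra.
Qed.

End bump.

(** * The Euclidean norm on matrices *)

Section mx_continuous.
Variables (R : realType) (m n : nat).
Local Notation RM := (measurableTypeR R).

Let rnd (k : nat) (M : 'M[R]_(m, n)) : 'M[R]_(m, n) :=
  \matrix_(i, j) ((Num.floor (M i j * k.+1%:R))%:~R / k.+1%:R).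

Let rnd_near k M i j : `|rnd k M i j - M i j| <= k.+1%:R^-1.
Proof.
rewrite mxE; set z := Num.floor _.
have k0 : 0 < k.+1%:R :> R by [].
have h1 : z%:~R <= M i j * k.+1%:R by exact: floor_le.
have h2 : M i j * k.+1%:R < (z + 1)%:~R by exact: floorD1_gt.
rewrite intrD in h2.
rewrite -[X in _ - X](mulfK (lt0r_neq0 k0)) -mulrBl normrM.
rewrite [X in _ * X]ger0_norm ?invr_ge0// ler_piMl ?invr_ge0//.
rewrite ler_norml; lra.
Qed.

Lemma mx_norm_le (M : 'M[R]_(m, n)) (c : R) : 0 <= c ->
  (forall i j, `|M i j| <= c) -> `|M| <= c.
Proof.
move=> c0 Mc; rewrite -[`|M|]/(mx_norm M) mx_normrE.
by apply: bigmax_le => // -[i j] _; exact: Mc.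
Qed.

(* Continuous functions are pointwise limits of functions that are constant on
   the boxes of a countable grid. *)
Lemma continuous_mx_measurable (f : 'M[R]_(m, n) -> R) :
  continuous f -> measurable_fun setT f.
Proof.
move=> cf; apply: (@measurable_fun_cvg _ _ _ setT (fun k M => f (rnd k M))).
- move=> k _ A mA; rewrite setTI.
  pose S (Z : 'M[int]_(m, n)) : set 'M[R]_(m, n) :=
    if f (\matrix_(i, j) ((Z i j)%:~R / k.+1%:R)) \in A then
      mx_box (fun i j => `[(Z i j)%:~R / k.+1%:R, (Z i j + 1)%:~R / k.+1%:R[%classic)
    else set0.
  have k0 : 0 < k.+1%:R :> R by [].
  rewrite (_ : _ @^-1` _ = \bigcup_(Z in [set: 'M[int]_(m, n)]) S Z).
    apply: countable_bigcupT_measurable; first exact: countableP.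
    move=> Z; rewrite /S; case: ifP => // _; exact: measurable_mx_box.
  apply/seteqP; split => M /=.
    move=> AM; exists (\matrix_(i, j) Num.floor (M i j * k.+1%:R)) => //.
    rewrite /S; rewrite (_ : \matrix_(i, j) _ = rnd k M); last first.
      by apply/matrixP => i j; rewrite !mxE.
    rewrite mem_set// => i j /=; rewrite in_itv /= mxE.
    by rewrite ler_pdivrMr// ltr_pdivlMr// floor_le floorD1_gt.
  move=> [Z _]; rewrite /S; case: ifPn => //; rewrite inE => AZ ZM.
  rewrite (_ : rnd k M = \matrix_(i, j) ((Z i j)%:~R / k.+1%:R))//.
  apply/matrixP => i j; rewrite !mxE; congr (_%:~R / _).
  have := ZM i j; rewrite /= in_itv /= ler_pdivrMr// ltr_pdivlMr// => h.
  exact/floor_def.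
- move=> M _; apply: (continuous_cvg _ (cf M)).
  apply/cvgrPdist_le => /= e e0; near=> k.
  rewrite distrC; apply: mx_norm_le; first exact: ltW.
  move=> i j; rewrite mxE [X in _ + X]mxE.
  apply: le_trans (rnd_near k M i j) _.
  by apply: ltW; near: k; exact: (near_infty_natSinv_lt (PosNum e0)).
Unshelve. all: by end_near. Qed.

End mx_continuous.

Section enorm.
Variables (R : realType) (m n : nat).
Local Notation RM := (measurableTypeR R).
Implicit Types M : 'M[R]_(m, n).

Lemma mxdotC M (N : 'M[R]_(m, n)) : mxdot M N = mxdot N M.
Proof. by apply: eq_bigr => i _; apply: eq_bigr => j _; rewrite mulrC. Qed.

Lemma mxdotDl (x y z : 'M[R]_(m, n)) : mxdot (x + y) z = mxdot x z + mxdot y z :> R.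
Proof.
rewrite /mxdot -big_split; apply: eq_bigr => i _ /=; rewrite -big_split.
by apply: eq_bigr => j _; rewrite !mxE mulrDl.
Qed.

Lemma mxdotZl (k : R) (x z : 'M[R]_(m, n)) : mxdot (k *: x) z = k * mxdot x z :> R.
Proof.
rewrite /mxdot mulr_sumr; apply: eq_bigr => i _; rewrite mulr_sumr.
by apply: eq_bigr => j _; rewrite !mxE mulrA.
Qed.

Lemma mxdot_ge0 M : 0 <= mxdot M M.
Proof. by apply: sumr_ge0 => i _; apply: sumr_ge0 => j _; rewrite -expr2 sqr_ge0. Qed.

Lemma enorm_ge0 M : 0 <= enorm M. Proof. exact: sqrtr_ge0. Qed.

Lemma sqr_enorm M : enorm M ^+ 2 = \sum_i \sum_j M i j ^+ 2.
Proof.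
by rewrite sqr_sqrtr ?mxdot_ge0//; apply: eq_bigr => i _; apply: eq_bigr => j _; rewrite expr2.
Qed.

Lemma sqr_entry_le_enorm M i j : M i j ^+ 2 <= enorm M ^+ 2.
Proof.
rewrite sqr_enorm (bigD1 i)//= (bigD1 j)//= -addrA lerDl addr_ge0//.
  by apply: sumr_ge0 => k _; exact: sqr_ge0.
by apply: sumr_ge0 => k _; apply: sumr_ge0 => l _; exact: sqr_ge0.
Qed.

Lemma enormZ (a : R) M : enorm (a *: M) = `|a| * enorm M.
Proof.
rewrite /enorm (_ : mxdot (a *: M) (a *: M) = a ^+ 2 * mxdot M M).
  by rewrite sqrtrM ?sqr_ge0// sqrtr_sqr.
rewrite /mxdot mulr_sumr; apply: eq_bigr => i _; rewrite mulr_sumr.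
by apply: eq_bigr => j _; rewrite !mxE; ring.
Qed.

Lemma enorm_le_sum M : enorm M <= \sum_i \sum_j `|M i j|.
Proof.
have s0 : 0 <= \sum_i \sum_j `|M i j| by apply: sumr_ge0 => i _; exact: sumr_ge0.
rewrite -(ler_pXn2r (n := 2))// ?nnegrE ?enorm_ge0// sqr_enorm.
have H (I : finType) (a : I -> R) : (forall i, 0 <= a i) ->
    \sum_i a i ^+ 2 <= (\sum_i a i) ^+ 2.
  move=> a0; rewrite [leRHS]expr2 mulr_suml; apply: ler_sum => i _.
  rewrite expr2 ler_wpM2l// (bigD1 i)//= lerDl; exact: sumr_ge0.
apply: le_trans (H _ _ (fun i => sumr_ge0 _ (fun j _ => normr_ge0 (M i j)))).
apply: ler_sum => i _; apply: le_trans (H _ _ (fun j => normr_ge0 (M i j))).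
by apply: ler_sum => j _; rewrite real_normK ?num_real.
Qed.

Lemma measurable_mxdotl (y : 'M[R]_(m, n)) :
  measurable_fun setT (fun M => mxdot M y : R).
Proof.
apply: measurable_sum => i; apply: measurable_sum => j.
by apply: measurable_funM => //; exact: measurable_entry.
Qed.

Lemma measurable_mxdot2 :
  measurable_fun setT (fun z : 'M[R]_(m, n) * 'M[R]_(m, n) => mxdot z.1 z.2 : R).
Proof.
apply: measurable_sum => i; apply: measurable_sum => j; apply: measurable_funM.
  exact: (measurableT_comp (measurable_entry i j)).
exact: (measurableT_comp (measurable_entry i j)).
Qed.

End enorm.

Lemma ler_enormD (R : realType) m n (M N : 'M[R]_(m, n)) :
  enorm (M + N) <= enorm M + enorm N.
Proof.
have CS : mxdot M N <= enorm M * enorm N.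
  have [M0|M0] := eqVneq (mxdot M M) 0.
    have Mij i j : M i j = 0.
      apply/eqP; rewrite -[_ == 0](expf_eq0 _ 2) eq_le sqr_ge0 andbT.
      by rewrite (le_trans (sqr_entry_le_enorm M i j))// sqr_sqrtr ?mxdot_ge0// M0.
    rewrite [mxdot M N]big1 ?mulr_ge0 ?enorm_ge0// => i _.
    by rewrite big1// => j _; rewrite Mij mul0r.
  have Mp : 0 < mxdot M M by rewrite lt_neqAle eq_sym M0 mxdot_ge0.
  apply: le_trans (ler_norm _) _; rewrite -sqrtr_sqr -sqrtrM ?mxdot_ge0//.
  rewrite ler_sqrt ?mulr_ge0 ?mxdot_ge0//.
  (* Cauchy-Schwarz from the nonnegativity of |N - t M|^2, used at its minimiser in t. *)
  have Q (t : R) : 0 <= mxdot N N - 2 * t * mxdot M N + t ^+ 2 * mxdot M M.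
    rewrite (_ : _ + _ = mxdot (N - t *: M) (N - t *: M)) ?mxdot_ge0//.
    rewrite /mxdot !mulr_sumr -sumrB -big_split; apply: eq_bigr => i _ /=.
    rewrite !mulr_sumr -sumrB -big_split; apply: eq_bigr => j _ /=.
    by rewrite !mxE; ring.
  have := Q (mxdot M N / mxdot M M); move: Mp (mxdot_ge0 N).
  move: (mxdot M M) (mxdot M N) (mxdot N N) => a b c a0 c0.
  have -> : c - 2 * (b / a) * b + (b / a) ^+ 2 * a = (a * c - b ^+ 2) / a.
    by field; rewrite gt_eqF.
  by rewrite pmulr_lge0 ?invr_gt0// subr_ge0.
rewrite -(ler_pXn2r (n := 2))// ?nnegrE ?addr_ge0 ?enorm_ge0//.
rewrite sqrrD ![enorm _ ^+ 2]sqr_sqrtr ?mxdot_ge0//.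
have -> : mxdot (M + N) (M + N) = mxdot M M + mxdot M N *+ 2 + mxdot N N.
  rewrite /mxdot -sumrMnl -!big_split; apply: eq_bigr => i _ /=.
  rewrite -sumrMnl -!big_split; apply: eq_bigr => j _ /=.
  by rewrite !mxE; ring.
by rewrite lerD2r lerD2l lerMn2r.
Qed.

(** * Products of Cauchy weights as integrable majorants *)

Section cauchy_prod.
Variables (R : realType) (m n : nat).
Local Notation RM := (measurableTypeR R).
Local Notation mu := (lebesgue_mx R m n).

Implicit Types t c M : 'M[R]_(m, n).

Definition cauchy_prod t c M : R :=
  \prod_i \prod_j (1 + ((M i j - c i j) / t i j) ^+ 2)^-1.

Lemma cauchy_prod_ge0 t c M : 0 <= cauchy_prod t c M.
Proof.
apply: prodr_ge0 => i _; apply: prodr_ge0 => j _.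
by rewrite invr_ge0 addr_ge0// sqr_ge0.
Qed.

Lemma measurable_cauchy (t c : R) :
  measurable_fun setT (fun x : RM => (1 + ((x - c) / t) ^+ 2)^-1).
Proof.
apply: continuous_measurable_fun => x; apply: (@continuous_comp _ _ _
  (fun x => (x - c) / t) (fun x => (1 + x ^+ 2)^-1)); last exact: continuous_oneDsqrV.
by apply: cvgMl; apply: cvgB; [exact: cvg_id|exact: cvg_cst].
Qed.

Lemma measurable_cauchy_prod t c : measurable_fun setT (cauchy_prod t c).
Proof.
apply: measurable_prod => i _; apply: measurable_prod => j _.
exact: (measurableT_comp (measurable_cauchy (t i j) (c i j)) (measurable_entry i j)).
Qed.

Lemma integral_cauchy_prod t c : (forall i j, 0 < t i j) ->
  (\int[mu]_M (cauchy_prod t c M)%:E = (\prod_i \prod_j (pi * t i j))%:E)%E.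
Proof.
move=> t0.
transitivity (\int[mu]_M \prod_i \prod_j ((1 + ((M i j - c i j) / t i j) ^+ 2)^-1)%:E)%E.
  apply: eq_integral => M _; rewrite /cauchy_prod -prodEFin.
  by apply: eq_bigr => i _; rewrite -prodEFin.
rewrite (@ge0_integral_mx_prod _ _ _ (fun i j x => ((1 + ((x - c i j) / t i j) ^+ 2)^-1)%:E)).
- rewrite -prodEFin; apply: eq_bigr => i _; rewrite -prodEFin.
  by apply: eq_bigr => j _; rewrite integral_cauchy.
- by move=> i j; apply/measurable_EFinP; exact: measurable_cauchy.
- by move=> i j x; rewrite lee_fin invr_ge0 addr_ge0// sqr_ge0.
Qed.

Lemma integrable_cauchy_prod t c : (forall i j, 0 < t i j) ->
  mu.-integrable setT (EFin \o cauchy_prod t c).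
Proof.
move=> t0; apply/integrableP; split.
  by apply/measurable_EFinP; exact: measurable_cauchy_prod.
under eq_integral do rewrite /= ger0_norm ?cauchy_prod_ge0//.
by rewrite integral_cauchy_prod// ltry.
Qed.

(** Each of the m n factors is at least (1 + e)^-2, where e is the scaled distance to the centre;
    hence the exponent 2 m n. *)
Lemma decay_le_cauchy_prod (w : R) c M : 0 < w ->
  ((1 + enorm (M - c) / w) ^+ (2 * (m * n)))^-1 <= cauchy_prod (const_mx w) c M.
Proof.
move=> w0; have e0 : 0 <= enorm (M - c) / w by rewrite divr_ge0 ?enorm_ge0// ltW.
set e := enorm (M - c) / w.
have -> : ((1 + e) ^+ (2 * (m * n)))^-1 = \prod_(i < m) \prod_(j < n) ((1 + e) ^+ 2)^-1.
  under eq_bigr do rewrite prodr_const card_ord.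
  by rewrite prodr_const card_ord -exprM exprM -exprVn mulnC.
have e1 : 0 < (1 + e) ^+ 2 by rewrite exprn_gt0// ltr_pwDl.
apply: ler_prod => i _; apply/andP; split.
  by apply: prodr_ge0 => j _; rewrite invr_ge0 ltW.
apply: ler_prod => j _; rewrite invr_ge0 (ltW e1) /= mxE.
have p : 0 < 1 + ((M i j - c i j) / w) ^+ 2 by rewrite ltr_pwDl// sqr_ge0.
rewrite lef_pV2 ?posrE// -subr_ge0.
have := sqr_entry_le_enorm (M - c) i j; rewrite !mxE => h.
have : ((M i j - c i j) / w) ^+ 2 <= e ^+ 2.
  by rewrite /e !exprMn ler_wpM2r// sqr_ge0.
by have : 0 <= e by []; nra.
Qed.

End cauchy_prod.

(** * Fourier duality and bounds on Lebesgue norms *)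

Section schwartz_integrable.
Variables (R : realType) (m n : nat).
Local Notation mu := (lebesgue_mx R m n).
Implicit Types f g phi : 'M[R]_(m, n) -> R[i].

Lemma schwartz_cmfun f : schwartz f -> cmfun f.
Proof.
move=> [[s1 s2] _]; have [c1 _] := s1 [::]; have [c2 _] := s2 [::].
by split; exact: continuous_mx_measurable.
Qed.

Lemma schwartz_decay f (k : nat) : schwartz f ->
  exists2 B, 0 <= B & forall x, (1 + enorm x) ^+ k * cmod (f x) <= B.
Proof.
move=> [_ sf]; have [B fB] := sf k [::]; exists B => [|x].
  by apply: le_trans (fB 0); rewrite mulr_ge0 ?cmod_ge0// exprn_ge0// addr_ge0 ?enorm_ge0.
by have := fB x; rewrite /cpderiv /pderiv /=; case: (f x).
Qed.

Lemma decay_cintegrable f (w B : R) c : 0 < w -> cmfun f ->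
  (forall x, (1 + enorm (x - c) / w) ^+ (2 * (m * n)) * cmod (f x) <= B) ->
  cintegrable mu f.
Proof.
move=> w0 mf fB.
have wm (i : 'I_m) (j : 'I_n) : 0 < const_mx w i j :> R by rewrite mxE.
have i1 := integrableZl measurableT B (integrable_cauchy_prod c wm).
apply: (cintegrable_le mf i1) => x /=.
have e0 : 0 <= enorm (x - c) / w by rewrite divr_ge0 ?enorm_ge0// ltW.
have e1 : 0 < (1 + enorm (x - c) / w) ^+ (2 * (m * n)) by rewrite exprn_gt0// ltr_pwDl.
have B0 : 0 <= B by apply: le_trans (fB x); rewrite mulr_ge0 ?cmod_ge0// ltW.
apply: le_trans (ler_wpM2l B0 (decay_le_cauchy_prod c x w0)).
by rewrite ler_pdivlMr// mulrC.
Qed.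

Lemma schwartz_cintegrable f : schwartz f -> cintegrable mu f.
Proof.
move=> sf; have [B _ fB] := schwartz_decay (2 * (m * n)) sf.
apply: (@decay_cintegrable f 1 B 0) => //; first exact: schwartz_cmfun.
by move=> x; rewrite subr0 divr1.
Qed.

End schwartz_integrable.

Section complex_fubini.
Context d1 d2 (X : measurableType d1) (Y : measurableType d2) (R : realType).
Variables (m1 : {sigma_finite_measure set X -> \bar R}).
Variables (m2 : {sigma_finite_measure set Y -> \bar R}).
Variable h : X * Y -> R[i].
Hypothesis hi : cintegrable (m1 \x m2)%E h.
Hypothesis h1 : forall x, cintegrable m2 (fun y => h (x, y)).
Hypothesis h2 : forall y, cintegrable m1 (fun x => h (x, y)).

(** Sections are assumed integrable everywhere, so that the inner real-valued integrals agree
    pointwise with the extended ones to which Fubini applies. *)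
Lemma complex_fubini :
  cint m1 (fun x => cint m2 (fun y => h (x, y))) =
  cint m2 (fun y => cint m1 (fun x => h (x, y))).
Proof.
have F (q : R[i] -> R) :
    (m1 \x m2)%E.-integrable setT (fun z => (q (h z))%:E) ->
    (forall x, m2.-integrable setT (fun y => (q (h (x, y)))%:E)) ->
    (forall y, m1.-integrable setT (fun x => (q (h (x, y)))%:E)) ->
    \int[m1]_x \int[m2]_y q (h (x, y)) = \int[m2]_y \int[m1]_x q (h (x, y)).
  move=> i12 i1 i2; rewrite /Rintegral; congr fine.
  transitivity (\int[m1]_x \int[m2]_y (q (h (x, y)))%:E)%E.
    apply: eq_integral => x _; rewrite fineK//; exact: integrable_fin_num.
  rewrite (Fubini i12); apply: eq_integral => y _.
  by rewrite fineK//; exact: integrable_fin_num.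
have [i1 i2] := hi.
rewrite /cint; congr Complex.
  apply: (F (@complex.Re R)) => // [x|y]; [exact: (h1 x).1|exact: (h2 y).1].
apply: (F (@complex.Im R)) => // [x|y]; [exact: (h1 x).2|exact: (h2 y).2].
Qed.

End complex_fubini.

Section fourier.
Variables (R : realType) (m n : nat).
Local Notation mu := (lebesgue_mx R m n).
Implicit Types f g phi : 'M[R]_(m, n) -> R[i].

Lemma cintegralE f : cintegral f = cint mu f. Proof. by []. Qed.

Lemma cintegrable_phase f (g : 'M[R]_(m, n) -> R) : measurable_fun setT g ->
  cintegrable mu f -> cintegrable mu (fun x => f x * expi (g x)).
Proof.
move=> mg fi; apply: (cintegrable_le _ (cintegrable_cmod fi)).
  by apply: cmfunM; [exact: cintegrable_cmfun fi|exact: cmfun_expi].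
by move=> x; rewrite cmodM cmod_expi mulr1.
Qed.

Lemma measurable_phase (y : 'M[R]_(m, n)) :
  measurable_fun setT (fun x : 'M[R]_(m, n) => - (2 * pi * mxdot x y)).
Proof.
apply: measurable_funN; apply: measurable_funM => //; exact: measurable_mxdotl.
Qed.

(** Fubini for f(x) phi(y) exp(- 2 pi i x.y). It shows that the pointwise integral [fourier f]
    satisfies the duality in [is_fourierL2]. *)
Lemma fourier_duality f phi : cintegrable mu f -> cintegrable mu phi ->
  cintegral (fun x => f x * fourier phi x) = cintegral (fun x => fourier f x * phi x).
Proof.
move=> fi pi_.
pose h (z : 'M[R]_(m, n) * 'M[R]_(m, n)) :=
  f z.1 * phi z.2 * expi (- (2 * pi * mxdot z.1 z.2)).
have mh : cmfun h.
  apply: cmfunM; last first.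
    apply: cmfun_expi; apply: measurable_funN; apply: measurable_funM => //.
    exact: measurable_mxdot2.
  exact: cintegrable_cmfun (cintegrable_tensor fi pi_).
have hi : cintegrable (mu \x mu)%E h.
  apply: (cintegrable_le mh (cintegrable_cmod (cintegrable_tensor fi pi_))).
  by move=> z; rewrite /h !cmodM cmod_expi mulr1.
have h1 x : cintegrable mu (fun y => h (x, y)).
  have -> : (fun y => h (x, y)) = (fun y => f x * (phi y * expi (- (2 * pi * mxdot y x)))).
    by apply/funext => y; rewrite /h mxdotC mulrA.
  by apply: cintegrableZ; apply: cintegrable_phase => //; exact: measurable_phase.
have h2 y : cintegrable mu (fun x => h (x, y)).
  have -> : (fun x => h (x, y)) = (fun x => phi y * (f x * expi (- (2 * pi * mxdot x y)))).
    by apply/funext => x; rewrite /h /= mulrA [phi y * _]mulrC.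
  by apply: cintegrableZ; apply: cintegrable_phase => //; exact: measurable_phase.
rewrite !cintegralE; transitivity (cint mu (fun x => cint mu (fun y => h (x, y)))).
  apply: eq_cint => x; rewrite /fourier cintegralE -cintZ; last first.
    by apply: cintegrable_phase => //; exact: measurable_phase.
  by apply: eq_cint => y; rewrite /h mxdotC mulrA.
rewrite (complex_fubini hi h1 h2); apply: eq_cint => y.
rewrite /fourier cintegralE mulrC -cintZ; last first.
  by apply: cintegrable_phase => //; exact: measurable_phase.
by apply: eq_cint => x; rewrite /h /= mulrA [phi y * _]mulrC.
Qed.

Lemma fourier_is_fourierL2 f : cintegrable mu f ->
  square_integrable f -> square_integrable (fourier f) -> is_fourierL2 f (fourier f).
Proof.
move=> fi sf sg; split=> // phi sphi.
by rewrite fourier_duality//; exact: schwartz_cintegrable.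
Qed.

End fourier.

Section Lnorm_bounds.
Context d (T : measurableType d) (R : realType) (mu : {measure set T -> \bar R}).

(** Monotonicity holds without measurability, since the integral of a nonnegative function is a
    supremum over the simple functions below it. It will be applied to the maximal function, whose
    measurability is never established. *)
Lemma ge0_integral_mono (f g : T -> \bar R) : (forall x, 0 <= f x)%E ->
  (forall x, f x <= g x)%E -> (\int[mu]_x f x <= \int[mu]_x g x)%E.
Proof.
move=> f0 fg; have g0 x : (0 <= g x)%E by exact: le_trans (fg x).
rewrite !ge0_integralTE//; apply: le_ereal_sup => _ [h hf <-].
by exists h => // x; apply: le_trans (hf x) (fg x).
Qed.

Lemma lee_poweR (x y : \bar R) (r : R) : 0 <= r ->
  (0 <= x)%E -> (x <= y)%E -> (x `^ r <= y `^ r)%E.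
Proof.
move=> r0 x0 xy; apply: (gt0_ler_poweR r0) => //; rewrite in_itv /= leey andbT//.
exact: le_trans xy.
Qed.

Lemma Lnorm_le (p V : R) (F : T -> \bar R) (G : T -> R) : 0 < p ->
  (forall x, `|F x| <= (G x)%:E)%E ->
  (\int[mu]_x (G x `^ p)%:E <= V%:E)%E ->
  (Lnorm mu p%:E F <= (V `^ p^-1)%:E)%E.
Proof.
move=> p0 FG GV; rewrite unlock -poweR_EFin.
have pp : 0 <= p^-1 by rewrite invr_ge0 ltW.
have I0 : (0 <= \int[mu]_x (`|F x| `^ p))%E.
  by apply: integral_ge0 => x _; exact: poweR_ge0.
apply: lee_poweR => //; apply: le_trans GV; apply: ge0_integral_mono => x.
  exact: poweR_ge0.
by rewrite -poweR_EFin; apply: lee_poweR => //; exact: ltW.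
Qed.

Lemma Lnorm_ge (p V : R) (F : T -> \bar R) (G : T -> R) : 0 < p -> 0 <= V ->
  (forall x, (G x)%:E <= `|F x|)%E -> (forall x, 0 <= G x) ->
  (V%:E <= \int[mu]_x (G x `^ p)%:E)%E ->
  ((V `^ p^-1)%:E <= Lnorm mu p%:E F)%E.
Proof.
move=> p0 V0 FG G0 GV; rewrite unlock -poweR_EFin.
have pp : 0 <= p^-1 by rewrite invr_ge0 ltW.
apply: lee_poweR => //; apply: le_trans GV _; apply: ge0_integral_mono => x.
  by rewrite lee_fin powR_ge0.
by rewrite -poweR_EFin; apply: lee_poweR; rewrite ?lee_fin// ltW.
Qed.

Lemma Lnorm_pinfty_le (V : R) (F : T -> \bar R) : 0 <= V ->
  (forall x, `|F x| <= V%:E)%E -> (Lnorm mu +oo%E F <= V%:E)%E.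
Proof.
move=> V0 FV; rewrite unlock; case: ifP => _; last by rewrite lee_fin.
by apply/ess_supP; apply: aeW => x; exact: FV.
Qed.

End Lnorm_bounds.

(** * Iterated second differences and Hardy norms *)

Section second_difference.
Variables (R : realType) (n : nat).
Implicit Types (b x : 'rV[R]_n).

(** The sign is chosen so that the Fourier multiplier, 4 sin(pi b.xi)^2, is nonnegative. *)
Definition sdiff (V : zmodType) b (f : 'rV[R]_n -> V) x : V :=
  f x *+ 2 - f (x + b) - f (x - b).

Lemma Re_sdiff b (f : 'rV[R]_n -> R[i]) x :
  complex.Re (sdiff b f x) = sdiff b (fun y => complex.Re (f y)) x.
Proof. by rewrite /sdiff; case: (f x); case: (f (x + b)); case: (f (x - b)). Qed.

Lemma Im_sdiff b (f : 'rV[R]_n -> R[i]) x :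
  complex.Im (sdiff b f x) = sdiff b (fun y => complex.Im (f y)) x.
Proof. by rewrite /sdiff; case: (f x); case: (f (x + b)); case: (f (x - b)). Qed.

Lemma Re_iter_sdiff b M (f : 'rV[R]_n -> R[i]) x :
  complex.Re (iter M (sdiff b) f x) = iter M (sdiff b) (fun y => complex.Re (f y)) x.
Proof.
elim: M x => // M IH x; rewrite !iterS Re_sdiff.
by congr (sdiff _ _ _); apply/funext.
Qed.

Lemma Im_iter_sdiff b M (f : 'rV[R]_n -> R[i]) x :
  complex.Im (iter M (sdiff b) f x) = iter M (sdiff b) (fun y => complex.Im (f y)) x.
Proof.
elim: M x => // M IH x; rewrite !iterS Im_sdiff.
by congr (sdiff _ _ _); apply/funext.
Qed.

Lemma iter_sdiff_comp (V : zmodType) b M (f : 'rV[R]_n -> V) (c : R) (x : 'rV[R]_n) :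
  iter M (sdiff b) (fun y => f (c *: y)) x = iter M (sdiff (c *: b)) f (c *: x).
Proof.
elim: M x => // M IH x; rewrite !iterS /sdiff !IH.
by rewrite scalerDr scalerBr.
Qed.

Variable j0 : 'I_n.
Let e : 'rV[R]_n := delta_mx 0 j0.

Lemma enorm_delta : enorm e = 1.
Proof.
rewrite /enorm /mxdot big_ord_recl big_ord0 addr0 (bigD1 j0)//= big1.
  by rewrite mxE !eqxx mulr1 addr0 sqrtr1.
by move=> i ij0; rewrite mxE (negbTE ij0) andbF mul0r.
Qed.

(** [G l] plays the part of the l-th derivative of [G 0] along [e]. Differencing maps chains to
    chains, which drives the induction of [decays_iter_sdiff]. *)
Definition derive_chain (G : nat -> 'rV[R]_n -> R) : Prop :=
  forall l x (s : R), is_derive s (1 : R) (fun u : R => G l (x + u *: e)) (G l.+1 (x + s *: e)).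

Lemma derive_chain_sdiff (G : nat -> 'rV[R]_n -> R) b : derive_chain G ->
  derive_chain (fun l => sdiff b (G l)).
Proof.
move=> dG l x s; rewrite /sdiff.
have E c u : x + u *: e + c = x + c + u *: e by rewrite addrAC.
have H c : is_derive s (1 : R) (fun u : R => G l (x + u *: e + c)) (G l.+1 (x + s *: e + c)).
  rewrite E (_ : (fun u => _) = (fun u => G l (x + c + u *: e))); first exact: dG.
  by apply/funext => u; rewrite E.
have h0 := dG l x s; have h1 := H b; have h2 := H (- b).
exact: (is_deriveB (is_deriveB (is_deriveD h0 h0) h1) h2).
Qed.

Lemma smooth_derive_chain (g : 'rV[R]_n -> R) : smooth g ->
  derive_chain (fun l => pderiv (nseq l (ord0, j0)) g).
Proof.
move=> sg l x s; have [_ /(_ (x + s *: e) ord0 j0) dg] := sg (nseq l (ord0, j0)).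
set G := pderiv _ g in dg *.
rewrite -[pderiv (nseq l.+1 _) g _]/('D_e G (x + s *: e)).
have E : (fun h : R => h^-1 *: ((fun u : R => G (x + u *: e)) (h *: (1 : R) + s) - G (x + s *: e))) =
         (fun h => h^-1 *: (G (h *: e + (x + s *: e)) - G (x + s *: e))).
  apply/funext => h; congr (_ *: (G _ - _)).
  by rewrite -[h *: (1 : R)]/(h * 1) mulr1 scalerDl addrCA.
by apply: DeriveDef; rewrite /derivable /derive /= E.
Qed.

Definition decays k (B : R) (g : 'rV[R]_n -> R) : Prop :=
  forall x, (1 + enorm x) ^+ k * `|g x| <= B.

Lemma oneDenorm_shift (x y : 'rV[R]_n) (c : R) : 0 <= c -> enorm (x - y) <= c ->
  1 + enorm x <= (1 + c) * (1 + enorm y).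
Proof.
move=> c0 xy; have := ler_enormD (x - y) y; rewrite subrK.
by have := enorm_ge0 y; move: (enorm x) (enorm y) (enorm _) xy => a b d; nra.
Qed.

Variable beta : R.
Hypothesis beta0 : 0 <= beta.

(** Mean value theorem; moving the weight from [x] to the intermediate point, at distance at most
    [beta], costs (1 + beta)^k. *)
Lemma decays_fdiff k B (g0 g1 : 'rV[R]_n -> R) (t : R) :
  (forall x (s : R), is_derive s (1 : R) (fun u : R => g0 (x + u *: e)) (g1 (x + s *: e))) ->
  0 <= t <= beta -> decays k B g1 ->
  decays k ((1 + beta) ^+ k * B * t) (fun x => g0 (x + t *: e) - g0 x).
Proof.
move=> dg /andP[t0 tb] g1B x.
move: t0; rewrite le_eqVlt => /predU1P[<-|t0].
  by rewrite scale0r addr0 subrr normr0 mulr0 mulr0.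
pose h (u : R) := g0 (x + u *: e).
have [|c] := @MVT R h (fun s => g1 (x + s *: e)) 0 t t0 (fun s _ => dg x s).
  apply: continuous_subspaceT; apply: (@is_derive_continuous _ _ (fun s => g1 (x + s *: e))).
rewrite in_itv /= => /andP[c0 ct]; rewrite /h scale0r addr0 subr0 => ->.
rewrite normrM (gtr0_norm t0) mulrA ler_wpM2r// ?(ltW t0)//.
apply: le_trans (_ : (1 + beta) ^+ k * ((1 + enorm (x + c *: e)) ^+ k * `|g1 (x + c *: e)|) <= _).
  rewrite mulrA ler_wpM2r// -exprMn lerXn2r ?nnegrE ?mulr_ge0 ?addr_ge0 ?enorm_ge0//.
  apply: oneDenorm_shift => //; rewrite opprD addrA subrr add0r -scaleNr enormZ.
  by rewrite enorm_delta mulr1 normrN gtr0_norm// (le_trans (ltW ct)).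
by rewrite ler_wpM2l// exprn_ge0// addr_ge0.
Qed.

(** Up to sign, a second difference is a twice iterated forward difference based at x - t e. Two
    factors (1 + beta)^k come from the mean value steps, the third from recentring at x. *)
Lemma decays_sdiff k B (G : nat -> 'rV[R]_n -> R) (t : R) l :
  derive_chain G -> 0 <= t <= beta -> decays k B (G l.+2) ->
  decays k ((1 + beta) ^+ (3 * k) * B * t ^+ 2) (sdiff (t *: e) (G l)).
Proof.
move=> dG tb GB; have /andP[t0 t1] := tb.
pose D l' (x : 'rV[R]_n) := G l' (x + t *: e) - G l' x.
have D1 : decays k ((1 + beta) ^+ k * B * t) (D l.+1).
  by apply: decays_fdiff tb GB => x s; exact: dG.
have D2 : decays k ((1 + beta) ^+ k * ((1 + beta) ^+ k * B * t) * t)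
    (fun x => D l (x + t *: e) - D l x).
  apply: decays_fdiff tb D1 => x s; rewrite /D.
  have E c u : x + u *: e + c = x + c + u *: e by rewrite addrAC.
  have H c : is_derive s (1 : R) (fun u : R => G l (x + u *: e + c)) (G l.+1 (x + s *: e + c)).
    rewrite E (_ : (fun u => _) = (fun u => G l (x + c + u *: e))); first exact: dG.
    by apply/funext => u; rewrite E.
  exact: is_deriveB (H (t *: e)) (dG l x s).
move=> x; have := D2 (x - t *: e).
have -> : D l (x - t *: e + t *: e) - D l (x - t *: e) = - sdiff (t *: e) (G l) x.
  by rewrite /D /sdiff subrK; ring.
rewrite normrN => H.
apply: le_trans (_ : (1 + beta) ^+ k * ((1 + enorm (x - t *: e)) ^+ k *
  `|sdiff (t *: e) (G l) x|) <= _).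
  rewrite mulrA ler_wpM2r// -exprMn lerXn2r ?nnegrE ?mulr_ge0 ?addr_ge0 ?enorm_ge0//.
  apply: oneDenorm_shift => //; rewrite opprB addrCA subrr addr0 enormZ.
  by rewrite enorm_delta mulr1 ger0_norm.
apply: le_trans (ler_wpM2l _ H) _; first by rewrite exprn_ge0// addr_ge0.
by rewrite le_eqVlt; apply/orP; left; apply/eqP; rewrite mulnC exprM; ring.
Qed.

(** The innermost difference is absorbed into the chain, so that each round uses two derivatives and
    yields t^2. *)
Lemma decays_iter_sdiff k M B (G : nat -> 'rV[R]_n -> R) (t : R) :
  derive_chain G -> 0 <= t <= beta -> decays k B (G (2 * M)%N) ->
  decays k ((1 + beta) ^+ (3 * k * M) * B * t ^+ (2 * M)) (iter M (sdiff (t *: e)) (G 0%N)).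
Proof.
elim: M B G => [|M IH] B G dG tb GB.
  by rewrite !muln0 !expr0 mul1r mulr1.
rewrite iterSr; have := IH _ _ (derive_chain_sdiff (t *: e) dG) tb.
move=> /(_ ((1 + beta) ^+ (3 * k) * B * t ^+ 2)) H x.
apply: le_trans (H _ x) _.
  by apply: decays_sdiff => //; move: GB; rewrite mulnS.
by rewrite le_eqVlt; apply/orP; left; apply/eqP; rewrite !mulnS !exprD; ring.
Qed.

(* The factor t ^+ (2 * M) is what moment cancellation would give for an atom. *)
Lemma schwartz_iter_sdiff (f : 'rV[R]_n -> R[i]) k M : schwartz f ->
  exists2 B, 0 <= B & forall t x, 0 <= t <= beta ->
    (1 + enorm x) ^+ k * cmod (iter M (sdiff (t *: e)) f x) <= B * t ^+ (2 * M).
Proof.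
move=> [[s1 s2] sf]; have [B fB] := sf k (nseq (2 * M) (ord0, j0)).
have p0 x : 0 <= (1 + enorm x : R) ^+ k by rewrite exprn_ge0// addr_ge0// enorm_ge0.
have B0 : 0 <= B by apply: le_trans (fB 0); rewrite mulr_ge0// cmod_ge0.
have d1 : decays k B (pderiv (nseq (2 * M) (ord0, j0)) (fun x => complex.Re (f x))).
  move=> x; apply: le_trans (fB x); rewrite ler_wpM2l//.
  exact: (ler_Re_cmod (cpderiv _ f x)).
have d2 : decays k B (pderiv (nseq (2 * M) (ord0, j0)) (fun x => complex.Im (f x))).
  move=> x; apply: le_trans (fB x); rewrite ler_wpM2l//.
  exact: (ler_Im_cmod (cpderiv _ f x)).
exists (2 * ((1 + beta) ^+ (3 * k * M) * B)).
  by rewrite mulr_ge0// mulr_ge0// exprn_ge0// addr_ge0.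
move=> t x tb.
have h1 := decays_iter_sdiff (smooth_derive_chain s1) tb d1 x.
have h2 := decays_iter_sdiff (smooth_derive_chain s2) tb d2 x.
apply: le_trans (ler_wpM2l (p0 x) (ler_cmod_ReIm _)) _.
rewrite Re_iter_sdiff Im_iter_sdiff mulrDr.
by apply: le_trans (lerD h1 h2) _; rewrite -mulrA mulrA; lra.
Qed.

End second_difference.

(** * Maximal function bounds for iterated differences *)

Section convolution_bounds.
Variables (R : realType) (n : nat).
Local Notation mu := (lebesgue_mx R 1 n).
Implicit Types (u h f : 'rV[R]_n -> R[i]) (b x y : 'rV[R]_n).

Lemma oneDenorm_ge1 (t : R) x : 0 < t -> 1 <= 1 + enorm x / t.
Proof. by move=> t0; rewrite lerDl divr_ge0 ?enorm_ge0// ltW. Qed.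

Lemma enormN x : enorm (- x) = enorm x.
Proof. by rewrite -scaleN1r enormZ normrN1 mul1r. Qed.

(** Peetre's inequality with two scales, both dominated by [r]. *)
Lemma oneDenorm_peetre (t w r : R) x y : 0 < t -> 0 < w -> t <= r -> w <= r ->
  1 + enorm x / r <= (1 + enorm (x - y) / t) * (1 + enorm y / w).
Proof.
move=> t0 w0 tr wr; have r0 : 0 < r by exact: lt_le_trans tr.
have h := ler_enormD (x - y) y; rewrite subrK in h.
have a0 := enorm_ge0 (x - y); have b0 := enorm_ge0 y.
have h1 : enorm (x - y) / r <= enorm (x - y) / t by rewrite ler_wpM2l// lef_pV2.
have h2 : enorm y / r <= enorm y / w by rewrite ler_wpM2l// lef_pV2.
have h3 : enorm x / r <= enorm (x - y) / r + enorm y / r.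
  by rewrite -mulrDl ler_wpM2r// invr_ge0 ltW.
have q1 : 0 <= enorm (x - y) / t by rewrite divr_ge0// ltW.
have q2 : 0 <= enorm y / w by rewrite divr_ge0// ltW.
move: h1 h2 h3 q1 q2; move: (_ / r) (_ / r) (_ / r) (_ / t) (_ / w) => a b c d e; nra.
Qed.

Lemma cmfun_comp (f : 'rV[R]_n -> R[i]) (g : 'rV[R]_n -> 'rV[R]_n) :
  cmfun f -> measurable_fun setT g -> cmfun (fun x => f (g x)).
Proof. by move=> [m1 m2] mg; split; [exact: (measurableT_comp m1)|exact: (measurableT_comp m2)]. Qed.

Lemma measurable_subl x : measurable_fun setT (fun y : 'rV[R]_n => x - y).
Proof.
apply: measurable_mxP => i j; under eq_fun do rewrite !mxE.
by apply: measurable_funB => //; exact: measurable_entry.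
Qed.

Lemma measurable_addr x : measurable_fun setT (fun y : 'rV[R]_n => y + x).
Proof. exact: measurable_addmx. Qed.

(* u decays at scale t and h at scale w: their convolution decays at the larger
   scale, and the integral is taken over the smaller one. *)
Lemma conv_bound u h (A B t w : R) L x :
  0 < t -> 0 < w -> 0 <= A -> 0 <= B -> cmfun u -> cmfun h ->
  (forall z, (1 + enorm z / t) ^+ (L + 2 * n) * cmod (u z) <= B) ->
  (forall y, (1 + enorm y / w) ^+ (L + 2 * n) * cmod (h y) <= A) ->
  cintegrable mu (fun y => u (x - y) * h y) /\
  (1 + enorm x / Num.max t w) ^+ L * cmod (convolution u h x) <=
    2 * A * B * (pi * Num.min t w) ^+ n.
Proof.
move=> t0 w0 A0 B0 mcu mch uB hA.
pose r := Num.max t w; pose v := Num.min t w.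
have r0 : 0 < r by rewrite lt_max t0.
have v0 : 0 < v by rewrite lt_min t0.
(* The centre of the narrower factor as a function of y: [u (x - y)] peaks at y = x, [h] at y =
   0. *)
pose c := if t <= w then x else 0.
have p0 y : 0 < (1 + enorm (y - c) / v) ^+ (2 * n).
  by rewrite exprn_gt0// (lt_le_trans _ (oneDenorm_ge1 _ v0)).
have rx : 0 < (1 + enorm x / r) ^+ L.
  by rewrite exprn_gt0// (lt_le_trans _ (oneDenorm_ge1 _ r0)).
(* Of the L + 2 n orders of decay, L pay for the decay in x through Peetre's inequality; the other 2
   n of the narrower factor make the integral over y converge at scale v. *)
have key y : (1 + enorm x / r) ^+ L * ((1 + enorm (y - c) / v) ^+ (2 * n) * cmod (u (x - y) * h y)) <= A * B.
  have pee : 1 + enorm x / r <= (1 + enorm (x - y) / t) * (1 + enorm y / w).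
    by apply: oneDenorm_peetre; rewrite // /r le_max lexx ?orbT.
  have := uB (x - y); have := hA y; rewrite cmodM; move: pee.
  have := cmod_ge0 (u (x - y)); have := cmod_ge0 (h y).
  have := oneDenorm_ge1 y w0; have := oneDenorm_ge1 (x - y) t0.
  have := oneDenorm_ge1 x r0.
  have -> : 1 + enorm (y - c) / v = if t <= w then 1 + enorm (x - y) / t else 1 + enorm y / w.
    rewrite /c /v; case: leP => _; first by rewrite -opprB enormN.
    by rewrite subr0.
  move: (cmod _) (cmod _) (1 + _ / r) (1 + _ / w) (1 + _ / t) => cu ch X F E.
  move=> X1 E1 F1 ch0 cu0 XEF hF hE.
  have X0 : 0 <= X by exact: le_trans X1.
  have E0 : 0 <= E by exact: le_trans E1.
  have F0 : 0 <= F by exact: le_trans F1.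
  have XL : X ^+ L <= E ^+ L * F ^+ L by rewrite -exprMn lerXn2r// nnegrE mulr_ge0.
  have ge1 (a : R) k : 1 <= a -> a ^+ k <= a ^+ (k + 2 * n).
    by move=> a1; rewrite ler_weXn2l// leq_addr.
  case: ifP => _.
    apply: le_trans (_ : (F ^+ L * ch) * (E ^+ (L + 2 * n) * cu) <= _).
      apply: le_trans (ler_wpM2r _ XL) _; first by rewrite !mulr_ge0// exprn_ge0.
      by rewrite exprD le_eqVlt; apply/orP; left; apply/eqP; ring.
    apply: ler_pM => //; rewrite ?mulr_ge0 ?exprn_ge0//.
    by apply: le_trans hF; rewrite ler_wpM2r// ge1.
  apply: le_trans (_ : (F ^+ (L + 2 * n) * ch) * (E ^+ L * cu) <= _).
    apply: le_trans (ler_wpM2r _ XL) _; first by rewrite !mulr_ge0// exprn_ge0.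
    by rewrite exprD le_eqVlt; apply/orP; left; apply/eqP; ring.
  apply: ler_pM => //; rewrite ?mulr_ge0 ?exprn_ge0//.
  by apply: le_trans hE; rewrite ler_wpM2r// ge1.
have mi : cmfun (fun y => u (x - y) * h y).
  by apply: cmfunM => //; apply: cmfun_comp => //; exact: measurable_subl.
have ci : cintegrable mu (fun y => u (x - y) * h y).
  apply: (@decay_cintegrable _ _ _ _ v (A * B / (1 + enorm x / r) ^+ L) c) => // y.
  by rewrite mul1n ler_pdivlMr// [leLHS]mulrC key.
split=> //.
have vm (i : 'I_1) (j : 'I_n) : 0 < const_mx v i j :> R by rewrite mxE.
rewrite mulrC -ler_pdivlMr// -lee_fin.
apply: le_trans (cmod_cint_le ci) _.
apply: (@le_trans _ _ (2%:E * \int[mu]_y ((A * B / (1 + enorm x / r) ^+ L) * cauchy_prod (const_mx v) c y)%:E)%E).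
  apply: lee_wpmul2l => //; apply: ge0_integral_mono => y; first by rewrite lee_fin cmod_ge0.
  rewrite lee_fin; have := decay_le_cauchy_prod c y v0; rewrite mul1n => H.
  apply: le_trans (ler_wpM2l _ H); last by rewrite divr_ge0 ?mulr_ge0// ltW.
  by rewrite ler_pdivlMr// ler_pdivlMr// [leLHS]mulrC [cmod _ * _]mulrC key.
under eq_integral do rewrite EFinM.
rewrite ge0_integralZl//; last 3 first.
- by apply/measurable_EFinP; exact: measurable_cauchy_prod.
- by move=> y _; rewrite lee_fin cauchy_prod_ge0.
- by rewrite lee_fin divr_ge0 ?mulr_ge0// ltW.
rewrite integral_cauchy_prod// -!EFinM lee_fin.
rewrite big_ord_recl big_ord0 mulr1; under eq_bigr do rewrite mxE.
rewrite prodr_const card_ord le_eqVlt; apply/orP; left; apply/eqP; ring.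
Qed.

Lemma cmfun_sdiff b h : cmfun h -> cmfun (sdiff b h).
Proof.
move=> mh; have m1 := cmfun_comp mh (measurable_addr b).
have m2 := cmfun_comp mh (measurable_addr (- b)).
have mN (g : 'rV[R]_n -> R[i]) : cmfun g -> cmfun (fun x => - g x).
  by move=> mg; have := cmfunM (cmfun_cst _ (-1)) mg; under eq_fun do rewrite mulN1r.
have m0 : cmfun (fun x => h x *+ 2).
  by have := cmfunD mh mh; under eq_fun do rewrite -mulr2n.
have := cmfunD (cmfunD m0 (mN _ m1)) (mN _ m2).
by rewrite /sdiff.
Qed.

Lemma cmfun_iter_sdiff b M h : cmfun h -> cmfun (iter M (sdiff b) h).
Proof. by move=> mh; elim: M => // M IH; rewrite iterS; exact: cmfun_sdiff. Qed.

Lemma cint_sdiff_lin (a b c : 'rV[R]_n -> R[i]) :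
  cintegrable mu a -> cintegrable mu b -> cintegrable mu c ->
  cintegrable mu (fun y => a y *+ 2 - b y - c y) /\
  cint mu (fun y => a y *+ 2 - b y - c y) = cint mu a *+ 2 - cint mu b - cint mu c.
Proof.
move=> ia ib ic.
have E : (fun y => a y *+ 2 - b y - c y) =
    (fun y => (2 * a y + (-1) * b y) + (-1) * c y).
  by apply/funext => y; rewrite !mulN1r mulr_natl.
have i2 := cintegrableZ 2 ia; have ib' := cintegrableZ (-1) ib.
have ic' := cintegrableZ (-1) ic.
rewrite E; split; first by apply: cintegrableD => //; exact: cintegrableD.
rewrite cintD//; last exact: cintegrableD.
by rewrite cintD// !cintZ// !mulN1r mulr_natl.
Qed.

Lemma conv_translate u h b x : cmfun u -> cmfun h ->
  (forall z, cintegrable mu (fun y => u (z - y) * h y)) ->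
  cintegrable mu (fun y => u (x - y) * h (y + b)) /\
  cint mu (fun y => u (x - y) * h (y + b)) = convolution u h (x + b).
Proof.
move=> mu_ mh uh.
pose F y := u (x + b - y) * h y.
have mF : cmfun F.
  by apply: cmfunM => //; apply: cmfun_comp => //; exact: measurable_subl.
have E : (fun y => u (x - y) * h (y + b)) = (fun y => F (y + b)).
  by apply/funext => y; rewrite /F opprD addrACA subrr addr0.
rewrite E; split.
  apply/(cintegrable_preserving (measurable_addr b) (@lebesgue_mxD _ _ _ b) mF).
  exact: uh.
exact: (cint_preserving (measurable_addr b) (@lebesgue_mxD _ _ _ b) mF).
Qed.

Lemma conv_sdiff u h b : cmfun u -> cmfun h ->
  (forall z, cintegrable mu (fun y => u (z - y) * h y)) ->
  [/\ (forall z, cintegrable mu (fun y => sdiff b u (z - y) * h y)),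
      (forall z, cintegrable mu (fun y => u (z - y) * sdiff b h y)) &
      forall x, convolution u (sdiff b h) x = convolution (sdiff b u) h x].
Proof.
move=> mu_ mh uh.
have E1 z : (fun y => sdiff b u (z - y) * h y) = (fun y => (u (z - y) * h y) *+ 2 -
    u (z + b - y) * h y - u (z - b - y) * h y).
  apply/funext => y; rewrite /sdiff !mulrBl mulrnAl.
  by congr (_ - u _ * _ - u _ * _); rewrite addrAC.
have E2 z : (fun y => u (z - y) * sdiff b h y) = (fun y => (u (z - y) * h y) *+ 2 -
    u (z - y) * h (y + b) - u (z - y) * h (y - b)).
  by apply/funext => y; rewrite /sdiff !mulrBr mulrnAr.
have T c z := conv_translate c z mu_ mh uh.
split => z.
- by rewrite E1; exact: (cint_sdiff_lin (uh z) (uh (z + b)) (uh (z - b))).1.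
- by rewrite E2; exact: (cint_sdiff_lin (uh z) (T b z).1 (T (- b) z).1).1.
- rewrite /convolution !cintegralE E1 E2.
  rewrite (cint_sdiff_lin (uh z) (uh (z + b)) (uh (z - b))).2.
  rewrite (cint_sdiff_lin (uh z) (T b z).1 (T (- b) z).1).2.
  by rewrite (T b z).2 (T (- b) z).2.
Qed.

(** Convolution commutes with translations. The differences are thereby moved from the packet to the
    kernel, which is smoother when its scale is larger. *)
Lemma conv_iter_sdiff u h b M x : cmfun u -> cmfun h ->
  (forall z, cintegrable mu (fun y => u (z - y) * h y)) ->
  convolution u (iter M (sdiff b) h) x = convolution (iter M (sdiff b) u) h x.
Proof.
move=> mu_ mh uh; elim: M u mu_ uh => // M IH u mu_ uh.
have uhM : forall z, cintegrable mu (fun y => u (z - y) * iter M (sdiff b) h y).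
  elim: (M) => // k IHk; rewrite iterS.
  by have [] := conv_sdiff b mu_ (cmfun_iter_sdiff b k mh) IHk.
rewrite iterS iterSr.
have [_ _ ->] := conv_sdiff b mu_ (cmfun_iter_sdiff b M mh) uhM.
by apply: IH; [exact: cmfun_sdiff|have [] := conv_sdiff b mu_ mh uh].
Qed.

Lemma cmod_sdiff_bound h b (w c A : R) K x : 0 < w -> 0 <= c -> enorm b <= c * w ->
  (forall y, (1 + enorm y / w) ^+ K * cmod (h y) <= A) ->
  (1 + enorm x / w) ^+ K * cmod (sdiff b h x) <= 4 * (1 + c) ^+ K * A.
Proof.
move=> w0 c0 bc hA.
have wE y : enorm y / w = enorm (w^-1 *: y).
  by rewrite enormZ ger0_norm ?invr_ge0 ?(ltW w0)// mulrC.
have sh y : enorm (x - y) <= c * w ->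
    (1 + enorm x / w) ^+ K * cmod (h y) <= (1 + c) ^+ K * A.
  move=> xy; apply: le_trans (_ : (1 + c) ^+ K * ((1 + enorm y / w) ^+ K * cmod (h y)) <= _).
    rewrite mulrA ler_wpM2r ?cmod_ge0// -exprMn.
    rewrite lerXn2r ?nnegrE ?mulr_ge0 ?addr_ge0 ?divr_ge0 ?enorm_ge0 ?(ltW w0)//.
    rewrite !wE; apply: oneDenorm_shift => //.
    by rewrite -scalerBr -wE ler_pdivrMr.
  by rewrite ler_wpM2l// exprn_ge0// addr_ge0.
have h0 := sh x; have h1 := sh (x + b); have h2 := sh (x - b).
have p0 : 0 <= (1 + enorm x / w) ^+ K.
  by rewrite exprn_ge0// addr_ge0// divr_ge0 ?enorm_ge0// ltW.
have hN z : cmod (- z) = cmod z by exact: normcN.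
have : cmod (sdiff b h x) <= cmod (h x) + cmod (h x) + cmod (h (x + b)) + cmod (h (x - b)).
  rewrite /sdiff; apply: le_trans (ler_cmodD _ _) _; rewrite hN lerD2r.
  apply: le_trans (ler_cmodD _ _) _; rewrite hN lerD2r mulr2n.
  exact: ler_cmodD.
move=> /(ler_wpM2l p0) H; apply: le_trans H _; rewrite !mulrDr.
rewrite opprD addrA subrr add0r enormN in h1; rewrite opprB addrCA subrr addr0 in h2.
have x0 : enorm (x - x) <= c * w.
  by rewrite subrr -(scale0r x) enormZ normr0 mul0r mulr_ge0// ltW.
have := h0 x0; have := h1 bc; have := h2 bc; lra.
Qed.

Lemma cmod_iter_sdiff_bound h b (w c A : R) K M x : 0 < w -> 0 <= c -> enorm b <= c * w ->
  (forall y, (1 + enorm y / w) ^+ K * cmod (h y) <= A) ->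
  (1 + enorm x / w) ^+ K * cmod (iter M (sdiff b) h x) <= (4 * (1 + c) ^+ K) ^+ M * A.
Proof.
move=> w0 c0 bc hA; elim: M x => [|M IH] x; first by rewrite mul1r.
by rewrite iterS exprS -[leRHS]mulrA; exact: cmod_sdiff_bound.
Qed.

Variable j0 : 'I_n.
Variables (Phi : 'rV[R]_n -> R[i]) (beta : R) (L M : nat).
Hypotheses (sPhi : schwartz Phi) (beta0 : 0 <= beta) (LM : (L <= 2 * M)%N).
Let e : 'rV[R]_n := delta_mx 0 j0.

(** The analogue of the estimate for an atom at scale w. For t <= w the size of the differenced
    function is enough. For t > w the differences act on the kernel and gain (beta / (N t))^(2M),
    which pays for replacing the decay at scale t by decay at scale w. *)
Lemma hardy_pointwise : exists2 C, 0 <= C &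
  forall h (w N A : R), 0 < w -> 0 < N -> 1 <= N * w -> 0 <= A -> cmfun h ->
  (forall y, (1 + enorm y / w) ^+ (L + 2 * n) * cmod (h y) <= A) ->
  (forall x, (1 + enorm x / w) ^+ L * cmod (iter M (sdiff ((beta / N) *: e)) h x) <= C * A) /\
  (forall t x, 0 < t -> (1 + enorm x / w) ^+ L *
     cmod (convolution (dilate Phi t) (iter M (sdiff ((beta / N) *: e)) h) x) <= C * A).
Proof.
pose K := (L + 2 * n)%N.
have [B1 B10 PB1] := schwartz_decay K sPhi.
have [B2 B20 PB2] := schwartz_iter_sdiff j0 beta0 K M sPhi.
have piN : 0 <= (pi : R) ^+ n by rewrite exprn_ge0// pi_ge0.
pose C0 := (4 * (1 + beta) ^+ K) ^+ M.
have C00 : 0 <= C0 by rewrite exprn_ge0// mulr_ge0// exprn_ge0// addr_ge0.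
pose b2 := beta ^+ (2 * M).
have b20 : 0 <= b2 by rewrite exprn_ge0.
(* One summand for each estimate: the function itself, t <= w, and t > w. *)
exists (C0 + 2 * C0 * B1 * pi ^+ n + 2 * (B2 * b2) * pi ^+ n).
  by rewrite !addr_ge0// !mulr_ge0.
move=> h w N A w0 N0 Nw A0 mh hA.
set b := (beta / N) *: e; set f := iter M (sdiff b) h.
have eb : enorm b <= beta * w.
  rewrite enormZ enorm_delta mulr1 ger0_norm ?divr_ge0 ?(ltW N0)//.
  by rewrite ler_wpM2l// -div1r ler_pdivrMr// mulrC.
have mf : cmfun f by exact: cmfun_iter_sdiff.
have fA x : (1 + enorm x / w) ^+ K * cmod (f x) <= C0 * A.
  exact: cmod_iter_sdiff_bound.
have C1A : 0 <= 2 * C0 * B1 * pi ^+ n * A by rewrite !mulr_ge0.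
have C2A : 0 <= 2 * (B2 * b2) * pi ^+ n * A by rewrite !mulr_ge0.
have C0A : 0 <= C0 * A by rewrite mulr_ge0.
split=> [x|t x t0].
  have h1 : (1 + enorm x / w) ^+ L * cmod (f x) <= C0 * A.
    apply: le_trans (fA x); rewrite ler_wpM2r ?cmod_ge0//.
    by rewrite ler_weXn2l ?oneDenorm_ge1// leq_addr.
  by rewrite !mulrDl; move: h1; lra.
have tn : 0 < t ^+ n by rewrite exprn_gt0.
have mPhi := schwartz_cmfun sPhi.
have mZ : measurable_fun setT (fun x : 'rV[R]_n => t^-1 *: x).
  apply: measurable_mxP => i j; under eq_fun do rewrite mxE.
  by apply: measurable_funM => //; exact: measurable_entry.
have mu_ : cmfun (dilate Phi t).
  by apply: cmfunM; [exact: cmfun_cst|exact: cmfun_comp].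
have tE z : enorm z / t = enorm (t^-1 *: z).
  by rewrite enormZ ger0_norm ?invr_ge0 ?(ltW t0)// mulrC.
have uB z : (1 + enorm z / t) ^+ K * cmod (dilate Phi t z) <= B1 / t ^+ n.
  rewrite /dilate cmod_realM ger0_norm ?invr_ge0 ?(ltW tn)// mulrCA [leRHS]mulrC.
  by rewrite ler_wpM2l ?invr_ge0 ?(ltW tn)// tE.
have Bt : 0 <= B1 / t ^+ n by rewrite divr_ge0// ltW.
have [tw|wt] := leP t w.
  have [_] := conv_bound x t0 w0 C0A Bt mu_ mf uB fA.
  rewrite (max_idPr tw) (min_idPl tw) => H; apply: le_trans H _.
  have -> : 2 * (C0 * A) * (B1 / t ^+ n) * (pi * t) ^+ n = 2 * C0 * B1 * pi ^+ n * A.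
    by rewrite exprMn; move: (pi ^+ n) => P; field; rewrite gt_eqF.
  by rewrite !mulrDl; lra.
have uh z : cintegrable mu (fun y => dilate Phi t (z - y) * h y).
  by have [] := conv_bound z t0 w0 A0 Bt mu_ mh uB hA.
rewrite conv_iter_sdiff//.
(* The step of the differences relative to the scale t of the kernel; it is at most [beta] because N
   t >= N w >= 1. *)
pose tau := beta / (N * t).
have Nt : 1 <= N * t by rewrite (le_trans Nw)// ler_wpM2l// ltW.
have Nt0 : 0 < N * t by exact: lt_le_trans Nt.
have tau01 : 0 <= tau <= beta.
  by rewrite divr_ge0 ?(ltW Nt0)//= ler_pdivrMr// ler_peMr.
have dE z : iter M (sdiff b) (dilate Phi t) z =
    Complex (t ^- n) 0 * iter M (sdiff (tau *: e)) Phi (t^-1 *: z).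
  have -> : tau *: e = t^-1 *: b by rewrite scalerA; congr (_ *: _); rewrite /tau invfM; ring.
  rewrite -iter_sdiff_comp; elim: (M) z => // k IHk z; rewrite !iterS /sdiff !IHk.
  by rewrite !mulrBr mulrnAr.
have tauM : 0 <= tau ^+ (2 * M) by rewrite exprn_ge0//; case/andP: tau01.
have Bt2 : 0 <= B2 * tau ^+ (2 * M) / t ^+ n by rewrite divr_ge0 ?mulr_ge0// ltW.
have uB2 z : (1 + enorm z / t) ^+ K * cmod (iter M (sdiff b) (dilate Phi t) z) <=
    B2 * tau ^+ (2 * M) / t ^+ n.
  rewrite dE cmod_realM ger0_norm ?invr_ge0 ?(ltW tn)// mulrCA [leRHS]mulrC.
  by rewrite ler_wpM2l ?invr_ge0 ?(ltW tn)// tE PB2.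
have [_] := conv_bound x t0 w0 A0 Bt2 (cmfun_iter_sdiff b M mu_) mh uB2 hA.
rewrite (max_idPl (ltW wt)) (min_idPr (ltW wt)) => H.
have q1 : 1 <= t / w by rewrite ler_pdivlMr// mul1r ltW.
have q0 : 0 <= t / w by exact: le_trans q1.
have qN : t / w <= N * t.
  by rewrite ler_pdivrMr// mulrAC ler_peMl// ltW.
have xw : (1 + enorm x / w) ^+ L <= (t / w) ^+ L * (1 + enorm x / t) ^+ L.
  rewrite -exprMn lerXn2r ?nnegrE ?mulr_ge0 ?addr_ge0 ?divr_ge0 ?enorm_ge0 ?invr_ge0 ?(ltW w0) ?(ltW t0)//.
  have -> : t / w * (1 + enorm x / t) = t / w + enorm x / w.
    by field; rewrite (gt_eqF w0) (gt_eqF t0).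
  by rewrite lerD2r.
have qL0 : 0 <= (t / w) ^+ L by rewrite exprn_ge0.
apply: le_trans (ler_wpM2r (cmod_ge0 _) xw) _.
rewrite -[leLHS]mulrA; apply: le_trans (ler_wpM2l qL0 H) _.
(* Passing from scale t to scale w costs (t / w)^L. Since N w >= 1 and L <= 2 M, this is at most (N
   t)^(2M), which cancels against tau^(2M). *)
have qL : (t / w) ^+ L <= (N * t) ^+ (2 * M).
  apply: (@le_trans _ _ ((t / w) ^+ (2 * M))); first by rewrite ler_weXn2l.
  by rewrite lerXn2r// nnegrE ltW.
have wn : (w / t) ^+ n <= 1.
  by rewrite exprn_ile1// ?divr_ge0 ?(ltW w0) ?(ltW t0)// ler_pdivrMr// mul1r ltW.
have wn0 : 0 <= (w / t) ^+ n by rewrite exprn_ge0// divr_ge0 ?(ltW w0) ?(ltW t0).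
apply: (@le_trans _ _ ((N * t) ^+ (2 * M) * (2 * A * (B2 * tau ^+ (2 * M) / t ^+ n) * (pi * w) ^+ n))).
  have pw : 0 <= (pi * w) ^+ n by rewrite exprn_ge0// mulr_ge0 ?pi_ge0// ltW.
  by rewrite ler_wpM2r// mulr_ge0// mulr_ge0// mulr_ge0.
have -> : (N * t) ^+ (2 * M) * (2 * A * (B2 * tau ^+ (2 * M) / t ^+ n) * (pi * w) ^+ n)
   = 2 * (B2 * b2) * pi ^+ n * A * (w / t) ^+ n.
  have -> : b2 = tau ^+ (2 * M) * (N * t) ^+ (2 * M).
    by rewrite -exprMn /tau divfK ?gt_eqF.
  rewrite [(pi * w) ^+ n]exprMn [(w / t) ^+ n]exprMn exprVn.
  by move: (pi ^+ n) (tau ^+ _) ((N * t) ^+ _) (w ^+ n) (t ^- n) => P Q S W V; ring.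
apply: le_trans (_ : 2 * (B2 * b2) * pi ^+ n * A * 1 <= _); first by rewrite ler_wpM2l.
by rewrite !mulrDl; lra.
Qed.

(** The power r of the bound decays with order L r >= 2 n, enough for the Cauchy majorant, whose
    integral is (pi w)^n. The exponent of w is n / p, read as 0 for p infinite. *)
Lemma Lnorm_decay (p : \bar R) : (0 < p)%E ->
  (forall r, p = r%:E -> (2 * n)%:R <= L%:R * r) ->
  exists2 Kp, 0 <= Kp & forall (F : 'rV[R]_n -> \bar R) (C w : R), 0 <= C -> 0 < w ->
  (forall x, `|F x| <= (C / (1 + enorm x / w) ^+ L)%:E)%E ->
  (Lnorm mu p F <= (Kp * C * w `^ (n%:R * fine (p^-1)%E))%:E)%E.
Proof.
case: p => [r| |] // r0 hL; last first.
  exists 1 => // F C w C0 w0 FC; rewrite invey /= mulr0 powRr0 mulr1 mul1r.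
  apply: Lnorm_pinfty_le => // x; apply: le_trans (FC x) _; rewrite lee_fin.
  by rewrite ler_pdivrMr ?exprn_gt0 ?(lt_le_trans _ (oneDenorm_ge1 x w0))// ler_peMr// exprn_ege1// oneDenorm_ge1.
rewrite lte_fin in r0; have {}hL := hL r erefl.
exists ((pi ^+ n) `^ r^-1); first exact: powR_ge0.
move=> F C w C0 w0 FC.
have E : fine (r%:E^-1)%E = r^-1 by rewrite inver gt_eqF.
have piw : 0 <= (pi : R) * w by rewrite mulr_ge0 ?pi_ge0// ltW.
have -> : (pi ^+ n) `^ r^-1 * C * w `^ (n%:R * fine (r%:E^-1)%E) =
    (C `^ r * (pi * w) ^+ n) `^ r^-1.
  rewrite powRM ?powR_ge0 ?exprn_ge0// -powRrM divff ?gt_eqF// powRr1//.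
  rewrite exprMn powRM ?exprn_ge0 ?pi_ge0 ?(ltW w0)// E powRrM powR_mulrn ?(ltW w0)//.
  by rewrite mulrA [C * _]mulrC.
apply: (Lnorm_le r0 FC).
apply: (@le_trans _ _ (\int[mu]_x (C `^ r * cauchy_prod (const_mx w) 0 x)%:E)%E).
  apply: ge0_integral_mono => x; first by rewrite lee_fin powR_ge0.
  have a1 := oneDenorm_ge1 x w0; have a0 : 0 < 1 + enorm x / w by exact: lt_le_trans a1.
  rewrite lee_fin powRM ?invr_ge0 ?exprn_ge0 ?(ltW a0)//.
  rewrite ler_wpM2l ?powR_ge0//.
  have := decay_le_cauchy_prod (0 : 'rV[R]_n) x w0; rewrite mul1n subr0; apply: le_trans.
  rewrite -!powR_mulrn ?(ltW a0)// -!powRN -powRrM.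
  by rewrite ler_powR// mulNr lerN2.
under eq_integral do rewrite EFinM.
rewrite ge0_integralZl//; last 3 first.
- by apply/measurable_EFinP; exact: measurable_cauchy_prod.
- by move=> y _; rewrite lee_fin cauchy_prod_ge0.
- by rewrite lee_fin powR_ge0.
rewrite integral_cauchy_prod; last by move=> i j; rewrite mxE.
rewrite -EFinM lee_fin big_ord_recl big_ord0 mulr1; under eq_bigr do rewrite mxE.
by rewrite prodr_const card_ord.
Qed.

Lemma Hnorm_bound (p : \bar R) : (0 < p)%E ->
  (forall r, p = r%:E -> (2 * n)%:R <= L%:R * r) ->
  exists2 C, 0 <= C &
  forall h (w N A : R), 0 < w -> 0 < N -> 1 <= N * w -> 0 <= A -> cmfun h ->
  (forall y, (1 + enorm y / w) ^+ (L + 2 * n) * cmod (h y) <= A) ->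
  (Hnorm Phi p (iter M (sdiff ((beta / N) *: e)) h) <=
     (C * A * w `^ (n%:R * fine (p^-1)%E))%:E)%E.
Proof.
move=> p0 hL; have [Kp Kp0 HK] := Lnorm_decay p0 hL.
have [C C0 HC] := hardy_pointwise.
exists (Kp * C); first by rewrite mulr_ge0.
move=> h w N A w0 N0 Nw A0 mh hA; rewrite -[Kp * C * A]mulrA.
have [H1 H2] := HC h w N A w0 N0 Nw A0 mh hA.
have CA : 0 <= C * A by rewrite mulr_ge0.
have a0 x : 0 < (1 + enorm x / w) ^+ L by rewrite exprn_gt0// (lt_le_trans _ (oneDenorm_ge1 x w0)).
rewrite /Hnorm; case: ifP => _; apply: HK => // x.
  set f := iter _ _ _ in H1 H2 *.
  have m0 : (0 <= maximal Phi f x)%E.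
    apply: le_trans (_ : ((cmod (convolution (dilate Phi 1) f x))%:E <= _)%E).
      by rewrite lee_fin cmod_ge0.
    by apply: ereal_sup_ubound; exists 1 => //=.
  rewrite gee0_abs//; apply: ge_ereal_sup => _ [t t0 <-].
  by rewrite lee_fin ler_pdivlMr// mulrC; exact: H2.
by rewrite gee0_abs ?lee_fin ?cmod_ge0// ler_pdivlMr// mulrC; exact: H1.
Qed.

End convolution_bounds.

(** * Wave packets *)

Lemma continuous_entry (R : realType) m n i j :
  continuous (fun M : 'M[R]_(m, n) => M i j : R).
Proof. by have := @coord_continuous R m n i j. Qed.

Lemma continuous_sum (R : realType) (T : topologicalType) (I : Type) (r : seq I)
    (F : I -> T -> R) :
  (forall i, continuous (F i)) -> continuous (fun x => \sum_(i <- r) F i x).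
Proof.
move=> cF; elim: r => [|i r IH].
  by under eq_fun do rewrite big_nil; exact: cst_continuous.
by under eq_fun do rewrite big_cons; move=> x; apply: cvgD; [exact: cF|exact: IH].
Qed.

Section gaussian_class.
Variables (R : realType) (n : nat).
Implicit Types (x y z b : (matrix R 1 n)).
Variables (c : R) (a : 'rV[R]_n).
Hypothesis c_gt0 : 0 < c.

(** The free phase makes the form stable: differentiating the cosine shifts it by pi / 2, and real
    and imaginary parts of a packet differ by the same shift. *)
Definition gcos (c0 : 'rV[R]_n) (phi : R) (x : 'rV[R]_n) : R :=
  expR (- (c * mxdot (x - c0) (x - c0))) * cos (mxdot x a + phi).

(* Closed under differentiation and translation, and made of Schwartz functions. *)
Inductive gclass : ('rV[R]_n -> R) -> Prop :=
| gclass_gcos (c0 : 'rV[R]_n) phi : gclass (gcos c0 phi)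
| gclass_coord j f : gclass f -> gclass (fun x => x 0 j * f x)
| gclass_add f g : gclass f -> gclass g -> gclass (fun x => f x + g x)
| gclass_scale k f : gclass f -> gclass (fun x => k * f x).

Lemma mxdot_deltal j z : mxdot (delta_mx 0 j) z = z 0 j :> R.
Proof.
rewrite /mxdot big_ord_recl big_ord0 addr0 (bigD1 j)//= big1.
  by rewrite mxE !eqxx mul1r addr0.
by move=> i ij; rewrite mxE (negbTE ij) andbF mul0r.
Qed.

Lemma gclass_translate b f : gclass f -> gclass (fun x => f (x + b)).
Proof.
elim=> [c0 phi|j g _ IH|g h _ IHg _ IHh|k g _ IH].
- rewrite (_ : (fun x => _) = gcos (c0 - b) (phi + mxdot b a)); first exact: gclass_gcos.
  by apply/funext => x; rewrite /gcos opprB addrA (mxdotDl x b a) -[X in cos X]addrA [mxdot b a + _]addrC.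
- rewrite (_ : (fun x => _) = (fun x => x 0 j * g (x + b) + b 0 j * g (x + b))).
    by apply: gclass_add; [exact: gclass_coord|exact: gclass_scale].
  by apply/funext => x; rewrite mxE mulrDl.
- exact: gclass_add.
- exact: gclass_scale.
Qed.

Lemma gclass_sdiff b f : gclass f -> gclass (sdiff b f).
Proof.
move=> gf; rewrite (_ : sdiff b f = (fun x => (2 * f x + (-1) * f (x + b)) + (-1) * f (x - b))).
  apply: gclass_add.
    by apply: gclass_add; apply: gclass_scale => //; exact: gclass_translate.
  by apply: gclass_scale; exact: gclass_translate.
by apply/funext => x; rewrite /sdiff !mulN1r mulr_natl.
Qed.

Lemma gclass_iter_sdiff b M f : gclass f -> gclass (iter M (sdiff b) f).
Proof. by move=> gf; elim: M => // M IH; rewrite iterS; exact: gclass_sdiff. Qed.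

Lemma continuous_mxdot (z : 'rV[R]_n) : continuous (fun x : 'rV[R]_n => mxdot x z : R).
Proof.
apply: continuous_sum => i; apply: continuous_sum => j x.
have h := @continuous_entry R 1 n i j x.
exact: (cvgM h (cvg_cst (z i j))).
Qed.

Lemma gclass_continuous f : gclass f -> continuous f.
Proof.
elim=> [c0 phi|j g _ IH|g h _ IHg _ IHh|k g _ IH] x.
- have cq : continuous (fun x : 'rV[R]_n => mxdot (x - c0) (x - c0) : R).
    apply: continuous_sum => i; apply: continuous_sum => j {}x.
    have h : continuous_at x (fun y : 'rV[R]_n => (y - c0) i j : R).
      have E : (fun y : 'rV[R]_n => (y - c0) i j) = (fun y => y i j - c0 i j).
        by apply/funext => y; rewrite !mxE.
      rewrite E; exact: (cvgB (@continuous_entry R 1 n i j x) (cvg_cst _)).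
    exact: (cvgM h h).
  have cN : continuous_at x (fun x : 'rV[R]_n => - (c * mxdot (x - c0) (x - c0))).
    exact: (cvgN (cvgM (cvg_cst c) (cq x))).
  have ce : continuous_at x (fun x : 'rV[R]_n => expR (- (c * mxdot (x - c0) (x - c0)))).
    exact: (continuous_comp cN (@continuous_expR R _)).
  have ct : continuous_at x (fun x : 'rV[R]_n => mxdot x a + phi : R).
    exact: (cvgD (@continuous_mxdot a x) (cvg_cst phi)).
  have cc : continuous_at x (fun x : 'rV[R]_n => cos (mxdot x a + phi)).
    exact: (continuous_comp ct (@continuous_cos R _)).
  exact: (cvgM ce cc).
- exact: (cvgM (@continuous_entry R 1 n 0 j x) (IH x)).
- exact: (cvgD (IHg x) (IHh x)).
- exact: (cvgM (cvg_cst k) (IH x)).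
Qed.

Lemma is_derive_line (f : 'rV[R]_n -> R) x v d :
  is_derive (0 : R) (1 : R) (fun s : R => f (s *: v + x)) d -> is_derive x v f d.
Proof.
move=> [df fE].
have E : (fun h : R => h^-1 *: ((fun s : R => f (s *: v + x)) (h *: (1 : R) + 0) - f (0 *: v + x))) =
         (fun h => h^-1 *: (f (h *: v + x) - f x)).
  apply/funext => h; congr (_ *: (f (_ *: _ + _) - f _)).
    by rewrite addr0 -[h *: (1 : R)]/(h * 1) mulr1.
  by rewrite scale0r add0r.
by apply: DeriveDef; move: df fE; rewrite /derivable /derive /= E.
Qed.

Lemma is_derive_gcos c0 phi x j : is_derive x (delta_mx 0 j) (gcos c0 phi)
  (- (2 * c) * (x 0 j * gcos c0 phi x) + 2 * c * c0 0 j * gcos c0 phi x +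
   (- a 0 j) * gcos c0 (phi - pi / 2) x).
Proof.
apply: is_derive_line; pose y := x - c0.
pose q (s : R) := - (c * (s ^+ 2 + 2 * s * y 0 j + mxdot y y)).
pose t (s : R) := s * a 0 j + (mxdot x a + phi).
have -> : (fun s : R => gcos c0 phi (s *: delta_mx 0 j + x)) =
    (fun s => expR (q s) * cos (t s)).
  apply/funext => s; rewrite /gcos /q /t -addrA -/y; congr (expR (- (c * _)) * cos _).
    rewrite mxdotDl mxdotZl mxdot_deltal !mxE eqxx eqxx /=.
    rewrite [mxdot y _]mxdotC mxdotDl mxdotZl mxdot_deltal !mxE; ring.
  by rewrite mxdotDl mxdotZl mxdot_deltal addrA.
have dq : is_derive (0 : R) (1 : R) q (- (2 * c) * y 0 j).
  rewrite /q; apply: is_derive_eq; rewrite /GRing.scale /= ?expr1 ?mulr0 ?addr0 ?add0r ?mul0r.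
  ring.
have dt : is_derive (0 : R) (1 : R) t (a 0 j).
  rewrite /t; apply: is_derive_eq; rewrite /GRing.scale /= ?mulr0 ?addr0 ?add0r ?mulr1//.
have d1 := @is_derive1_comp _ expR q 0 _ _ (is_derive_expR (q 0)) dq.
have d2 := @is_derive1_comp _ cos t 0 _ _ (is_derive_cos (t 0)) dt.
apply: (is_derive_eq (is_deriveM d1 d2)).
rewrite /GRing.scale /= /gcos addrA cosBpihalf.
have -> : q 0 = - (c * mxdot y y) by rewrite /q expr0n mulr0 mul0r !add0r.
have -> : t 0 = mxdot x a + phi by rewrite /t mul0r add0r.
rewrite -/y; have -> : y 0 j = x 0 j - c0 0 j by rewrite !mxE.
ring.
Qed.

Lemma gclass_derive f j : gclass f ->
  exists2 g, gclass g & forall x, is_derive x (delta_mx 0 j) f (g x).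
Proof.
elim=> [c0 phi|i g gg [g' gg' dg]|g h _ [g' gg' dg] _ [h' gh' dh]|k g _ [g' gg' dg]].
- eexists; last by move=> x; exact: is_derive_gcos.
  by repeat first [exact: gclass_gcos|apply: gclass_add|apply: gclass_scale|apply: gclass_coord].
- exists (fun x => x 0 i * g' x + (i == j)%:R * g x).
    by apply: gclass_add; [exact: gclass_coord|exact: gclass_scale].
  move=> x; have dc : is_derive x (delta_mx 0 j) (fun y : 'rV[R]_n => y 0 i) (i == j)%:R.
    apply: is_derive_line.
    have -> : (fun s : R => (s *: delta_mx 0 j + x) 0 i) = (fun s => s * (i == j)%:R + x 0 i).
      by apply/funext => s; rewrite !mxE eqxx.
    by apply: is_derive_eq; rewrite /GRing.scale /= ?mulr0 ?addr0 ?add0r ?mulr1//.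
  apply: (is_derive_eq (is_deriveM dc (dg x))).
  by rewrite /GRing.scale /= [g x * _]mulrC.
- by exists (fun x => g' x + h' x); [exact: gclass_add|move=> x; exact: is_deriveD].
- by exists (fun x => k * g' x); [exact: gclass_scale|move=> x; exact: is_deriveZ].
Qed.

(** A coordinate factor costs one power of the weight, so the induction treats all orders [k] at
    once. *)
Lemma gclass_decay f k : gclass f ->
  exists B, forall x, (1 + enorm x) ^+ k * `|f x| <= B.
Proof.
have p0 x i : 0 <= (1 + enorm x : R) ^+ i by rewrite exprn_ge0// addr_ge0// enorm_ge0.
move=> gf; elim: gf k => [c0 phi|j g _ IH|g h _ IHg _ IHh|l g _ IH] k.
- exists ((1 + enorm c0) ^+ k * (2 ^+ k * ((1 + expR c) * k`!%:R / c ^+ k))) => x.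
  have gE : expR (- (c * mxdot (x - c0) (x - c0))) = gau c (enorm (x - c0)).
    by rewrite /gau [enorm _ ^+ 2]sqr_sqrtr ?mxdot_ge0.
  apply: le_trans (_ : ((1 + enorm c0) * (1 + enorm (x - c0))) ^+ k * gau c (enorm (x - c0)) <= _).
    apply: ler_pM; rewrite ?p0//.
      rewrite lerXn2r ?nnegrE ?mulr_ge0 ?addr_ge0 ?enorm_ge0//.
      by apply: oneDenorm_shift; rewrite ?enorm_ge0// opprB addrCA subrr addr0.
    by rewrite /gcos gE normrM (ger0_norm (gau_ge0 _ _)) ler_piMr ?gau_ge0// cos_max.
  rewrite exprMn -[leLHS]mulrA ler_wpM2l ?p0//.
  apply: le_trans (_ : (2 * (1 + enorm (x - c0) ^+ 2)) ^+ k * gau c (enorm (x - c0)) <= _).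
    rewrite ler_wpM2r ?gau_ge0// lerXn2r ?nnegrE ?mulr_ge0 ?addr_ge0 ?sqr_ge0 ?enorm_ge0//.
    by have := enorm_ge0 (x - c0); move: (enorm _) => r; nra.
  by rewrite exprMn -[leLHS]mulrA ler_wpM2l ?exprn_ge0// gau_decay.
- have [B gB] := IH k.+1; exists B => x; apply: le_trans (gB x).
  rewrite normrM exprSr -[leRHS]mulrA ler_wpM2l ?p0// ler_wpM2r//.
  have : `|x 0 j| <= enorm x.
    rewrite -sqrtr_sqr ler_sqrt ?mxdot_ge0// -[mxdot x x]sqr_sqrtr ?mxdot_ge0//.
    exact: sqr_entry_le_enorm.
  by lra.
- have [B1 h1] := IHg k; have [B2 h2] := IHh k; exists (B1 + B2) => x.
  apply: le_trans (lerD (h1 x) (h2 x)); rewrite -mulrDr ler_wpM2l ?p0//.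
  exact: ler_normD.
- have [B gB] := IH k; exists (`|l| * B) => x.
  by rewrite normrM mulrCA ler_wpM2l.
Qed.

Lemma gclass_pderiv f l : gclass f -> exists2 g, gclass g & pderiv l f = g.
Proof.
move=> gf; elim: l => [|[i j] l [g gg E]]; first by exists f.
have [g' gg' dg] := gclass_derive j gg; exists g' => //.
rewrite /pderiv /= -/(pderiv l f) E (ord1 i); apply/funext => x.
by have [_ ->] := dg x.
Qed.

Lemma gclass_smooth f : gclass f -> smooth f.
Proof.
move=> gf l; have [g gg ->] := gclass_pderiv l gf; split; first exact: gclass_continuous.
move=> x i j; rewrite (ord1 i); have [g' _ dg] := gclass_derive j gg.
by have [] := dg x.
Qed.

Lemma gclass_schwartz (f : 'rV[R]_n -> R[i]) :
  gclass (fun x => complex.Re (f x)) -> gclass (fun x => complex.Im (f x)) -> schwartz f.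
Proof.
move=> g1 g2; split; first by split; exact: gclass_smooth.
move=> k l; have [h1 gh1 E1] := gclass_pderiv l g1; have [h2 gh2 E2] := gclass_pderiv l g2.
have [B1 b1] := gclass_decay k gh1; have [B2 b2] := gclass_decay k gh2.
exists (B1 + B2) => x; apply: le_trans (lerD (b1 x) (b2 x)).
rewrite -mulrDr ler_wpM2l ?exprn_ge0 ?addr_ge0 ?enorm_ge0//.
by rewrite /cpderiv E1 E2; exact: ler_cmod_ReIm.
Qed.

End gaussian_class.

Section packet.
Variables (R : realType) (n : nat).
Local Notation mu := (lebesgue_mx R 1 n).
Implicit Types (x y b a xi : 'rV[R]_n).

Lemma prod_expi (I : Type) (r : seq I) (th : I -> R) :
  \prod_(i <- r) expi (th i) = expi (\sum_(i <- r) th i).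
Proof.
elim: r => [|i r IH]; first by rewrite !big_nil expi0.
by rewrite !big_cons IH expiD.
Qed.

Lemma Complex0M (s t : R) : Complex s 0 * Complex t 0 = Complex (s * t) 0.
Proof. by apply/eqP; rewrite eq_complex ReM ImM /= !mulr0 mul0r subr0 addr0 !eqxx. Qed.

Lemma prod_Complex0 (I : Type) (r : seq I) (s : I -> R) :
  \prod_(i <- r) Complex (s i) 0 = Complex (\prod_(i <- r) s i) 0.
Proof.
elim: r => [|i r IH]; first by rewrite !big_nil.
by rewrite !big_cons IH Complex0M.
Qed.

(** A Gaussian of height 1, width [w] and frequency [a], written as a product over entries so that
    [cint_mx_prod] gives its transform; [packetE] is the closed form. *)
Definition packet (w : R) a x : R[i] :=
  \prod_i \prod_j (Complex (gau (pi / w ^+ 2) (x i j)) 0 * expi (2 * pi * a i j * x i j)).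

Lemma packetE w a x : packet w a x =
  Complex (expR (- (pi / w ^+ 2 * mxdot x x))) 0 * expi (mxdot x ((2 * pi) *: a)).
Proof.
rewrite /packet; under eq_bigr do rewrite big_split /= prod_expi prod_Complex0.
rewrite big_split /= prod_expi prod_Complex0; congr (Complex _ 0 * expi _).
  rewrite /mxdot mulr_sumr -sumrN expR_sum; apply: eq_bigr => i _.
  rewrite mulr_sumr -sumrN expR_sum; apply: eq_bigr => j _.
  by rewrite /gau expr2.
apply: eq_bigr => i _; apply: eq_bigr => j _; rewrite mxE; ring.
Qed.

Lemma packet_gclass w a :
  gclass (pi / w ^+ 2) ((2 * pi) *: a) (fun x => complex.Re (packet w a x)) /\
  gclass (pi / w ^+ 2) ((2 * pi) *: a) (fun x => complex.Im (packet w a x)).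
Proof.
split.
  rewrite (_ : (fun x => _) = gcos (pi / w ^+ 2) ((2 * pi) *: a) 0 0).
    exact: gclass_gcos.
  by apply/funext => x; rewrite packetE ReM /= mul0r subr0 /gcos subr0 addr0.
rewrite (_ : (fun x => _) = gcos (pi / w ^+ 2) ((2 * pi) *: a) 0 (- (pi / 2))).
  exact: gclass_gcos.
by apply/funext => x; rewrite packetE ImM /= mul0r addr0 /gcos subr0 cosBpihalf.
Qed.

Lemma packet_schwartz w a b M : 0 < w -> schwartz (iter M (sdiff b) (packet w a)).
Proof.
move=> w0; have c0 : 0 < pi / w ^+ 2 :> R by rewrite divr_gt0 ?pi_gt0 ?exprn_gt0.
have [g1 g2] := packet_gclass w a.
apply: (gclass_schwartz (a := (2 * pi) *: a) c0).
  by under eq_fun do rewrite Re_iter_sdiff; exact: gclass_iter_sdiff.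
by under eq_fun do rewrite Im_iter_sdiff; exact: gclass_iter_sdiff.
Qed.

(** Uniform in [w] and [a], because the modulus is a fixed Gaussian of |x| / w. *)
Lemma packet_decay k : exists2 A : R, 0 <= A & forall w a x, 0 < w ->
  (1 + enorm x / w) ^+ k * cmod (packet w a x) <= A.
Proof.
exists (2 ^+ k * ((1 + expR pi) * k`!%:R / pi ^+ k)).
  by rewrite mulr_ge0 ?exprn_ge0// !mulr_ge0 ?addr_ge0 ?expR_ge0 ?invr_ge0 ?exprn_ge0 ?pi_ge0.
move=> w a x w0; rewrite packetE cmod_realM cmod_expi mulr1 (ger0_norm (expR_ge0 _)).
have -> : expR (- (pi / w ^+ 2 * mxdot x x)) = gau pi (enorm x / w).
  rewrite /gau; congr (expR (- _)); rewrite exprMn [enorm x ^+ 2]sqr_sqrtr ?mxdot_ge0// exprVn.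
  by rewrite mulrAC mulrA.
have r0 : 0 <= enorm x / w by rewrite divr_ge0 ?enorm_ge0// ltW.
apply: le_trans (_ : (2 * (1 + (enorm x / w) ^+ 2)) ^+ k * gau pi (enorm x / w) <= _).
  rewrite ler_wpM2r ?gau_ge0// lerXn2r ?nnegrE ?mulr_ge0 ?addr_ge0 ?sqr_ge0//.
  by move: r0; move: (enorm x / w) => r; nra.
by rewrite exprMn -[leLHS]mulrA ler_wpM2l ?exprn_ge0// gau_decay// pi_gt0.
Qed.

Lemma fourier_packet w a xi : 0 < w -> fourier (packet w a) xi =
  Complex (w ^+ n * expR (- (pi * w ^+ 2 * mxdot (xi - a) (xi - a)))) 0.
Proof.
move=> w0; have c0 : 0 < pi / w ^+ 2 :> R by rewrite divr_gt0 ?pi_gt0 ?exprn_gt0.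
pose F (i : 'I_1) (j : 'I_n) (x : R) :=
  Complex (gau (pi / w ^+ 2) x) 0 * expi (2 * pi * (a i j - xi i j) * x).
have gi : (@lebesgue_measure R).-integrable setT (EFin \o gau (pi / w ^+ 2)).
  have := @integrable_gauM _ (pi / w ^+ 2) (fun=> 1) 1 c0 (measurable_cst _) _.
  under eq_fun do rewrite mul1r; apply => x.
  by rewrite normr1 mul1r lerDl sqr_ge0.
have ge (x : R) : gau (pi / w ^+ 2) (- x) = gau (pi / w ^+ 2) x by rewrite /gau sqrrN.
have HF (i : 'I_1) (j : 'I_n) := cint_even_expi (2 * pi * (a i j - xi i j)) gi ge.
have [_ E] := cint_mx_prod (fun i j => (HF i j).1).
rewrite /fourier cintegralE.
have -> : (fun x => packet w a x * expi (- (2 * pi * mxdot x xi))) =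
   (fun x => \prod_i \prod_j F i j (x i j)).
  apply/funext => x; rewrite packetE -mulrA -expiD.
  rewrite /F; under [RHS]eq_bigr do rewrite big_split /= prod_expi prod_Complex0.
  rewrite big_split /= prod_expi prod_Complex0; congr (Complex _ 0 * expi _).
    rewrite /mxdot mulr_sumr -sumrN expR_sum; apply: eq_bigr => i _.
    rewrite mulr_sumr -sumrN expR_sum; apply: eq_bigr => j _.
    by rewrite /gau expr2.
  rewrite /mxdot mulr_sumr -sumrB; apply: eq_bigr => i _.
  rewrite mulr_sumr -sumrB; apply: eq_bigr => j _; rewrite mxE.
  by move: (pi : R) => P; ring.
rewrite E; under eq_bigr => i _ do under eq_bigr => j _ do rewrite (HF i j).2 -/(gau_cos _ _) gau_cosE//.
under eq_bigr do rewrite prod_Complex0; rewrite prod_Complex0; congr (Complex _ 0).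
under eq_bigr do rewrite big_split /= prodr_const card_ord.
rewrite big_split /= prodr_const card_ord expr1; congr (_ * _).
rewrite /mxdot mulr_sumr -sumrN expR_sum; apply: eq_bigr => i _.
rewrite mulr_sumr -sumrN expR_sum; apply: eq_bigr => j _; rewrite !mxE.
congr (expR (- _)).
have A (P : R) : 0 < P -> w ^+ 2 * (2 * P * (a i j - xi i j)) ^+ 2 / (4 * P) =
    P * w ^+ 2 * ((xi i j - a i j) * (xi i j - a i j)).
  by move=> P0; field; rewrite gt_eqF.
exact: A (@pi_gt0 R).
Qed.

(** Translations become phases, and 2 - 2 cos(2 theta) = 4 sin(theta)^2. *)
Lemma fourier_sdiff b f xi : cintegrable mu f ->
  cintegrable mu (sdiff b f) /\
  fourier (sdiff b f) xi = Complex (4 * sin (pi * mxdot b xi) ^+ 2) 0 * fourier f xi.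
Proof.
move=> fi.
pose ph (x : 'rV[R]_n) := expi (- (2 * pi * mxdot x xi)).
have mf := cintegrable_cmfun fi.
have fpi : cintegrable mu (fun x => f x * ph x).
  by apply: cintegrable_phase => //; exact: measurable_phase.
have mfp := cintegrable_cmfun fpi.
have tr c : cintegrable mu (fun x => f (x + c)).
  exact: (cintegrable_preserving (measurable_addr c) (@lebesgue_mxD _ _ _ c) mf).2.
have tp c : cintegrable mu (fun x => f (x + c) * ph x).
  by apply: cintegrable_phase => //; exact: measurable_phase.
have trE c : cint mu (fun x => f (x + c) * ph x) =
    expi (2 * pi * mxdot c xi) * cint mu (fun x => f x * ph x).
  rewrite -(cint_preserving (measurable_addr c) (@lebesgue_mxD _ _ _ c) mfp) -cintZ; last first.
    exact: (cintegrable_preserving (measurable_addr c) (@lebesgue_mxD _ _ _ c) mfp).2.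
  apply: eq_cint => x; rewrite mulrCA; congr (_ * _).
  rewrite /ph -expiD; congr expi; rewrite mxdotDl.
  by move: (pi : R) => P; ring.
split.
  exact: (cint_sdiff_lin fi (tr b) (tr (- b))).1.
rewrite /fourier !cintegralE.
have -> : (fun x => sdiff b f x * expi (- (2 * pi * mxdot x xi))) =
    (fun x => (f x * ph x) *+ 2 - f (x + b) * ph x - f (x - b) * ph x).
  by apply/funext => x; rewrite -/(ph x) /sdiff !mulrBl (mulrnAl (f x)).
rewrite (cint_sdiff_lin fpi (tp b) (tp (- b))).2 !trE.
rewrite -(mulr_natl (cint mu _)) -!mulrBl; congr (_ * _).
have -> : 2 * pi * mxdot (- b) xi = - (2 * pi * mxdot b xi).
  by rewrite -scaleN1r mxdotZl; move: (pi : R) => P; ring.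
have C2 : cos (2 * pi * mxdot b xi) = 1 - 2 * sin (pi * mxdot b xi) ^+ 2.
  have -> : 2 * pi * mxdot b xi = (pi * mxdot b xi) *+ 2.
    by rewrite -mulrA mulr_natl.
  by rewrite cos_mulr2n cos2sin2; ring.
have E2 : 2 = Complex 2 0 :> R[i] by apply/eqP; rewrite eq_complex /= addr0 !eqxx.
rewrite E2 /expi cosN sinN C2; apply/eqP; rewrite eq_complex /=.
by apply/andP; split; apply/eqP; ring.
Qed.

Lemma fourier_iter_sdiff b M f xi : cintegrable mu f ->
  cintegrable mu (iter M (sdiff b) f) /\
  fourier (iter M (sdiff b) f) xi =
    Complex ((4 * sin (pi * mxdot b xi) ^+ 2) ^+ M) 0 * fourier f xi.
Proof.
move=> fi; elim: M => [|M [IH1 IH2]]; first by split=> //; rewrite expr0 -[Complex 1 0]/(1 : R[i]) mul1r.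
rewrite iterS; have [h1 h2] := fourier_sdiff b xi IH1; split => //.
by rewrite h2 IH2 mulrA Complex0M -exprS.
Qed.

End packet.

(** * The symbol and its Sobolev norm *)

Section bumphat_measurable.
Variable R : realType.
Local Notation leb := (@lebesgue_measure R).

(** Tonelli gives measurability in the parameter for nonnegative integrands: the cosine is raised by
    1 and the resulting constant subtracted. *)
Lemma measurable_bumphat r K : 0 < r -> measurable_fun setT (@bumphat R r K).
Proof.
move=> r0.
pose f (z : measurableTypeR R * measurableTypeR R) : \bar R :=
  ((cos (z.1 * z.2) + 1) * bump r K z.2)%:E.
have mf : measurable_fun setT f.
  apply/measurable_EFinP; apply: measurable_funM; last first.
    exact: (measurableT_comp (measurable_bump r K)).
  apply: measurable_funD => //.
  apply: measurableT_comp; first exact: continuous_measurable_fun (@continuous_cos R).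
  exact: measurable_funM.
have f0 z : (0 <= f z)%E.
  by rewrite lee_fin mulr_ge0 ?bump_ge0// -lerBlDr sub0r cos_geN1.
have mF : measurable_fun setT (fun w => fine (\int[leb]_x f (w, x))).
  have h := measurable_fun_fubini_tonelli_F (m2 := leb) f mf f0.
  exact: (measurableT_comp (fine_measurable measurableT) h).
rewrite (_ : bumphat r K = fun w => fine (\int[leb]_x f (w, x)) - \int[leb]_x bump r K x).
  exact: measurable_funB.
apply/funext => w; rewrite /bumphat.
have i1 : leb.-integrable setT (EFin \o (fun x => cos (w * x) * bump r K x)).
  have [[i _] _] := cint_even_expi w (integrable_bump K r0) (@bump_even _ r K).
  apply: eq_integrable i => // x _ /=.
  by rewrite mul0r subr0 mulrC.
have i2 := integrable_bump K r0.
apply/eqP; rewrite eq_sym subr_eq; apply/eqP; rewrite -RintegralD//.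
by apply: eq_Rintegral => x _; rewrite /= mulrDl mul1r.
Qed.

End bumphat_measurable.

(** * The shear of the symbol and its dual *)

Section shear_mask.
Variables (R : realType) (m n : nat) (i0 : 'I_m) (J : {set 'I_m}).
Hypothesis i0J : i0 \notin J.
Local Notation mu := (lebesgue_mx R m n).

(** Identity plus this matrix turns row [i0] into the sum of the rows in [i0 |: J], the argument of
    the narrow bump. *)
Definition row_shear : 'M[R]_m := \matrix_(k, i) ((k == i0) && (i \in J))%:R.

Lemma row_shearE (M : 'M[R]_(m, n)) k j :
  (row_shear *m M) k j = if k == i0 then \sum_(i in J) M i j else 0.
Proof.
rewrite mxE; under eq_bigr do rewrite mxE.
case: eqP => _ /=; last by under eq_bigr do rewrite mul0r; rewrite big1.
rewrite [RHS]big_mkcond; apply: eq_bigr => i _.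
by case: ifP; rewrite ?mul1r ?mul0r.
Qed.

Lemma row_shearTE (M : 'M[R]_(m, n)) k j :
  (row_shear^T *m M) k j = if k \in J then M i0 j else 0.
Proof.
rewrite mxE (bigD1 i0)//= big1 ?addr0 => [|i ii]; rewrite !mxE ?eqxx /=.
  by case: ifP; rewrite ?mul1r ?mul0r.
by rewrite (negbTE ii) mul0r.
Qed.

Lemma row_shear_sqr0 : row_shear *m row_shear = 0.
Proof.
apply/matrixP => k l; rewrite !mxE big1// => i _; rewrite !mxE.
by case: (i =P i0) => [->|_]; rewrite ?(negbTE i0J) ?andbF ?mul0r ?mulr0.
Qed.

Lemma mxdot_mull (U : 'M[R]_m) (M N : 'M[R]_(m, n)) :
  mxdot (U *m M) N = mxdot M (U^T *m N).
Proof.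
rewrite /mxdot exchange_big [RHS]exchange_big /=; apply: eq_bigr => j _.
under eq_bigr do rewrite mxE mulr_suml.
rewrite exchange_big /=; apply: eq_bigr => i _.
by rewrite mxE mulr_sumr; apply: eq_bigr => k _; rewrite mxE; ring.
Qed.

Let D : 'M[R]_m := \matrix_(k, l) ((k == l) && (k == i0))%:R.
Let D' : 'M[R]_m := \matrix_(k, l) ((k == l) && (k \in J))%:R.

Lemma lebesgue_row_shear A : measurable A ->
  mu ((fun M => M + row_shear *m M) @^-1` A) = mu A.
Proof.
apply: (@lebesgue_mx_shear _ _ _ _ D).
  apply/matrixP => k l; rewrite !mxE (bigD1 k)//= big1 ?addr0 => [|i ik]; rewrite !mxE ?eqxx/=.
    by case: eqP => _; rewrite ?mul1r ?mul0r.
  by rewrite eq_sym (negbTE ik) mul0r.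
apply/matrixP => k l; rewrite !mxE big1// => i _; rewrite !mxE.
case: (i =P i0) => [->|_]; rewrite ?(negbTE i0J) ?andbF ?mul0r ?mulr0//.
Qed.

(** The change of variables on the Fourier side: as [row_shear] has square zero, the inverse
    transpose of 1 + U is 1 - U^T. Here the changed rows are those of [J]. *)
Lemma lebesgue_row_shearTN A : measurable A ->
  mu ((fun M => M + - row_shear^T *m M) @^-1` A) = mu A.
Proof.
apply: (@lebesgue_mx_shear _ _ _ _ D').
  apply/matrixP => k l; rewrite !mxE (bigD1 k)//= big1 ?addr0 => [|i ik]; rewrite !mxE ?eqxx/=.
    by case: (k \in J); rewrite ?mul1r ?mul0r ?andbF ?andbT ?oppr0.
  by rewrite eq_sym (negbTE ik) mul0r.
apply/matrixP => k l; rewrite !mxE big1// => i _; rewrite !mxE.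
by case: (i =P i0) => [->|_]; rewrite ?(negbTE i0J) ?andbF ?mul0r ?mulr0// oppr0 mul0r.
Qed.

End shear_mask.

Section prodr_ge1.
Variable R : numDomainType.

Lemma prodr_ge1 (I : Type) (r : seq I) (P : pred I) (F : I -> R) :
  (forall i, P i -> 1 <= F i) -> 1 <= \prod_(i <- r | P i) F i.
Proof.
move=> F1; elim/big_ind : _ => // x y x1 y1.
by rewrite -[leLHS]mulr1 ler_pM.
Qed.

Lemma ler_prodr_ge1 (I : finType) (F : I -> R) i :
  (forall i, 1 <= F i) -> F i <= \prod_i F i.
Proof.
move=> F1; rewrite (bigD1 i)//= ler_peMr ?prodr_ge1//.
exact: le_trans (F1 i).
Qed.

End prodr_ge1.

Lemma japan_le (R : realType) n (x : 'rV[R]_n) : japan x <= 1 + enorm x.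
Proof.
rewrite /japan -[leRHS]ger0_norm ?addr_ge0 ?enorm_ge0// -sqrtr_sqr.
by apply: ler_wsqrtr; move: (enorm_ge0 x); nra.
Qed.

Lemma prod_powR (R : realType) (I : Type) (r : seq I) (P : pred I) (x : R) (s : I -> R) : 0 < x ->
  \prod_(i <- r | P i) x `^ s i = x `^ (\sum_(i <- r | P i) s i).
Proof.
move=> x0; elim: r => [|i r IH]; first by rewrite !big_nil powRr0.
by rewrite !big_cons; case: ifP => // _; rewrite powRD ?IH// (gt_eqF x0) implybT.
Qed.

Lemma cintegrable_square_integrable (R : realType) m n (f : 'M[R]_(m, n) -> R[i]) :
  cintegrable (lebesgue_mx R m n) f -> (forall x, cmod (f x) <= 1) -> square_integrable f.
Proof.
move=> fi f1; split; first exact: cintegrable_cmfun fi.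
have i1 := cintegrable_cmod fi.
have fin : (\int[lebesgue_mx R m n]_x (cmod (f x))%:E)%E \is a fin_num.
  exact: integrable_fin_num.
apply: le_lt_trans (Lnorm_le (G := fun x => cmod (f x))
  (V := fine (\int[lebesgue_mx R m n]_x (cmod (f x))%:E)%E) _ _ _) (ltry _) => //.
  by move=> x; rewrite /= ger0_norm ?cmod_ge0.
rewrite fineK//; apply: ge0_integral_mono => x; rewrite lee_fin ?powR_ge0//.
by rewrite powR_mulrn ?cmod_ge0// expr2 ler_piMl ?cmod_ge0.
Qed.

Section symbol.
Variables (R : realType) (m n : nat) (i0 : 'I_m) (J : {set 'I_m}).
Hypothesis i0J : i0 \notin J.
Local Notation mu := (lebesgue_mx R m n).
Local Notation leb := (@lebesgue_measure R).
Local Notation U := (row_shear R i0 J).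
Variables (K : nat) (dlt : R).
Hypothesis dlt0 : 0 < dlt.
Implicit Types (t : 'I_m -> R) (A xi y M : 'M[R]_(m, n)).

Definition shear A xi : 'M[R]_(m, n) := (xi - A) + U *m (xi - A).

Lemma measurable_shear A : measurable_fun setT (shear A).
Proof.
have h : measurable_fun setT (fun xi : 'M[R]_(m, n) => xi - A) by exact: measurable_addmx.
by apply: measurable_addmx => //; exact: measurable_mulmx.
Qed.

Lemma lebesgue_shear A B : measurable B -> mu (shear A @^-1` B) = mu B.
Proof.
move=> mB; rewrite -(lebesgue_row_shear i0J mB).
rewrite -[RHS](lebesgue_mxD (- A))//.
rewrite -[X in measurable X]setTI; apply: (_ : measurable_fun setT _) => //.
by apply: measurable_addmx => //; exact: measurable_mulmx.
Qed.

Definition symbol t A xi : R[i] :=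
  Complex (\prod_i \prod_j bump (dlt / t i) K (shear A xi i j)) 0.

(** The transform of the symbol up to a unimodular phase; [y - U^T *m y] is the variable dual to the
    sheared one, see [mxdot_shear]. *)
Definition symbol_hat t y : R :=
  \prod_i \prod_j bumphat (dlt / t i) K (- (2 * pi * (y - U^T *m y) i j)).

Lemma mxdot_shear A xi y :
  mxdot (shear A xi) (y - U^T *m y) = mxdot xi y - mxdot A y.
Proof.
have NE (M : 'M[R]_(m, n)) N : mxdot M (- N) = - mxdot M N.
  by rewrite mxdotC -scaleN1r mxdotZl mulN1r mxdotC.
have DE (M N : 'M[R]_(m, n)) P : mxdot M (N + P) = mxdot M N + mxdot M P.
  by rewrite mxdotC mxdotDl; congr (_ + _); rewrite mxdotC.
rewrite /shear mxdotDl !DE !NE -mxdot_mull -mxdot_mull mulmxA row_shear_sqr0//.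
rewrite mul0mx mxdotDl (mxdotC (- A)) NE (mxdotC y A).
have -> : mxdot (0 : 'M[R]_(m, n)) y = 0 by rewrite -(scale0r 0) mxdotZl mul0r.
by ring.
Qed.

Lemma fourier_symbol t A : (forall i, 0 < t i) ->
  cintegrable mu (symbol t A) /\
  forall y, fourier (symbol t A) y =
    expi (- (2 * pi * mxdot A y)) * Complex (symbol_hat t y) 0.
Proof.
move=> t0.
have r0 i : 0 < dlt / t i by rewrite divr_gt0.
pose F y i j (x : R) := Complex (bump (dlt / t i) K x) 0 *
   expi (- (2 * pi * (y - U^T *m y) i j) * x).
pose H y i j := cint_even_expi (- (2 * pi * (y - U^T *m y) i j))
    (integrable_bump K (r0 i)) (@bump_even _ _ K).
have HM y := cint_mx_prod (fun i j => (H y i j).1).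
pose G y (M : 'M[R]_(m, n)) := \prod_i \prod_j F y i j (M i j).
have mG y : cmfun (G y) by exact: cintegrable_cmfun (HM y).1.
have E y xi : symbol t A xi * expi (- (2 * pi * mxdot xi y)) =
    expi (- (2 * pi * mxdot A y)) * G y (shear A xi).
  rewrite /G /F; under [X in _ = _ * X]eq_bigr do rewrite big_split /= prod_expi prod_Complex0.
  rewrite big_split /= prod_expi prod_Complex0 mulrCA -expiD; congr (_ * expi _).
  have -> : mxdot xi y = mxdot (shear A xi) (y - U^T *m y) + mxdot A y.
    by rewrite mxdot_shear subrK.
  rewrite mulrDr opprD addrC; congr (_ + _).
  rewrite {1}/mxdot mulr_sumr -sumrN; apply: eq_bigr => i _.
  rewrite mulr_sumr -sumrN; apply: eq_bigr => j _.
  by move: (pi : R) => P; ring.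
have iG y : cintegrable mu (fun xi => G y (shear A xi)).
  exact: (cintegrable_preserving (measurable_shear A) (@lebesgue_shear A) (mG y)).2 (HM y).1.
split.
  (* At y = 0 all phases are trivial, so the integrability of the symbol itself is a special
     case. *)
  suff -> : symbol t A = fun xi => G 0 (shear A xi) by exact: iG.
  apply/funext => xi; have := E 0 xi.
  have z (M : 'M[R]_(m, n)) : mxdot M 0 = 0 by rewrite mxdotC -(scale0r 0) mxdotZl mul0r.
  by rewrite !z !mulr0 oppr0 expi0 mulr1 mul1r.
move=> y; rewrite /fourier cintegralE (eq_cint _ (E y)) cintZ//; congr (_ * _).
rewrite (cint_preserving (measurable_shear A) (@lebesgue_shear A) (mG y)) (HM y).2.
under eq_bigr => i _ do under eq_bigr => j _ do rewrite (H y i j).2.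
by under eq_bigr do rewrite prod_Complex0; rewrite prod_Complex0.
Qed.

Definition rowwise t : 'M[R]_(m, n) := \matrix_(i, j) t i.

Local Notation Q t y := (cauchy_prod (rowwise t) 0 (y - U^T *m y)).

Lemma symbol_hat_le : exists2 C, 0 <= C & forall t y, (forall i, 0 < t i) ->
  `|symbol_hat t y| <= C * (\prod_(i < m) \prod_(j < n) t i)^-1 * Q t y ^+ K.
Proof.
have [C0 C00 HC] := @bumphat_decay R K.
(* With this k, k (1 + x^2) <= 1 + (2 pi dlt x)^2: the fixed width [dlt] is absorbed into the
   constant, leaving only the widths [t]. *)
pose k := Num.min 1 ((2 * pi * dlt) ^+ 2) : R.
have pd : 0 < 2 * pi * dlt :> R by rewrite !mulr_gt0 ?pi_gt0.
have k0 : 0 < k by rewrite lt_min ltr01 exprn_gt0.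
have k1 : k <= 1 by rewrite ge_min lexx.
have k2 : k <= (2 * pi * dlt) ^+ 2 by rewrite ge_min lexx orbT.
move: (k) k0 k1 k2 => {}k k0 k1 k2.
pose C1 := C0 * dlt / k ^+ K.
have C10 : 0 <= C1 by rewrite divr_ge0 ?mulr_ge0 ?exprn_ge0// ltW.
exists (C1 ^+ (n * m)) => [|t y t0]; first exact: exprn_ge0.
have step (T z : R) : 0 < T -> `|bumphat (dlt / T) K (- (2 * pi * z))| <=
    C1 * T^-1 * ((1 + ((z - 0) / T) ^+ 2)^-1) ^+ K.
  move=> T0; rewrite subr0; have r0 : 0 < dlt / T by rewrite divr_gt0.
  have := HC _ (- (2 * pi * z)) r0; set b := `|_|.
  have b0 : 0 <= b by exact: normr_ge0.
  have -> : dlt / T * - (2 * pi * z) = - (2 * pi * dlt) * (z / T).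
    by move: (pi : R) => P; field; rewrite gt_eqF.
  move: pd b0 k2; rewrite /C1; move: (2 * pi * dlt) (z / T) => D x D0 b0 k2 H.
  have p1 : 0 < 1 + x ^+ 2 by rewrite ltr_wpDr ?sqr_ge0.
  have A : (k * (1 + x ^+ 2)) ^+ K <= (1 + (- D * x) ^+ 2) ^+ K.
    rewrite lerXn2r ?nnegrE ?mulr_ge0 ?addr_ge0 ?sqr_ge0 ?(ltW k0)//.
    by rewrite mulrDr mulr1 mulNr sqrrN exprMn lerD// ler_wpM2r ?sqr_ge0.
  have B := le_trans (ler_wpM2l b0 A) H.
  rewrite exprVn -ler_pdivrMr ?invr_gt0 ?exprn_gt0// invrK -(ler_pM2r (exprn_gt0 K k0)).
  apply: le_trans (le_trans _ B) _; first by rewrite exprMn -mulrA [X in b * X]mulrC.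
  by rewrite le_eqVlt; apply/orP; left; apply/eqP; field; rewrite !gt_eqF ?exprn_gt0.
rewrite /symbol_hat normr_prod.
apply: le_trans (_ : \prod_(i < m) \prod_(j < n) (C1 * (t i)^-1 *
   ((1 + (((y - U^T *m y) i j - 0) / t i) ^+ 2)^-1) ^+ K) <= _).
  apply: ler_prod => i _; rewrite normr_ge0 normr_prod /=.
  by apply: ler_prod => j _; rewrite normr_ge0 /=; exact: step.
rewrite /cauchy_prod -prodrXl -prodfV.
rewrite -[X in C1 ^+ (n * X)](card_ord m) exprM -prodr_const -!big_split /=.
rewrite le_eqVlt; apply/orP; left; apply/eqP; apply: eq_bigr => i _.
rewrite -prodrXl -prodfV -[X in C1 ^+ X](card_ord n) -prodr_const -!big_split /=.
by apply: eq_bigr => j _; rewrite !mxE.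
Qed.

Lemma entry_le_cauchy_prod t M i j : (forall i, 0 < t i) ->
  1 + (M i j / t i) ^+ 2 <= (cauchy_prod (rowwise t) 0 M)^-1.
Proof.
move=> t0; rewrite /cauchy_prod -prodfV.
under eq_bigr do rewrite -prodfV.
have ge1 k l : 1 <= ((1 + ((M k l - (0 : 'M[R]_(m, n)) k l) / rowwise t k l) ^+ 2)^-1)^-1.
  by rewrite invrK lerDl sqr_ge0.
apply: le_trans (ler_prodr_ge1 i _) => [|k]; last exact: prodr_ge1.
apply: le_trans (ler_prodr_ge1 j (ge1 i)).
by rewrite invrK !mxE subr0.
Qed.

Lemma invr_cauchy_prod_ge1 (t c M : 'M[R]_(m, n)) : 1 <= (cauchy_prod t c M)^-1.
Proof.
rewrite /cauchy_prod -prodfV; apply: prodr_ge1 => i _.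
rewrite -prodfV; apply: prodr_ge1 => j _.
by rewrite invrK lerDl sqr_ge0.
Qed.

Lemma oneDenorm_row_le t M i : (forall i, 0 < t i) ->
  1 + enorm (row i M) <= n.+1%:R * Num.max 1 (t i) * (cauchy_prod (rowwise t) 0 M)^-1.
Proof.
move=> t0; set q := (cauchy_prod _ _ _)^-1.
have q1 : 1 <= q by exact: invr_cauchy_prod_ge1.
have H j : `|M i j| <= Num.max 1 (t i) * q.
  have h : 1 + (M i j / t i) ^+ 2 <= q by exact: entry_le_cauchy_prod.
  have e : M i j = t i * (M i j / t i) by rewrite mulrC mulfVK// gt_eqF.
  rewrite e normrM (gtr0_norm (t0 i)); apply: ler_pM; rewrite ?(ltW (t0 i))//.
    by rewrite le_max lexx orbT.
  apply: le_trans h; rewrite -[_ ^+ 2]real_normK ?num_real//.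
  by move: (normr_ge0 (M i j / t i)); nra.
have T1 : 1 <= Num.max 1 (t i) * q.
  by rewrite -[leLHS]mulr1 ler_pM// ?le_max ?lexx//.
rewrite -mulrA mulrSr mulrDl mul1r addrC lerD//.
apply: le_trans (enorm_le_sum _) _; rewrite big_ord_recl big_ord0 addr0.
apply: le_trans (ler_sum _ (fun j _ => _ : _ <= Num.max 1 (t i) * q)) _.
  by move=> j _; rewrite mxE; exact: H.
by rewrite sumr_const card_ord mulr_natl.
Qed.

Local Notation S := (i0 |: J).

(** In the dual coordinates y' = y - U^T y, row i of y with i in [J] is y'_i + y'_i0. So every row
    in [S] may have the size [t i0] of the long block, which is where the sum of the [s_i] over [S]
    arises. The growth beyond these sizes is left to powers of 1 / Q. *)
Lemma weight_le (s : 'I_m -> R) (N : nat) :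
  (forall i, 0 < s i) -> \sum_i s i <= N%:R ->
  exists2 C, 0 <= C & forall t y, (forall i, 0 < t i) ->
    (forall i, i != i0 -> t i <= 1) -> 1 <= t i0 ->
    \prod_i japan (row i y) `^ s i <=
      C * t i0 `^ (\sum_(i in S) s i) * (Q t y)^-1 ^+ (2 * N).
Proof.
move=> s0 sN; pose c : R := n.+1%:R ^+ 2.
have c1 : 1 <= c by rewrite exprn_ege1// ler1n.
exists (c `^ (\sum_i s i)) => [|t y t0 t1 ti0]; first exact: powR_ge0.
set q := (Q t y)^-1.
have q1 : 1 <= q by exact: invr_cauchy_prod_ge1.
pose T i := if i \in S then t i0 else 1.
have T1 i : 1 <= T i by rewrite /T; case: ifP.
pose y' := y - U^T *m y.
have P i : 1 + enorm (row i y') <= n.+1%:R * Num.max 1 (t i) * q by exact: oneDenorm_row_le.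
have P0 : 1 + enorm (row i0 y') <= n.+1%:R * t i0 * q.
  by have := P i0; rewrite max_r.
have P1 i : i != i0 -> 1 + enorm (row i y') <= n.+1%:R * q.
  by move=> ii; have := P i; rewrite max_l ?mulr1// t1.
have n1 : 1 <= n.+1%:R :> R by rewrite ler1n.
have nc : n.+1%:R <= c by rewrite /c expr2 ler_peMl.
have q0' : 0 <= q by exact: le_trans q1.
have qq : q <= q ^+ 2 by rewrite expr2 ler_peMl.
(* Rows in [J] are bounded by a product of two row bounds, hence the squares in [c] and in the power
   of q. *)
have jle i : japan (row i y) <= c * T i * q ^+ 2.
  apply: le_trans (japan_le _) _.
  have yE k j : y' k j = y k j - if k \in J then y i0 j else 0.
    by rewrite mxE [X in _ + X]mxE row_shearTE.
  clearbody y'.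
  have rE : row i y = row i y' + if i \in J then row i0 y' else 0.
    apply/matrixP => k j; rewrite !ord1 !mxE; case: ifP => iJ; rewrite !mxE yE iJ ?subr0 ?addr0//.
    by rewrite yE (negbTE i0J) subr0 subrK.
  rewrite rE /T !inE.
  have [->|ii] := eqVneq i i0 => /=.
    rewrite (negbTE i0J) addr0; apply: le_trans P0 _.
    by rewrite ler_pM ?mulr_ge0 ?(ltW (t0 _))// ler_wpM2r ?(ltW (t0 _)).
  case: ifP => iJ; last first.
    rewrite addr0 mulr1; apply: le_trans (P1 _ ii) _.
    by rewrite ler_pM.
  apply: (@le_trans _ _ ((1 + enorm (row i y')) * (1 + enorm (row i0 y')))).
    have := ler_enormD (row i y') (row i0 y').
    by move: (enorm_ge0 (row i y')) (enorm_ge0 (row i0 y')); nra.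
  apply: le_trans (ler_pM _ _ (P1 _ ii) P0) _; rewrite ?addr_ge0 ?enorm_ge0//.
  by rewrite /c le_eqVlt; apply/orP; left; apply/eqP; ring.
have jp i : 0 <= japan (row i y) by exact: sqrtr_ge0.
apply: le_trans (_ : \prod_i (c * T i * q ^+ 2) `^ s i <= _).
  apply: ler_prod => i _; rewrite powR_ge0 /=.
  by apply: ge0_ler_powR; rewrite ?nnegrE ?(ltW (s0 i))//; apply: le_trans (jle i).
have c0 : 0 < c by exact: lt_le_trans c1.
have q0 : 0 < q ^+ 2 by rewrite exprn_gt0// (lt_le_trans _ q1).
have -> : \prod_i (c * T i * q ^+ 2) `^ s i =
    c `^ (\sum_i s i) * t i0 `^ (\sum_(i in S) s i) * (q ^+ 2) `^ (\sum_i s i).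
  rewrite -!prod_powR// [X in _ * X * _]big_mkcond -!big_split /=; apply: eq_bigr => i _.
  have T0 : 0 <= T i by exact: le_trans (T1 i).
  rewrite !powRM ?mulr_ge0 ?exprn_ge0 ?(ltW c0) ?(le_trans _ q1)//.
  by rewrite /T; case: ifP => //; rewrite powR1.
rewrite ler_wpM2l ?mulr_ge0 ?powR_ge0// exprM -[leRHS]powR_mulrn ?(ltW q0)//.
by apply: ler_powR => //; rewrite exprn_ege1.
Qed.

(** This fixes the smoothness of the bumps: of the K = 2 N + 1 powers of Q, 2 N compensate the
    weights and one is kept for integrability. *)
Lemma symbol_hat_weight_le (s : 'I_m -> R) (N : nat) :
  (forall i, 0 < s i) -> \sum_i s i <= N%:R -> K = (2 * N).+1 ->
  exists2 C, 0 <= C & forall t y, (forall i, 0 < t i) ->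
    (forall i, i != i0 -> t i <= 1) -> 1 <= t i0 ->
    `|symbol_hat t y| * \prod_i japan (row i y) `^ s i <=
      C * t i0 `^ (\sum_(i in S) s i) * (\prod_(i < m) \prod_(j < n) t i)^-1 * Q t y.
Proof.
move=> s0 sN KN; have [C1 C10 H1] := symbol_hat_le.
have [C2 C20 H2] := weight_le s0 sN.
exists (C1 * C2) => [|t y t0 t1 ti0]; first exact: mulr_ge0.
apply: le_trans (ler_pM _ _ (H1 t y t0) (H2 t y t0 t1 ti0)) _ => //.
  by apply: prodr_ge0 => i _; exact: powR_ge0.
have q1 : 1 <= (Q t y)^-1 by exact: invr_cauchy_prod_ge1.
have q0 : Q t y != 0 by rewrite -invr_eq0 gt_eqF// (lt_le_trans _ q1).
move: (Q t y) q0 => q q0.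
have -> : q ^+ K = q * q ^+ (2 * N) by rewrite KN exprS.
have e : q ^+ (2 * N) * q^-1 ^+ (2 * N) = 1 by rewrite -exprMn divff// expr1n.
move: e; move: (q ^+ _) (q^-1 ^+ _) (t i0 `^ _) (\prod_(i < m) _) => a b c d e.
rewrite le_eqVlt; apply/orP; left; apply/eqP.
transitivity (C1 * d^-1 * q * C2 * c * (a * b)); first by ring.
by rewrite e; ring.
Qed.

Lemma measurable_symbol_hat t : (forall i, 0 < t i) ->
  measurable_fun setT (symbol_hat t).
Proof.
move=> t0; apply: measurable_prod => i _; apply: measurable_prod => j _.
apply: (measurableT_comp (measurable_bumphat K (divr_gt0 dlt0 (t0 i)))).
apply: measurable_funN; apply: measurable_funM => //.
apply: (measurableT_comp (measurable_entry i j)).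
apply: measurable_addmx => //.
by under eq_fun do rewrite -mulNmx; exact: measurable_mulmx.
Qed.

(** Since Q <= 1, its square is at most Q, whose integral is explicit after the dual shear. *)
Lemma integral_cauchy_shear_le t (c : R) : (forall i, 0 < t i) -> 0 <= c ->
  (\int[mu]_y ((c * Q t y) `^ 2)%:E <=
   (c ^+ 2 * \prod_(i < m) \prod_(j < n) (pi * t i))%:E)%E.
Proof.
move=> t0 c0.
have rt0 i j : 0 < rowwise t i j by rewrite mxE.
have mQ : measurable_fun setT (cauchy_prod (rowwise t) 0 : 'M[R]_(m, n) -> R).
  exact: measurable_cauchy_prod.
pose ph (y : 'M[R]_(m, n)) := y + - U^T *m y.
have phE y : ph y = y - U^T *m y by rewrite /ph mulNmx.
have mph : measurable_fun setT ph.
  by apply: measurable_addmx => //; exact: measurable_mulmx.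
apply: (@le_trans _ _ (\int[mu]_y ((c ^+ 2)%:E * (cauchy_prod (rowwise t) 0 (ph y))%:E))%E).
  apply: ge0_integral_mono => y; first by rewrite lee_fin powR_ge0.
  rewrite -EFinM lee_fin phE.
  have q1 : 1 <= (Q t y)^-1 by exact: invr_cauchy_prod_ge1.
  have q0 : 0 <= Q t y by exact: cauchy_prod_ge0.
  rewrite powR_mulrn ?mulr_ge0// exprMn ler_wpM2l ?sqr_ge0// expr2 ler_piMl//.
  by rewrite -[Q t y]invrK invf_le1// (lt_le_trans _ q1).
rewrite ge0_integralZl//=; last 3 first.
- by apply/measurable_EFinP; exact: (measurableT_comp mQ mph).
- by move=> y _; rewrite lee_fin cauchy_prod_ge0.
- by rewrite lee_fin sqr_ge0.
rewrite (ge0_integral_preserving mph (@lebesgue_row_shearTN _ _ _ _ _ i0J)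
  (f := fun y => (cauchy_prod (rowwise t) 0 y)%:E)); last 2 first.
- by apply/measurable_EFinP.
- by move=> y; rewrite lee_fin cauchy_prod_ge0.
rewrite integral_cauchy_prod// -EFinM lee_fin.
by under eq_bigr do under eq_bigr do rewrite mxE.
Qed.

Lemma cmod_symbol_le1 t A xi : cmod (symbol t A xi) <= 1.
Proof.
rewrite cmod_real ger0_norm; last first.
  by apply: prodr_ge0 => i _; apply: prodr_ge0 => j _; exact: bump_ge0.
apply: prodr_ile1 => i _; rewrite prodr_ge0 => [/=|j _]; last exact: bump_ge0.
by apply: prodr_ile1 => j _; rewrite bump_ge0 bump_le1.
Qed.

(** The conditions on [t] cover both the test symbol (t i0 = 1, the others 1/N) and its rescaled
    dyadic piece (t i0 = N, the others 1). Only the latter gives the decisive power of N. *)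
Lemma Wnorm_symbol_le (s : 'I_m -> R) (N : nat) :
  (forall i, 0 < s i) -> \sum_i s i <= N%:R -> K = (2 * N).+1 ->
  exists2 C, 0 <= C & forall t A, (forall i, 0 < t i) ->
    (forall i, i != i0 -> t i <= 1) -> 1 <= t i0 ->
    (Wnorm s (symbol t A) <= (C * t i0 `^ (\sum_(i in S) s i) *
      (\prod_(i < m) \prod_(j < n) t i) `^ (- 2^-1))%:E)%E.
Proof.
move=> s0 sN KN; have [C C0 HC] := symbol_hat_weight_le s0 sN KN.
exists (C * (\prod_(i < m) \prod_(j < n) pi) `^ 2^-1) => [|t A t0 t1 ti0].
  by rewrite mulr_ge0 ?powR_ge0.
set e := t i0 `^ _; set T := \prod_(i < m) \prod_(j < n) t i.
have e0 : 0 <= e by exact: powR_ge0.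
have T0 : 0 < T by apply: prodr_gt0 => i _; apply: prodr_gt0 => j _; exact: t0.
pose c := C * e * T^-1.
have c0 : 0 <= c by rewrite !mulr_ge0// invr_ge0 ltW.
have [si fE] := fourier_symbol A t0.
pose w y := \prod_i japan (row i y) `^ s i.
have w1 y : 1 <= w y.
  apply: prodr_ge1 => i _; rewrite -[leLHS](powRr0 (japan (row i y))).
  apply: ler_powR; last exact: ltW.
  by rewrite -[leLHS]sqrtr1 ler_wsqrtr// lerDl sqr_ge0.
have B y : cmod (fourier (symbol t A) y) * w y <= c * Q t y.
  by rewrite fE cmodM cmod_expi mul1r cmod_real; exact: HC.
pose V := c ^+ 2 * \prod_(i < m) \prod_(j < n) (pi * t i).
have IV : (\int[mu]_y ((c * Q t y) `^ 2)%:E <= V%:E)%E by exact: integral_cauchy_shear_le.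
(* The height 1 / T of the transform, squared, times the volume T leaves T^-1, hence T^(-1/2) after
   the square root. *)
have VE : V `^ 2^-1 = C * (\prod_(i < m) \prod_(j < n) pi) `^ 2^-1 * e * T `^ (- 2^-1).
  have -> : V = (C * e) ^+ 2 * (\prod_(i < m) \prod_(j < n) pi) * T^-1.
    rewrite /V; under eq_bigr do rewrite big_split /=.
    rewrite big_split /= -/T /c; move: (\prod_(i < m) _) => P.
    by field; rewrite gt_eqF.
  have P0 : 0 <= \prod_(i < m) \prod_(j < n) pi :> R.
    by apply: prodr_ge0 => i _; apply: prodr_ge0 => j _; exact: pi_ge0.
  rewrite powRM ?mulr_ge0 ?exprn_ge0 ?mulr_ge0 ?invr_ge0 ?(ltW T0)//.
  rewrite powRM ?exprn_ge0 ?mulr_ge0//.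
  rewrite -[_ ^+ 2]powR_mulrn ?mulr_ge0// -powRrM divff// powRr1 ?mulr_ge0//.
  by rewrite -(powR_inv1 (ltW T0)) -powRrM mulN1r; ring.
rewrite -VE.
have F2 : is_fourierL2 (symbol t A) (fourier (symbol t A)).
  apply: fourier_is_fourierL2 => //.
    by apply: cintegrable_square_integrable => // xi; exact: cmod_symbol_le1.
  split.
    apply: (_ : cmfun _); rewrite (_ : fourier _ = fun y =>
       expi (- (2 * pi * mxdot A y)) * Complex (symbol_hat t y) 0); last exact/funext.
    apply: cmfunM; last by apply: cmfun_real; exact: measurable_symbol_hat.
    apply: cmfun_expi; under eq_fun do rewrite mxdotC; exact: measurable_phase.
  apply: le_lt_trans (Lnorm_le (G := fun y => c * Q t y) (V := V) _ _ IV) (ltry _) => //.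
  move=> y; rewrite /= ger0_norm ?cmod_ge0// lee_fin.
  by apply: le_trans (B y); rewrite ler_peMr ?cmod_ge0.
apply: le_trans (Lnorm_le (F := fun y => (cmod (fourier (symbol t A) y) * w y)%:E)
  (G := fun y => c * Q t y) _ _ IV) => //.
  by apply: ereal_inf_lbound; exists (fourier (symbol t A)).
move=> y; rewrite /= ger0_norm; first by rewrite lee_fin B.
by rewrite mulr_ge0 ?cmod_ge0// (le_trans _ (w1 y)).
Qed.

End symbol.

(** * Support of the symbol and its dyadic pieces *)

Section cutoff.
Variables (R : realType) (m n : nat) (i0 : 'I_m) (J : {set 'I_m}).
Hypothesis i0J : i0 \notin J.
Local Notation mu := (lebesgue_mx R m n).
Variables (K : nat) (dlt : R).
Hypothesis dlt0 : 0 < dlt.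
Local Notation symbol := (@symbol R m n i0 J K dlt).
Implicit Types (t : 'I_m -> R) (A xi y M : 'M[R]_(m, n)).

Lemma bump_scale (N r : R) k x : 0 < N -> bump (N * r) k (N * x) = bump r k x.
Proof.
move=> N0; rewrite /bump normrM (gtr0_norm N0) ler_pM2l//; case: ifP => // _.
congr (cos _ ^+ _); rewrite (mulrCA 2 N) invfM.
move: (pi : R) (2 * r)^-1 => P q; transitivity (N^-1 * N * (P * q * x)); first by ring.
by rewrite mulVf ?gt_eqF// mul1r.
Qed.

Lemma symbol_scale (N : R) t A xi : 0 < N ->
  symbol (fun i => t i / N) (N *: A) (N *: xi) = symbol t A xi.
Proof.
move=> N0; congr (Complex _ 0); apply: eq_bigr => i _; apply: eq_bigr => j _.
rewrite invf_div mulrCA /shear -scalerBr -scalemxAr -scalerDr mxE.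
exact: bump_scale.
Qed.

Lemma shear_row A xi i j : i != i0 -> shear i0 J A xi i j = (xi - A) i j.
Proof. by move=> ii; rewrite /shear mxE row_shearE (negbTE ii) addr0. Qed.

Lemma shear_row0 A xi j :
  shear i0 J A xi i0 j = (xi - A) i0 j + \sum_(i in J) (xi - A) i j.
Proof. by rewrite /shear mxE row_shearE eqxx. Qed.

(** Row [i0] is the sheared row minus the rows in [J]: at most m terms of size [dlt]. *)
Lemma symbol_support t A xi : (forall i, 1 <= t i) -> symbol t A xi != 0 ->
  forall i j, `|(xi - A) i j| <= m%:R * dlt.
Proof.
move=> t1 nz.
have H i j : `|shear i0 J A xi i j| <= dlt.
  apply: (@le_trans _ _ (dlt / t i)); last first.
    by rewrite ler_pdivrMr ?(lt_le_trans _ (t1 i))// ler_peMr// ltW.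
  rewrite leNgt; apply: contra nz => h; apply/eqP; congr (Complex _ 0).
  by rewrite (bigD1 i)//= (bigD1 j)//= bump_out// !mul0r.
have m1 : 1 <= m%:R :> R by rewrite ler1n (leq_ltn_trans _ (ltn_ord i0)).
have H1 i j : i != i0 -> `|(xi - A) i j| <= dlt.
  by move=> ii; rewrite -(shear_row A xi j ii).
move=> i j; have [->|ii] := eqVneq i i0; last first.
  by apply: le_trans (H1 _ _ ii) _; rewrite ler_peMl// ltW.
have -> : (xi - A) i0 j = shear i0 J A xi i0 j - \sum_(i in J) (xi - A) i j.
  by rewrite shear_row0 addrK.
apply: le_trans (ler_normB _ _) _.
apply: le_trans (lerD (H i0 j) (ler_norm_sum _ _ _)) _.
apply: (@le_trans _ _ (dlt + \sum_(i in J) dlt)).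
  rewrite lerD2l; apply: ler_sum => k kJ; apply: H1.
  by apply: contraNneq i0J => <-.
rewrite sumr_const -mulrS -[leLHS]mulr_natl ler_wpM2r ?(ltW dlt0)// ler_nat.
by have := max_card (mem (i0 |: J)); rewrite cardsU1 i0J card_ord.
Qed.

Lemma enorm_near (a e : R) M : 0 <= a -> 0 <= e -> e <= 1 -> (m * n)%:R * a ^+ 2 = 1 ->
  (forall i j, `|M i j - a| <= e * a) -> 1 - e <= enorm M <= 1 + e.
Proof.
move=> a0 e0 e1 E H.
have S (c : R) : \sum_(i < m) \sum_(j < n) (c * a) ^+ 2 = c ^+ 2.
  rewrite !sumr_const !card_ord -mulrnA mulnC -mulr_natl exprMn mulrCA.
  by rewrite E mulr1.
have L : (1 - e) ^+ 2 <= enorm M ^+ 2.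
  rewrite sqr_enorm -[leLHS]S; apply: ler_sum => i _; apply: ler_sum => j _.
  have := H i j; rewrite ler_norml => /andP[h1 h2].
  have b0 : 0 <= (1 - e) * a by rewrite mulr_ge0// subr_ge0.
  by apply: lerXn2r; rewrite ?nnegrE//; lra.
have U : enorm M ^+ 2 <= (1 + e) ^+ 2.
  rewrite sqr_enorm -[leRHS]S; apply: ler_sum => i _; apply: ler_sum => j _.
  have := H i j; rewrite ler_norml => /andP[h1 h2].
  have b0 : 0 <= (1 - e) * a by rewrite mulr_ge0// subr_ge0.
  by apply: lerXn2r; rewrite ?nnegrE//; lra.
have p := enorm_ge0 M.
by rewrite -[X in X && _]ler_sqr ?nnegrE ?subr_ge0// L -ler_sqr ?nnegrE ?addr_ge0.
Qed.

End cutoff.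

Section dyadic_pieces.
Variables (R : realType) (m n : nat).
Local Notation mu := (lebesgue_mx R m n).
Implicit Types (f psi : 'M[R]_(m, n) -> R[i]) (xi : 'M[R]_(m, n)).

Lemma Wnorm_ge0 (s : 'I_m -> R) f : (0 <= Wnorm s f)%E.
Proof.
by apply/ereal_infP => _ [g _ ->]; exact: Lnorm_ge0.
Qed.

Lemma Wnorm_cst0 (s : 'I_m -> R) : (Wnorm s (fun _ : 'M[R]_(m, n) => 0%R : R[i]) <= 0)%E.
Proof.
have L0 (h : 'M[R]_(m, n) -> R) : (forall x, h x = 0) ->
    Lnorm mu 2%:E (fun x => (h x)%:E) = 0%E.
  move=> h0; apply/eqP; rewrite eq_le Lnorm_ge0 andbT.
  rewrite -[leRHS](_ : ((0 : R) `^ 2^-1)%:E = 0%E); last by rewrite powR0// invr_eq0.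
  apply: (Lnorm_le (G := fun=> 0)) => // [x|]; first by rewrite h0 /= normr0.
  by rewrite powR0// integral0.
have c0 : cmod (0 : R[i]) = 0 by rewrite -[0]/(Complex 0 0) cmod_real normr0.
have sq : square_integrable (fun _ : 'M[R]_(m, n) => 0%R : R[i]).
  by split; [exact: cmfun_cst|rewrite /cLnorm L0// => x; rewrite c0].
apply: ereal_inf_lbound; exists (fun=> 0).
  split=> // phi _; rewrite !cintegralE; apply: eq_cint => x.
  by rewrite !mul0r.
by rewrite L0// => x; rewrite c0 mul0r.
Qed.

Lemma dyadic_piece psi f (l : int) : dyadic_cutoff psi ->
  (forall xi, f xi != 0 -> 1 - 20^-1 <= enorm xi <= 1 + 20^-1) ->
  (fun xi => f ((2%:R ^ l) *: xi) * fourier psi xi) = if l == 0 then f else fun=> 0.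
Proof.
move=> [_ _ supp one _] H.
(* The four radii of the cutoff are r^-3, r^-1, r and r^3, with r^4 = 2. *)
pose r : R := 2 `^ (1 / 4).
have r0 : 0 < r by rewrite powR_gt0.
have r4 : r ^+ 4 = 2.
  rewrite -powR_mulrn ?(ltW r0)// -powRrM (_ : 1 / 4 * 4%:R = 1) ?powRr1//.
  by field.
have rN : 2 `^ (- (1 / 4)) = r^-1 :> R by rewrite powRN.
have r3 : 2 `^ (3 / 4) = r ^+ 3 :> R.
  by rewrite -powR_mulrn ?(ltW r0)// -powRrM; congr (_ `^ _); field.
have r3N : 2 `^ (- (3 / 4)) = (r ^+ 3)^-1 :> R by rewrite powRN r3.
(* The annulus 1 - 1/20 <= |xi| <= 1 + 1/20 thus lies where the cutoff equals 1; the bound holds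
   because (11/10)^4 < 2. *)
have r1 : 11 / 10 < r.
  rewrite ltNge; apply/negP => h; suff: r ^+ 4 <= (11 / 10) ^+ 4 by rewrite r4; lra.
  by apply: lerXn2r; rewrite ?nnegrE ?(ltW r0)//; lra.
have ri : r^-1 < 10 / 11.
  by rewrite invf_plt ?posrE// ?invf_div//; lra.
have r3V : 2 * (r ^+ 3)^-1 = r.
  by rewrite -r4; field; rewrite gt_eqF.
have r3h : r ^+ 3 = 2 * r^-1 by rewrite -r4; field; rewrite gt_eqF.
apply/funext => xi; case: eqP => [->|/eqP l0].
  rewrite expr0z scale1r; have [->|nz] := eqVneq (f xi) 0; first by rewrite mul0r.
  have /andP[h1 h2] := H _ nz; rewrite one ?mulr1// rN -/r.
  by move: ri r1 h1 h2; move: (r^-1) (enorm xi) => a b; lra.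
apply/eqP; rewrite mulf_eq0; case: (eqVneq (f (2%:R ^ l *: xi)) 0) => //= nz.
apply/negPn/negP => /supp /andP[s1 s2]; have := H _ nz; rewrite enormZ => /andP[h1 h2].
rewrite r3N in s1; rewrite r3 r3h in s2.
have e0 := enorm_ge0 xi.
(* On the support of the cutoff the dilated point has norm at least 2 r^-3 = r if l > 0, and at most
   r^3 / 2 = r^-1 if l < 0. Both miss the annulus that carries f. *)
case: l l0 h1 h2 {nz} => k l0 h1 h2.
  have k2 : 2 <= `|2%:R ^ k| :> R.
    rewrite ger0_norm ?exprz_ge0// -exprnP -[leLHS]expr1.
    by apply: ler_weXn2l; [lra|rewrite lt0n].
  have := ler_pM (ler0n _ 2) _ k2 s1; rewrite r3V.
  rewrite invr_ge0 exprn_ge0 ?(ltW r0)// => /(_ isT).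
  by move: r1 h2; move: (`|_| * _) => q; lra.
have k2 : `|2%:R ^ Negz k| <= 2^-1 :> R.
  rewrite ger0_norm ?exprz_ge0// NegzE -exprnN lef_pV2 ?posrE ?exprn_gt0//.
  by rewrite -[leLHS]expr1; apply: ler_weXn2l; [lra|].
have := ler_pM (normr_ge0 _) e0 k2 s2; rewrite mulKf//.
by move: ri h1; move: (`|_| * _) (r^-1) => q a; lra.
Qed.

End dyadic_pieces.

Section symbol_cutoff.
Variables (R : realType) (m n : nat) (i0 : 'I_m) (J : {set 'I_m}).
Hypothesis i0J : i0 \notin J.
Variables (K : nat) (alpha : R).
Hypothesis alpha0 : 0 < alpha.
Hypothesis alphaE : (m * n)%:R * alpha ^+ 2 = 1.
(** The m undoes the loss in [symbol_support]; the 20 puts every entry within alpha / 20 of alpha,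
    hence the support in the annulus of [dyadic_piece]. *)
Let dlt := alpha / (20 * m%:R).
Local Notation symbol := (@symbol R m n i0 J K dlt).

(** By homogeneity the piece of index l is the piece of index l - k of the symbol rescaled to unit
    frequency, so all but l = k vanish. *)
Lemma sup_Wnorm_symbol_le (psi : 'M[R]_(m, n) -> R[i]) (s t : 'I_m -> R) (k : nat) :
  dyadic_cutoff psi -> (forall i, 1 <= t i)%R ->
  (sup_Wnorm psi s (symbol (fun i => t i / 2 ^+ k)%R (2 ^+ k *: const_mx alpha)%R) <=
   Wnorm s (symbol t (const_mx alpha)))%E.
Proof.
move=> psiP t1; set N : R := 2 ^+ k.
have N0 : 0 < N by rewrite exprn_gt0.
have m0 : 0 < m%:R :> R by rewrite ltr0n (leq_ltn_trans _ (ltn_ord i0)).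
have d0 : 0 < dlt by rewrite divr_gt0// mulr_gt0.
apply: ub_ereal_sup => _ [l _ <-].
have E xi : symbol (fun i => t i / N) (N *: const_mx alpha) (2%:R ^ l *: xi) =
    symbol t (const_mx alpha) (2%:R ^ (l - k%:Z) *: xi).
  rewrite -(symbol_scale i0 J K dlt t _ _ N0); congr (symbol _ _ _).
  by rewrite scalerA /N exprnP -expfzDr ?pnatr_eq0// addrC subrK.
under eq_fun do rewrite E.
rewrite (dyadic_piece (psi := psi) (f := symbol t (const_mx alpha)))//.
  case: ifP => // _; exact: le_trans (Wnorm_cst0 _ _) (Wnorm_ge0 _ _).
move=> xi nz; apply: (@enorm_near _ _ _ alpha) => //; [exact: ltW|lra|].
move=> i j; have := symbol_support i0J d0 t1 nz i j.
rewrite !mxE => h; apply: le_trans h _; rewrite /dlt.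
by rewrite le_eqVlt; apply/orP; left; apply/eqP; field; rewrite gt_eqF.
Qed.

End symbol_cutoff.

(** * Lower bound for the multiplier operator *)

Lemma cos_ge_oneB (R : realType) (x : R) : 1 - `|x| <= cos x.
Proof.
wlog x0 : x / 0 <= x => [H|].
  have [/H//|/ltW x0] := leP 0 x.
  by rewrite -normrN -cosN; apply: H; rewrite oppr_ge0.
have [|c _] := @MVT_segment R cos (fun y => - sin y) 0 x x0.
- by apply: continuous_subspaceT; exact: continuous_cos.
rewrite cos0 subr0 (ger0_norm x0) => E.
have := sin_le1 c; nra.
Qed.

Section phase.
Context d (T : measurableType d) (R : realType) (mu : {measure set T -> \bar R}).
Implicit Types (P g : T -> R).

(* The phase g is nearly the constant c where P lives, so that multiplying by
   expi (- c) nearly turns the integrand into P. *)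
Lemma cmod_cint_phase_ge P g c (a b : R) :
  (forall x, 0 <= P x) -> measurable_fun setT g ->
  mu.-integrable setT (EFin \o P) ->
  (a%:E <= \int[mu]_x (P x)%:E)%E ->
  (\int[mu]_x (P x * `|g x - c|)%:E <= b%:E)%E ->
  a - b <= cmod (cint mu (fun x => expi (g x) * Complex (P x) 0)).
Proof.
move=> P0 mg iP aP Pb.
have mP : measurable_fun setT P by apply/measurable_EFinP; case/integrableP: iP.
have mgc : measurable_fun setT (fun x => g x - c) by exact: measurable_funB.
pose F x := expi (g x) * Complex (P x) 0.
have mF : cmfun F by apply: cmfunM; [exact: cmfun_expi|exact: cmfun_real].
have iF : cintegrable mu F.
  apply: (cintegrable_le mF iP) => x.
  by rewrite cmodM cmod_expi mul1r cmod_real ger0_norm.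
have iQ : mu.-integrable setT (EFin \o (fun x => P x * `|g x - c|)).
  apply/integrableP; split.
    apply/measurable_EFinP; apply: measurable_funM => //.
    exact: measurableT_comp.
  apply: le_lt_trans (ltry b); apply: le_trans Pb.
  under eq_integral => x _ do rewrite /= ger0_norm ?mulr_ge0//.
  exact: lexx.
have -> : cmod (cint mu (fun x => expi (g x) * Complex (P x) 0)) =
    cmod (cint mu (fun x => expi (- c) * F x)).
  by rewrite cintZ// cmodM cmod_expi mul1r.
have iC : mu.-integrable setT (EFin \o (fun x => complex.Re (expi (- c) * F x))).
  exact: (cintegrableZ (expi (- c)) iF).1.
apply: le_trans (le_trans (ler_norm _) (ler_Re_cmod _)).
rewrite -[complex.Re (cint _ _)]/(\int[mu]_x complex.Re (expi (- c) * F x)).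
(* The real part of the rotated integrand is P cos(g - c), and cos(u) >= 1 - |u|. *)
apply: le_trans (_ : \int[mu]_x (P x - P x * `|g x - c|) <= _); last first.
  apply: le_Rintegral => //.
    by have := integrableB measurableT iP iQ; apply: eq_integrable => // x _.
  move=> x _; rewrite /F mulrA -expiD ReM /= mulr0 subr0.
  rewrite -[X in X - _]mulr1 -mulrBr mulrC [- c + g x]addrC.
  by apply: ler_wpM2r => //; exact: cos_ge_oneB.
rewrite RintegralB//; apply: lerB; rewrite /Rintegral -lee_fin fineK//;
  exact: integrable_fin_num.
Qed.

End phase.

Section lower_bound.
Variables (R : realType) (m n : nat) (i0 : 'I_m) (J : {set 'I_m}).
Hypothesis i0J : i0 \notin J.
Local Notation mu := (lebesgue_mx R m n).
Local Notation leb := (@lebesgue_measure R).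
Variables (K M : nat) (j0 : 'I_n) (alpha : R).
Hypothesis alpha0 : 0 < alpha.

Definition delta : R := alpha / (20 * m%:R).

Definition test_center N : 'M[R]_(m, n) := N *: const_mx alpha.

(** The quotient by N is kept for comparison with [symbol_scale]; the widths are [delta] in the
    sheared row [i0] and N [delta] in the others. *)
Definition test_symbol (N : R) : 'M[R]_(m, n) -> R[i] :=
  symbol i0 J K delta (fun i => (if i == i0 then N else 1) / N) (test_center N).

(* The multiplier of the second difference with this step is 4 sin^2 of a phase
   that equals pi / 2 at the centre of the packet, where it is maximal. *)
Definition test_fun (N : R) (w : 'I_m -> R) (i : 'I_m) : 'rV[R]_n -> R[i] :=
  iter M (sdiff (((2 * alpha)^-1 / N) *: delta_mx 0 j0)) (packet (w i) (N *: const_mx alpha)).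

Local Notation D N := (shear i0 J (test_center N)).

(** Difference multipliers, Gaussian transforms and bumps are all nonnegative, so the integrand of
    the operator is this density times the phase in x. *)
Definition test_density (N : R) (w : 'I_m -> R) (xi : 'M[R]_(m, n)) : R :=
  \prod_i ((4 * sin (pi * ((2 * alpha)^-1 / N * xi i j0)) ^+ 2) ^+ M * w i ^+ n *
    \prod_j (bump (delta * (if i == i0 then 1 else N)) K (D N xi i j) *
             gau (pi * w i ^+ 2) ((xi - test_center N) i j))).

Let m0 : 0 < m%:R :> R.
Proof. by rewrite ltr0n (leq_ltn_trans _ (ltn_ord i0)). Qed.

Lemma delta_gt0 : 0 < delta.
Proof. by rewrite divr_gt0// mulr_gt0. Qed.

Lemma multiplier_op_test N w x : 0 < N -> (forall i, 0 < w i) ->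
  multiplier_op (test_symbol N) (test_fun N w) x =
  cint mu (fun xi => expi (2 * pi * mxdot x (\sum_i row i xi)) *
                     Complex (test_density N w xi) 0).
Proof.
move=> N0 w0; apply: eq_cint => xi; rewrite -mulrA; congr (_ * _).
under eq_bigr => i _.
  rewrite (fourier_iter_sdiff _ _ _ (schwartz_cintegrable
    (packet_schwartz (N *: const_mx alpha) 0 0 (w0 i)))).2 fourier_packet// Complex0M.
  over.
rewrite prod_Complex0 Complex0M -big_split; congr (Complex _ 0).
apply: eq_bigr => i _ /=; rewrite big_split /=.
rewrite mxdotZl mxdot_deltal mxE.
have -> : \prod_j gau (pi * w i ^+ 2) ((xi - test_center N) i j) =
    expR (- (pi * w i ^+ 2 * mxdot (row i xi - N *: const_mx alpha) (row i xi - N *: const_mx alpha))).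
  rewrite /mxdot big_ord_recl big_ord0 addr0 mulr_sumr -sumrN expR_sum.
  by apply: eq_bigr => j _; rewrite /gau !mxE expr2.
have -> : \prod_j bump (delta / ((if i == i0 then N else 1) / N)) K (D N xi i j) =
    \prod_j bump (delta * (if i == i0 then 1 else N)) K (D N xi i j).
  apply: eq_bigr => j _; congr bump.
  by case: eqP => _; rewrite ?div1r ?invrK// divff ?invr1 ?gt_eqF.
by ring.
Qed.

Lemma test_density_ge0 N w xi : (forall i, 0 < w i) -> 0 <= test_density N w xi.
Proof.
move=> w0; apply: prodr_ge0 => i _; apply: mulr_ge0.
  by rewrite mulr_ge0// exprn_ge0// ?(ltW (w0 i))// mulr_ge0// sqr_ge0.
by apply: prodr_ge0 => j _; rewrite mulr_ge0 ?bump_ge0 ?gau_ge0.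
Qed.

Lemma measurable_test_density N w : measurable_fun setT (test_density N w).
Proof.
have mD : measurable_fun setT (D N) by exact: measurable_shear.
have mA : measurable_fun setT (fun xi : 'M[R]_(m, n) => xi - test_center N).
  exact: measurable_addmx.
apply: measurable_prod => i _; apply: measurable_funM.
  apply: measurable_funM => //; apply: measurable_funX; apply: measurable_funM => //.
  apply: measurable_funX; apply: measurableT_comp.
    exact: continuous_measurable_fun (@continuous_sin R).
  apply: measurable_funM => //; apply: measurable_funM => //.
  exact: measurable_entry.
apply: measurable_prod => j _; apply: measurable_funM.
  apply: (measurableT_comp (measurable_bump _ _)).
  exact: (measurableT_comp (measurable_entry i j)).
apply: (measurableT_comp (@measurable_expR R)).
apply: measurable_funN; apply: measurable_funM => //; apply: measurable_funX.
exact: (measurableT_comp (measurable_entry i j)).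
Qed.

(* The two choices of widths made in the end are w = 1 with J empty, and
   w = 1 / N on i0 |: J with w = 1 elsewhere. *)
Definition admissible (N : R) (w : 'I_m -> R) : Prop :=
  [/\ 1 <= N, forall i, i \in J -> w i = N^-1, forall i, i \notin i0 |: J -> w i = 1 &
      w i0 = N^-1 \/ w i0 = 1 /\ J = finset.set0].

(** The effective width of the density in sheared row i, up to constants: the bumps give N on [J]
    and 1 at [i0], a Gaussian of unit width gives 1 elsewhere. For admissible widths w_i b_i = 1
    unless i = i0, so only [w i0] survives in products. *)
Let b (N : R) i : R := if i \in J then N else 1.

Lemma admissible_gt0 N w i : admissible N w -> 0 < w i.
Proof.
move=> [N1 wJ wO w0]; have N0 : 0 < N by exact: lt_le_trans N1.
have [->|ii] := eqVneq i i0; first by case: w0 => [->|[-> _]]//; rewrite invr_gt0.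
have [iJ|iJ] := boolP (i \in J); first by rewrite wJ// invr_gt0.
by rewrite wO// !inE negb_or ii.
Qed.

Lemma prod_width N w (c : R) : admissible N w ->
  \prod_i \prod_(j < n) (c * (w i * b N i)) = c ^+ (n * m) * w i0 ^+ n.
Proof.
move=> aw; have [N1 wJ wO w0] := aw; have N0 : 0 < N by exact: lt_le_trans N1.
under eq_bigr do rewrite prodr_const card_ord exprMn.
rewrite big_split /= prodr_const card_ord exprM; congr (_ * _).
rewrite (bigD1 i0)//= big1 ?mulr1 => [|i ii]; rewrite /b.
  by rewrite (negbTE i0J) mulr1.
case: ifP => iJ; first by rewrite wJ// mulVf ?gt_eqF// expr1n.
by rewrite wO ?mulr1 ?expr1n// !inE negb_or ii iJ.
Qed.

Lemma shear_out N xi i j : i != i0 -> (xi - test_center N) i j = D N xi i j.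
Proof. by move=> ii; rewrite shear_row. Qed.

(** On this sheared box every factor is bounded below: the difference multipliers by 1, the bumps by
    2^-K, the Gaussians because w_i |xi_i - N a_i| stays bounded entrywise. *)
Lemma test_density_box N w xi : admissible N w ->
  (forall i j, `|D N xi i j| <= delta * b N i / 2) ->
  \prod_i \prod_(j < n) (w i * ((1 / 2) ^+ K * expR (- (pi * (m%:R * delta / 2) ^+ 2)))) <=
  test_density N w xi.
Proof.
move=> aw H; have [N1 wJ wO wi0] := aw; have N0 : 0 < N by exact: lt_le_trans N1.
have d0 := delta_gt0.
have w0 i : 0 < w i by exact: admissible_gt0 aw.
have m1 : 1 <= m%:R :> R by rewrite ler1n -(ltr0n R).
have bN i : b N i <= N by rewrite /b; case: ifP.
have md : delta <= m%:R * delta by rewrite ler_peMl// ltW.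
(* The first bound controls the phase of the sine, the second the exponent of the Gaussian. *)
have ZN i j : `|(xi - test_center N) i j| <= m%:R * delta * N / 2 /\
    `|w i * (xi - test_center N) i j| <= m%:R * delta / 2.
  have Di k l : `|D N xi k l| <= delta * N / 2.
    by apply: le_trans (H k l) _; rewrite ler_wpM2r ?invr_ge0// ler_wpM2l ?(ltW d0).
  rewrite normrM (gtr0_norm (w0 i)).
  have [->|ii] := eqVneq i i0; last first.
    rewrite shear_out//; split.
      by apply: le_trans (Di i j) _; rewrite !ler_wpM2r ?invr_ge0 ?(ltW N0).
    have wb : w i * b N i = 1.
      rewrite /b; case: ifP => iJ; first by rewrite (wJ _ iJ) mulVf ?gt_eqF.
      by rewrite wO ?mulr1// !inE negb_or ii iJ.
    apply: le_trans (ler_wpM2l (ltW (w0 i)) (H i j)) _.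
    rewrite (_ : w i * _ = w i * b N i * (delta / 2)); last by ring.
    by rewrite wb mul1r ler_wpM2r ?invr_ge0.
  have -> : (xi - test_center N) i0 j = D N xi i0 j - \sum_(i in J) D N xi i j.
    rewrite shear_row0; apply/eqP; rewrite eq_sym subr_eq; apply/eqP; congr (_ + _).
    by apply: eq_bigr => k kJ; rewrite shear_row//; apply: contraNneq i0J => <-.
  have J1 : `|D N xi i0 j - \sum_(i in J) D N xi i j| <= m%:R * delta * N / 2.
    apply: le_trans (ler_normB _ _) _.
    apply: le_trans (lerD (Di i0 j) (ler_norm_sum _ _ _)) _.
    apply: le_trans (lerD (lexx _) (ler_sum _ (fun k _ => Di k j))) _.
    have p0 : 0 <= delta * N / 2 by rewrite divr_ge0// mulr_ge0// ltW.
    rewrite sumr_const -mulrS -[leLHS]mulr_natl -[m%:R * delta * N]mulrA -[leRHS]mulrA.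
    apply: ler_wpM2r => //.
    by rewrite ler_nat; have := max_card (mem (i0 |: J)); rewrite cardsU1 i0J card_ord.
  (* Undoing the shear brings rows of size N into row [i0]. This is harmless if w_i0 = 1/N; if w_i0
     = 1, then [J] is empty and nothing is added. *)
  split => //; case: wi0 => [->|[-> J0]].
    apply: le_trans (ler_wpM2l _ J1) _; first by rewrite invr_ge0 ltW.
    by rewrite le_eqVlt; apply/orP; left; apply/eqP; field; rewrite gt_eqF.
  rewrite mul1r big1 ?subr0 => [|k]; last by rewrite J0 inE.
  apply: le_trans (H i0 j) _.
  by rewrite /b (negbTE i0J) mulr1 ler_wpM2r ?invr_ge0.
have h0 : 0 <= (1 / 2) ^+ K :> R by apply: exprn_ge0; lra.
have g0 : 0 <= (1 / 2) ^+ K * expR (- (pi * (m%:R * delta / 2) ^+ 2)) :> R.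
  by rewrite mulr_ge0 ?expR_ge0.
apply: ler_prod => i _; apply/andP; split.
  by apply: prodr_ge0 => j _; exact: mulr_ge0 (ltW (w0 i)) g0.
rewrite big_split /= prodr_const card_ord.
apply: ler_pM; rewrite ?exprn_ge0 ?(ltW (w0 i))//.
- by apply: prodr_ge0 => j _; exact: g0.
- rewrite ler_peMl ?exprn_ge0 ?(ltW (w0 i))// exprn_ege1//.
  have : 1 / 2 <= cos (pi * ((2 * alpha)^-1 / N * (xi - test_center N) i j0)) ^+ 2.
    apply: cos_sqr_ge_half; rewrite !normrM (ger0_norm (pi_ge0 R)).
    rewrite ler_wpM2l ?pi_ge0//.
    have [z _] := ZN i j0; move: z; move: `|_ i j0| => z Hz.
    rewrite gtr0_norm ?invr_gt0 ?mulr_gt0// gtr0_norm ?invr_gt0//.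
    apply: le_trans (ler_wpM2l _ Hz) _; first by rewrite ?mulr_ge0 ?invr_ge0 ?mulr_ge0 ?ltW.
    rewrite /delta.
    (* The phase is within pi / 80 of pi / 2, well inside the pi / 4 allowed. *)
    have -> : (2 * alpha)^-1 / N * (m%:R * (alpha / (20 * m%:R)) * N / 2) = 80^-1.
      by field; rewrite !gt_eqF.
    by lra.
  have -> : pi * ((2 * alpha)^-1 / N * xi i j0) =
      pi * ((2 * alpha)^-1 / N * (xi - test_center N) i j0) + pi / 2.
    have -> : (xi - test_center N) i j0 = xi i j0 - N * alpha by rewrite !mxE.
    by move: (pi : R) => P; field; rewrite !gt_eqF.
  by rewrite sinDpihalf; lra.
apply: ler_prod => j _; rewrite g0 /=.
apply: ler_pM; rewrite ?expR_ge0//.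
  apply: bump_ge; first by rewrite mulr_gt0//; case: ifP.
  apply: le_trans (H i j) _; rewrite ler_wpM2r ?invr_ge0// ler_wpM2l ?(ltW d0)//.
  by case: eqP => [->|_]; rewrite ?bN// /b (negbTE i0J).
rewrite /gau ler_expR lerN2 -mulrA ler_wpM2l ?pi_ge0// -exprMn.
rewrite -[leLHS]real_normK ?num_real//; apply: lerXn2r; rewrite ?nnegrE ?normr_ge0//.
  by rewrite divr_ge0// mulr_ge0// ltW.
exact: (ZN i j).2.
Qed.

Let C1 : R := 2 * ((1 + expR pi) * 2`!%:R / pi ^+ 2).

Let C10 : 0 <= C1.
Proof. by rewrite mulr_ge0// !mulr_ge0 ?addr_ge0 ?expR_ge0 ?invr_ge0 ?exprn_ge0 ?pi_ge0. Qed.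

(** The extra factor 1 + |x| pays for the variation of the phase in the rows outside [i0 |: J]. *)
Let gau_lin (x : R) : gau pi x * (1 + `|x|) <= C1 * (1 + x ^+ 2)^-1.
Proof.
have x2 : 0 < 1 + x ^+ 2 by rewrite ltr_wpDr ?sqr_ge0.
rewrite ler_pdivlMr// /C1; have := gau_decay x 2 (pi_gt0 R); move: (_ / _) => A HA.
apply: le_trans (ler_wpM2l (ler0n _ 2) HA).
have k : 1 + `|x| <= 2 * (1 + x ^+ 2).
  by rewrite -[x ^+ 2]real_normK ?num_real//; move: (normr_ge0 x); nra.
apply: le_trans (ler_wpM2r (ltW x2) (ler_wpM2l (gau_ge0 pi x) k)) _.
by rewrite le_eqVlt; apply/orP; left; apply/eqP; ring.
Qed.

(** Outside [i0 |: J] the bump has width N [delta] and gives no bound uniform in N; there the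
    Gaussian of unit width takes over. *)
Let h (N : R) i (x : R) : R := if i \in i0 |: J then
  bump (delta * (if i == i0 then 1 else N)) K x else C1 * (1 + x ^+ 2)^-1.

Let h_ge0 N i x : 0 <= h N i x.
Proof.
rewrite /h; case: ifP => _; first exact: bump_ge0.
by rewrite mulr_ge0// invr_ge0 addr_ge0// sqr_ge0.
Qed.

Let measurable_h N i : measurable_fun [set: measurableTypeR R] (h N i).
Proof.
have -> : h N i = if i \in i0 |: J then
    bump (delta * (if i == i0 then 1 else N)) K else fun x => C1 * (1 + x ^+ 2)^-1.
  by apply/funext => x; rewrite /h; case: ifP.
case: ifP => _; first exact: measurable_bump.
apply: measurable_funM => //.
by have := @measurable_cauchy R 1 0; under eq_fun do rewrite subr0 divr1.
Qed.

Let C2 : R := 2 * delta + C1 * pi.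

Let C20 : 0 <= C2.
Proof.
by rewrite addr_ge0// mulr_ge0 ?pi_ge0//; exact: ltW delta_gt0.
Qed.

Let integral_h N w i : admissible N w ->
  exists2 I : R, 0 <= I <= C2 * b N i & (\int[leb]_x (h N i x)%:E = I%:E)%E.
Proof.
move=> [N1 _ _ _]; have N0 : 0 < N by exact: lt_le_trans N1.
have b0 : 0 < b N i by rewrite /b; case: ifP.
have d0 := delta_gt0.
rewrite /h; case: (boolP (i \in i0 |: J)) => iS.
  have r0 : 0 < delta * (if i == i0 then 1 else N) by rewrite mulr_gt0//; case: ifP.
  have fi := integrable_fin_num measurableT (integrable_bump K r0).
  exists (fine (\int[leb]_x (bump (delta * (if i == i0 then 1 else N)) K x)%:E)%E); last first.
    by rewrite fineK.
  rewrite fine_ge0 ?integral_ge0//= => [|x _]; last by rewrite lee_fin bump_ge0.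
  rewrite -lee_fin fineK//; apply: le_trans (integral_bump_le K r0) _.
  rewrite lee_fin /b (_ : (if i \in J then N else 1) = (if i == i0 then 1 else N)); last first.
    move: iS; rewrite !inE; case: eqP => [->|_ /= ->] //.
    by rewrite (negbTE i0J).
  rewrite mulrA ler_wpM2r//; first by case: ifP => _ //; exact: ltW.
  by rewrite /C2 lerDl mulr_ge0 ?pi_ge0.
exists (C1 * pi).
  rewrite mulr_ge0 ?pi_ge0//= /b; move: iS; rewrite !inE negb_or => /andP[_ /negbTE ->].
  by rewrite mulr1 /C2 lerDr mulr_ge0// ltW.
under eq_integral do rewrite EFinM.
rewrite ge0_integralZl ?lee_fin//.
- by rewrite integral_oneDsqrV -EFinM.
- apply/measurable_EFinP.
  by have := @measurable_cauchy R 1 0; under eq_fun do rewrite subr0 divr1.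
- by move=> x _; rewrite lee_fin invr_ge0 addr_ge0// sqr_ge0.
Qed.

Let majorant N w (Z : 'M[R]_(m, n)) : R := \prod_i \prod_j (w i * h N i (Z i j)).

Let integral_majorant N w : admissible N w ->
  (\int[mu]_xi (majorant N w (D N xi))%:E <= (C2 ^+ (n * m) * w i0 ^+ n)%:E)%E.
Proof.
move=> aw; have w0 i : 0 <= w i by exact: ltW (admissible_gt0 _ aw).
have mh i : measurable_fun [set: measurableTypeR R] (fun x => w i * h N i x) by exact: measurable_funM.
have mmaj : measurable_fun setT (majorant N w).
  apply: measurable_prod => i _; apply: measurable_prod => j _.
  exact: (measurableT_comp (mh i) (measurable_entry i j)).
rewrite (ge0_integral_preserving (measurable_shear _ _ _)
  (@lebesgue_shear _ _ _ _ _ i0J (test_center N)) (f := fun Z => (majorant N w Z)%:E)); last 2 first.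
- exact/measurable_EFinP.
- move=> x; rewrite lee_fin; apply: prodr_ge0 => i _; apply: prodr_ge0 => j _.
  exact: mulr_ge0.
have iF i : (\int[leb]_x (w i * h N i x)%:E = (w i)%:E * \int[leb]_x (h N i x)%:E)%E.
  under eq_integral do rewrite EFinM.
  rewrite ge0_integralZl ?lee_fin//; first by apply/measurable_EFinP; exact: measurable_h.
  by move=> x _; rewrite lee_fin.
have -> : (\int[mu]_Z (majorant N w Z)%:E =
    \int[mu]_Z \prod_i \prod_j (w i * h N i (Z i j))%:E)%E.
  apply: eq_integral => Z _; rewrite /majorant -prodEFin.
  by apply: eq_bigr => i _; rewrite -prodEFin.
rewrite (@ge0_integral_mx_prod _ _ _ (fun i j x => (w i * h N i x)%:E)); last 2 first.
- by move=> i j; apply/measurable_EFinP.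
- by move=> i j x; rewrite lee_fin mulr_ge0.
pose I i := sval (cid2 (integral_h i aw)).
have [I1 I2] : (forall i, 0 <= I i <= C2 * b N i) /\
    (forall i, \int[leb]_x (h N i x)%:E = (I i)%:E)%E.
  by split=> i; rewrite /I; case: cid2.
under eq_bigr do under eq_bigr do rewrite iF I2 -EFinM.
under eq_bigr do rewrite prodEFin; rewrite prodEFin lee_fin.
rewrite -(prod_width _ aw); apply: ler_prod => i _; apply/andP; split.
  by apply: prodr_ge0 => j _; rewrite mulr_ge0//; case/andP: (I1 i).
apply: ler_prod => j _; have /andP[a1 a2] := I1 i.
by rewrite mulr_ge0//= mulrCA ler_wpM2l.
Qed.

(** Bounds the part of the frequency sum that no bump confines uniformly in N. *)
Let spread (N : R) (xi : 'M[R]_(m, n)) : R :=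
  \prod_i \prod_j (if i \in i0 |: J then 1 else 1 + `|D N xi i j|).

Let spread_ge1 N xi : 1 <= spread N xi.
Proof.
apply: prodr_ge1 => i _; apply: prodr_ge1 => j _.
by case: ifP => // _; rewrite lerDl.
Qed.

Let entry_le_spread N xi i j : i \notin i0 |: J -> `|D N xi i j| <= spread N xi.
Proof.
move=> iS; have e1 k l : 1 <= (if k \in i0 |: J then 1 else 1 + `|D N xi k l|) :> R.
  by case: ifP => // _; rewrite lerDl.
apply: le_trans (ler_prodr_ge1 i _) => [|k]; last exact: prodr_ge1.
apply: le_trans (ler_prodr_ge1 j (e1 i)).
by rewrite (negbTE iS) lerDr.
Qed.

Let density_spread_le N w xi : admissible N w ->
  test_density N w xi * spread N xi <= 4 ^+ (M * m) * majorant N w (D N xi).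
Proof.
move=> aw; have [N1 _ wO _] := aw.
have w0 i : 0 < w i by exact: admissible_gt0 aw.
rewrite exprM -[X in _ ^+ X](card_ord m) -prodr_const -!big_split /=.
apply: ler_prod => i _.
have e0 j : 0 <= (if i \in i0 |: J then 1 else 1 + `|D N xi i j|) :> R.
  by case: ifP => // _; rewrite addr_ge0.
have s0 : 0 <= 4 * sin (pi * ((2 * alpha)^-1 / N * xi i j0)) ^+ 2.
  by rewrite mulr_ge0// sqr_ge0.
apply/andP; split.
  rewrite !mulr_ge0 ?exprn_ge0 ?(ltW (w0 i))//; apply: prodr_ge0 => j _ //.
  by rewrite mulr_ge0 ?bump_ge0 ?gau_ge0.
rewrite -[leLHS]mulrA -[leLHS]mulrA; apply: ler_pM; first exact: exprn_ge0.
- by rewrite !mulr_ge0 ?exprn_ge0 ?(ltW (w0 i))//; apply: prodr_ge0 => j _ //;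
    rewrite mulr_ge0 ?bump_ge0 ?gau_ge0.
- apply: lerXn2r; rewrite ?nnegrE// ler_piMr//.
rewrite [leRHS]big_split /= prodr_const card_ord ler_wpM2l ?exprn_ge0 ?(ltW (w0 i))//.
rewrite -big_split /=; apply: ler_prod => j _; apply/andP; split.
  by rewrite !mulr_ge0 ?bump_ge0 ?gau_ge0.
rewrite /h; case: (boolP (i \in i0 |: J)) => iS.
  by rewrite mulr1 ler_piMr ?bump_ge0// gau_le1// mulr_ge0 ?pi_ge0 ?sqr_ge0.
have ii : i != i0 by move: iS; rewrite !inE negb_or => /andP[].
rewrite shear_out// wO// expr1n mulr1; apply: le_trans (gau_lin _).
by rewrite -mulrA ler_piMl ?bump_le1// mulr_ge0 ?gau_ge0// addr_ge0.
Qed.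

Let phase (x : 'rV[R]_n) (xi : 'M[R]_(m, n)) := 2 * pi * mxdot x (\sum_i row i xi).

(** Relative to the centre, the sum of all rows is the sheared row [i0], of size at most [delta]
    where the density lives, plus the rows outside [i0 |: J]. The wide rows of [J] never appear on
    their own: this is the purpose of the narrow bump. *)
Let phase_le N w (x : 'rV[R]_n) rho xi : admissible N w -> (forall j, `|x 0 j| <= rho) ->
  test_density N w xi * `|phase x xi - phase x (test_center N)| <=
  rho * (2 * pi * n%:R * (delta + m%:R)) * (test_density N w xi * spread N xi).
Proof.
move=> aw xr; have w0 i : 0 < w i by exact: admissible_gt0 aw.
have [->|nz] := eqVneq (test_density N w xi) 0; first by rewrite !mul0r mulr0.
rewrite [leRHS]mulrCA; apply: ler_wpM2l; first exact: test_density_ge0.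
have Db j : `|D N xi i0 j| <= delta.
  rewrite leNgt; apply: contra nz => hh.
  rewrite /test_density (bigD1 i0)//= (bigD1 j)//= eqxx mulr1 bump_out//.
  by rewrite !(mul0r, mulr0).
have -> : phase x xi - phase x (test_center N) = 2 * pi *
    \sum_j x 0 j * (D N xi i0 j + \sum_(i | i \notin i0 |: J) D N xi i j).
  rewrite /phase -mulrBr; congr (_ * _).
  rewrite /mxdot !big_ord_recl !big_ord0 !addr0 -sumrB; apply: eq_bigr => j _.
  rewrite -mulrBr; congr (_ * _); rewrite !summxE -sumrB.
  rewrite (eq_bigr (fun i => (xi - test_center N) i j)) => [|i _]; last by rewrite !mxE.
  rewrite shear_row0 (bigID (fun i => i \in i0 |: J)) /= big_setU1//= -!addrA.
  do 2 congr (_ + _); apply: eq_bigr => i; rewrite !inE negb_or => /andP[ii _].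
  exact: shear_out.
rewrite normrM ger0_norm ?mulr_ge0 ?pi_ge0//.
have E1 := spread_ge1 N xi; have d0 := delta_gt0.
have p0 : 0 <= pi :> R by exact: pi_ge0.
have xr0 : 0 <= rho by apply: le_trans (xr j0).
suff : `|\sum_j x 0 j * (D N xi i0 j + \sum_(i | i \notin i0 |: J) D N xi i j)| <=
    n%:R * (rho * ((delta + m%:R) * spread N xi)).
  move=> H; apply: le_trans (ler_wpM2l (mulr_ge0 (ler0n _ 2) p0) H) _.
  by rewrite le_eqVlt; apply/orP; left; apply/eqP; move: (pi : R) => P; ring.
apply: le_trans (ler_norm_sum _ _ _) _.
apply: le_trans (ler_sum _ (fun j _ => _ : _ <= rho * ((delta + m%:R) * spread N xi))) _; last first.
  by rewrite sumr_const card_ord mulr_natl.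
move=> j _; rewrite normrM; apply: ler_pM => //.
apply: le_trans (ler_normD _ _) _; rewrite mulrDl; apply: lerD.
  by apply: le_trans (Db j) _; rewrite ler_peMr// ltW.
apply: le_trans (ler_norm_sum _ _ _) _.
apply: le_trans (ler_sum _ (fun i iS => entry_le_spread N xi j iS)) _.
rewrite sumr_const -[leLHS]mulr_natl ler_wpM2r ?(le_trans _ E1)// ler_nat.
by have := max_card [pred i | i \notin i0 |: J]; rewrite card_ord.
Qed.

(** The density has mass at least a w_i0^n, and the phase error over it is at most rho B w_i0^n with
    the same power of [w i0], so [rho] can be chosen independently of N. *)
Lemma multiplier_op_test_ge : exists2 c, 0 < c & exists2 rho, 0 < rho &
  forall N w (x : 'rV[R]_n), admissible N w -> (forall j, `|x 0 j| <= rho) ->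
    c * w i0 ^+ n <= cmod (multiplier_op (test_symbol N) (test_fun N w) x).
Proof.
have d0 := delta_gt0.
pose g : R := (1 / 2) ^+ K * expR (- (pi * (m%:R * delta / 2) ^+ 2)).
have g0 : 0 < g by rewrite mulr_gt0 ?expR_gt0// exprn_gt0.
pose a : R := (g * delta) ^+ (n * m).
have a0 : 0 < a by rewrite exprn_gt0// mulr_gt0.
pose B : R := 2 * pi * n%:R * (delta + m%:R) * 4 ^+ (M * m) * C2 ^+ (n * m).
have B0 : 0 <= B.
  by rewrite !mulr_ge0 ?exprn_ge0 ?pi_ge0// addr_ge0// ltW.
exists (a / 2); first by rewrite divr_gt0.
(* Makes rho B at most a / 2; the 1 guards against B = 0. *)
exists (a / (2 * (B + 1))) => [|N w x aw xr].
  by rewrite divr_gt0// mulr_gt0// ltr_wpDl.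
have [N1 _ _ _] := aw; have N0 : 0 < N by exact: lt_le_trans N1.
have w0 i : 0 < w i by exact: admissible_gt0 aw.
have W0 : 0 <= w i0 ^+ n by rewrite exprn_ge0// ltW.
set rho := a / _ in xr.
have r0 : 0 <= rho by apply: le_trans (xr j0).
rewrite (multiplier_op_test x N0 w0).
pose H xi := 4 ^+ (M * m) * majorant N w (D N xi).
have mmaj : measurable_fun setT H.
  apply: measurable_funM => //; apply: measurable_prod => i _; apply: measurable_prod => j _.
  apply: measurable_funM => //; apply: (measurableT_comp (measurable_h N i)).
  exact: (measurableT_comp (measurable_entry i j) (measurable_shear _ _ _)).
have maj0 xi : 0 <= majorant N w (D N xi).
  by apply: prodr_ge0 => i _; apply: prodr_ge0 => j _; rewrite mulr_ge0// ltW.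
have H0 xi : 0 <= H xi by rewrite mulr_ge0// exprn_ge0.
have iH : (\int[mu]_xi (H xi)%:E <= (4 ^+ (M * m) * (C2 ^+ (n * m) * w i0 ^+ n))%:E)%E.
  under eq_integral do rewrite EFinM.
  rewrite ge0_integralZl//=; last 2 first.
  - apply/measurable_EFinP; apply: measurable_prod => i _; apply: measurable_prod => j _.
    apply: measurable_funM => //; apply: (measurableT_comp (measurable_h N i)).
    exact: (measurableT_comp (measurable_entry i j) (measurable_shear _ _ _)).
  - by move=> xi _; rewrite lee_fin.
  by rewrite EFinM lee_wpmul2l ?lee_fin ?exprn_ge0// integral_majorant.
have PH xi : test_density N w xi <= H xi.
  apply: le_trans (density_spread_le xi aw).
  by rewrite ler_peMr ?spread_ge1// test_density_ge0.
have iP : mu.-integrable setT (EFin \o test_density N w).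
  apply: (le_integrable measurableT _ (g := EFin \o H)) => //=.
  - by apply/measurable_EFinP; exact: measurable_test_density.
  - move=> xi _; rewrite lee_fin !ger0_norm// test_density_ge0//.
  apply/integrableP; split; first by apply/measurable_EFinP.
  apply: le_lt_trans (ltry _); apply: le_trans iH.
  under eq_integral => xi _ do rewrite /= ger0_norm//.
  exact: lexx.
have mph : measurable_fun setT (phase x).
  rewrite /phase /mxdot; apply: measurable_funM => //.
  apply: measurable_sum => i; apply: measurable_sum => j; apply: measurable_funM => //.
  under eq_fun do rewrite summxE; apply: measurable_sum => k.
  by under eq_fun do rewrite mxE; exact: measurable_entry.
apply: le_trans (cmod_cint_phase_ge (c := phase x (test_center N))
  (a := a * w i0 ^+ n) (b := rho * B * w i0 ^+ n) _ mph iP _ _).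
- rewrite -mulrBl ler_wpM2r//.
  have : rho * B <= a / 2.
    rewrite /rho -mulrA ler_wpM2l ?(ltW a0)// mulrC ler_pdivrMr ?mulr_gt0 ?ltr_wpDl//.
    by lra.
  by lra.
- by move=> xi; exact: test_density_ge0.
(* The mass is bounded below on this box, whose volume the shear preserves; by [prod_width], volume
   times height is a w_i0^n. *)
- pose X := mx_box (fun (i : 'I_m) (j : 'I_n) => `[- (delta * b N i / 2), delta * b N i / 2]%classic).
  have b0 i : 0 < b N i by rewrite /b; case: ifP.
  have mX : measurable X by exact: measurable_mx_box.
  pose v : R := \prod_i \prod_(j < n) (w i * g).
  have v0 : 0 <= v.
    by apply: prodr_ge0 => i _; apply: prodr_ge0 => j _; rewrite mulr_ge0// ltW.
  have muX : (mu (D N @^-1` X) = (\prod_i \prod_(j < n) (delta * b N i))%:E)%E.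
    rewrite (lebesgue_shear i0J)// lebesgue_mx_boxE// -prodEFin; apply: eq_bigr => i _.
    rewrite -prodEFin; apply: eq_bigr => j _; rewrite lebesgue_measure_itv/= lte_fin.
    have e0 : 0 < delta * b N i by exact: mulr_gt0.
    rewrite ifT; last by lra.
    by rewrite -EFinB; congr EFin; lra.
  have mDX : measurable (D N @^-1` X).
    by rewrite -[X in measurable X]setTI; apply: measurable_shear.
  apply: (@le_trans _ _ (\int[mu]_xi (v%:E * (\1_(D N @^-1` X) xi)%:E))%E).
    rewrite ge0_integralZl//=; last 1 first.
    + by apply/measurable_EFinP; exact: measurable_indic.
    rewrite integral_indic// setIT [X in (_ * X)%E]muX -EFinM lee_fin /v -big_split /=.
    under [leRHS]eq_bigr do rewrite -big_split /=.
    rewrite -(prod_width (g * delta) aw) le_eqVlt; apply/orP; left; apply/eqP.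
    apply: eq_bigr => i _; apply: eq_bigr => j _.
    by ring.
  apply: ge0_integral_mono => xi; first by rewrite -EFinM lee_fin mulr_ge0.
  rewrite -EFinM lee_fin indicE; case: (boolP (xi \in D N @^-1` X)) => hX; last first.
    by rewrite mulr0 test_density_ge0.
  rewrite mulr1; apply: test_density_box => // i j.
  by have := set_mem hX i j; rewrite /= in_itv /= ler_norml.
have dm0 : 0 <= delta + m%:R by rewrite addr_ge0// ltW.
have k0 : 0 <= rho * (2 * pi * n%:R * (delta + m%:R)).
  apply: mulr_ge0 => //; apply: mulr_ge0 => //.
  by apply: mulr_ge0 => //; apply: mulr_ge0 => //; exact: pi_ge0.
apply: (@le_trans _ _ (\int[mu]_xi ((rho * (2 * pi * n%:R * (delta + m%:R)))%:E * (H xi)%:E))%E).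
  apply: ge0_integral_mono => xi; first by rewrite lee_fin mulr_ge0// test_density_ge0.
  rewrite -EFinM lee_fin; apply: le_trans (phase_le xi aw xr) _.
  by rewrite ler_wpM2l ?density_spread_le.
rewrite ge0_integralZl//=; last 2 first.
- by apply/measurable_EFinP.
- by move=> xi _; rewrite lee_fin.
apply: le_trans (lee_wpmul2l _ iH) _; first by rewrite lee_fin.
rewrite -EFinM lee_fin /B le_eqVlt; apply/orP; left; apply/eqP.
by move: (pi : R) => P; ring.
Qed.

End lower_bound.

(** * Letting the scale go to infinity *)

Section necessity.
Variables (R : realType) (m n : nat).
Local Notation mu := (lebesgue_mx R 1 n).

(** The pointwise bound holds on a cube of volume (2 rho)^n independent of N, so passing to L^p only
    costs a constant. *)
Lemma cLnorm_test_ge (i0 : 'I_m) (J : {set 'I_m}) (K M : nat) (j0 : 'I_n)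
    (alpha p : R) : i0 \notin J -> 0 < alpha -> 0 < p ->
  exists2 c, 0 < c & forall N w, admissible i0 J N w ->
    ((c * w i0 ^+ n)%:E <= cLnorm p%:E (multiplier_op
      (test_symbol (n := n) i0 J K alpha N) (test_fun M j0 alpha N w)))%E.
Proof.
move=> i0J a0 p0.
have [c c0 [rho r0 H]] := multiplier_op_test_ge i0J K M j0 a0.
pose V : R := (2 * rho) ^+ n.
have V0 : 0 < V by rewrite exprn_gt0// mulr_gt0.
exists (c * V `^ p^-1) => [|N w aw]; first by rewrite mulr_gt0// powR_gt0.
have w0 : 0 < w i0 by exact: admissible_gt0 aw.
set e := c * w i0 ^+ n; have e0 : 0 <= e by rewrite mulr_ge0 ?exprn_ge0// ltW.
pose X := mx_box (fun (_ : 'I_1) (_ : 'I_n) => `[- rho, rho]%classic).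
have mX : measurable X by exact: measurable_mx_box.
have muX : (mu X = V%:E)%E.
  rewrite lebesgue_mx_boxE// /V; under eq_bigr do under eq_bigr do
    rewrite lebesgue_measure_itv/= lte_fin (_ : - rho < rho) ?gtrN//.
  have -> : (rho%:E - (- rho)%:E)%E = (2 * rho)%:E by rewrite -EFinB; congr EFin; lra.
  rewrite big_ord_recl big_ord0 mule1 prodEFin prodr_const card_ord.
  by [].
have -> : c * V `^ p^-1 * w i0 ^+ n = (e `^ p * V) `^ p^-1.
  rewrite powRM ?powR_ge0 ?(ltW V0)// -powRrM divff ?gt_eqF// powRr1//.
  by rewrite /e mulrAC.
apply: (Lnorm_ge (G := fun x => e * \1_X x)) => //.
- by rewrite mulr_ge0 ?powR_ge0// ltW.
- move=> x; rewrite gee0_abs ?lee_fin ?cmod_ge0// indicE.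
  case: (boolP (x \in X)) => hX; last by rewrite mulr0 cmod_ge0.
  rewrite mulr1; apply: H => // j.
  by have := set_mem hX 0 j; rewrite /= in_itv /= ler_norml.
- by move=> x; rewrite mulr_ge0.
have -> : (\int[mu]_x ((e * \1_X x) `^ p)%:E = \int[mu]_x ((e `^ p)%:E * (\1_X x)%:E))%E.
  apply: eq_integral => x _; rewrite -EFinM indicE; congr EFin.
  by case: (x \in X); rewrite ?mulr1// !mulr0 powR0// gt_eqF.
rewrite ge0_integralZl//=; last 2 first.
- by apply/measurable_EFinP; exact: measurable_indic.
- by rewrite lee_fin powR_ge0.
by rewrite integral_indic// setIT [X in (_ * X)%E]muX -EFinM.
Qed.

Lemma lee_prod_ge0 (I : finType) (F : I -> \bar R) (G : I -> R) :
  (forall i, 0 <= F i)%E -> (forall i, F i <= (G i)%:E)%E ->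
  (\prod_i F i <= (\prod_i G i)%:E)%E.
Proof.
move=> F0 FG.
suff /andP[] : ((0 <= \prod_i F i) && (\prod_i F i <= (\prod_i G i)%:E))%E by [].
elim/big_ind2 : _ => [|x1 x2 y1 y2 /andP[a1 a2] /andP[b1 b2]|i _].
- by rewrite lee_fin ler01 lexx.
- by rewrite mule_ge0//= EFinM lee_pmul.
- by rewrite F0 FG.
Qed.

Lemma Hnorm_ge0 (Phi : 'rV[R]_n -> R[i]) p f : (0 <= Hnorm Phi p f)%E.
Proof. by rewrite /Hnorm; case: ifP => _; exact: Lnorm_ge0. Qed.

(** For e < 0 the power is exp(- q k) <= 1 / (1 + q k) with q > 0, which falls below c / D for large
    k. *)
Lemma power_bound_ge0 (c D e : R) : 0 < c ->
  (forall k : nat, c <= D * (2 ^+ k) `^ e) -> 0 <= e.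
Proof.
move=> c0 H; rewrite leNgt; apply/negP => e0.
have l2 : 0 < ln 2 :> R by rewrite ln_gt0// ltr1n.
pose q : R := - e * ln 2.
have q0 : 0 < q by rewrite mulr_gt0// oppr_gt0.
pose k := Num.bound (D / (c * q)).
have D0 : 0 < D.
  have := lt_le_trans c0 (H 0); rewrite expr0 powR1 mulr1//.
have hk : D / (c * q) < k%:R.
  by apply: archi_boundP; rewrite divr_ge0 ?(ltW D0)// mulr_ge0 ?ltW.
have E : (2 ^+ k) `^ e = (expR (q * k%:R))^-1 :> R.
  rewrite /powR gt_eqF ?exprn_gt0// -expRN lnXn// /q; congr expR.
  by rewrite -[ln 2 *+ k]mulr_natr; ring.
have := H k; rewrite E ler_pdivlMr ?expR_gt0// => h.
have := le_trans (ler_wpM2l (ltW c0) (expR_ge1Dx (q * k%:R))) h.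
move: hk; rewrite ltr_pdivrMr ?mulr_gt0//; nra.
Qed.

(** [M] serves both as the order of decay and as the number of differences; admissibility provides N
    w_i >= 1. *)
Lemma Hnorm_test_le (i0 : 'I_m) (J : {set 'I_m}) (j0 : 'I_n) (alpha : R)
    (Phi : 'rV[R]_n -> R[i]) (p_ : 'I_m -> \bar R) (M : nat) :
  i0 \notin J -> 0 < alpha -> schwartz Phi -> (forall i, (0 < p_ i)%E) ->
  (forall i r, p_ i = r%:E -> (2 * n)%:R <= M%:R * r) ->
  exists2 c : 'I_m -> R, forall i, 0 <= c i &
    forall N w i, admissible i0 J N w ->
      (Hnorm Phi (p_ i) (test_fun M j0 alpha N w i) <=
       (c i * w i `^ (n%:R * fine ((p_ i)^-1)%E))%:E)%E.
Proof.
move=> i0J a0 sPhi p0 pM.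
have [A A0 HA] := packet_decay R n (M + 2 * n).
have b0 : 0 <= (2 * alpha)^-1 by rewrite invr_ge0 mulr_ge0// ltW.
have MM : (M <= 2 * M)%N by rewrite leq_pmull.
pose H i := cid2 (Hnorm_bound j0 sPhi b0 MM (p0 i) (pM i)).
exists (fun i => sval (H i) * A) => [i|N w i aw]; case: (H i) => c c0 Hc /=.
  exact: mulr_ge0.
have wi0 := admissible_gt0 i aw.
have [N1 wJ wO w0] := aw; have N0 : 0 < N by exact: lt_le_trans N1.
have Nw : 1 <= N * w i.
  have [->|ii] := eqVneq i i0.
    by case: w0 => [->|[-> _]]; rewrite ?mulr1// divff// gt_eqF.
  have [iJ|iJ] := boolP (i \in J); first by rewrite wJ// divff// gt_eqF.
  by rewrite wO ?mulr1// !inE negb_or ii.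
apply: Hc => //; last by move=> y; exact: HA.
exact: schwartz_cmfun (packet_schwartz (N *: const_mx alpha) 0 0 wi0).
Qed.

(** The assumed estimate on the test family, with all constants independent of k and w; both
    conclusions are read off from the powers of N. *)
Lemma test_inequality (i0 : 'I_m) (J : {set 'I_m}) (j0 : 'I_n)
    (psi : 'M[R]_(m, n) -> R[i]) (Phi : 'rV[R]_n -> R[i])
    (p_ : 'I_m -> \bar R) (p : R) (s : 'I_m -> R) (C : R) :
  i0 \notin J -> dyadic_cutoff psi -> schwartz Phi ->
  (forall i, (0 < p_ i)%E) -> 0 < p -> (forall i, 0 < s i) ->
  (forall f : 'I_m -> 'rV[R]_n -> R[i],
     (forall i, schwartz (f i)) -> (forall i, (Hnorm Phi (p_ i) (f i) < +oo)%E) ->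
     forall sigma : 'M[R]_(m, n) -> R[i], in_W s sigma ->
     (cLnorm p%:E (multiplier_op sigma f) <=
        C%:E * sup_Wnorm psi s sigma * \prod_i Hnorm Phi (p_ i) (f i))%E) ->
  exists2 c, 0 < c & exists B, forall (k : nat) w,
    admissible i0 J (2 ^+ k) w ->
    c * w i0 ^+ n <= B * (2 ^+ k) `^ (\sum_(i in i0 |: J) s i - n%:R / 2) *
      \prod_i w i `^ (n%:R * fine ((p_ i)^-1)%E).
Proof.
move=> i0J psiP sPhi p0_ p0 s0 HC.
have mn0 : 0 < (m * n)%:R :> R.
  by rewrite ltr0n muln_gt0 (leq_ltn_trans _ (ltn_ord i0))// (leq_ltn_trans _ (ltn_ord j0)).
(* Normalised so that the matrix with all entries alpha has Euclidean norm 1. *)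
pose alpha : R := (Num.sqrt (m * n)%:R)^-1.
have a0 : 0 < alpha by rewrite invr_gt0 sqrtr_gt0.
have aE : (m * n)%:R * alpha ^+ 2 = 1.
  by rewrite exprVn sqr_sqrtr ?(ltW mn0)// divff// gt_eqF.
have [Nw sN] : exists Nw : nat, \sum_i s i <= Nw%:R.
  exists (Num.bound (\sum_i s i)); apply/ltW/archi_boundP.
  by apply: sumr_ge0 => i _; exact: ltW.
pose K := (2 * Nw).+1.
have d0 : 0 < delta m alpha by exact: delta_gt0.
have [CW CW0 HW] := Wnorm_symbol_le n i0J d0 s0 sN (erefl K).
(* A single M for all i, at least 2 n / p_i for every finite p_i; an infinite p_i imposes no
   condition. *)
pose M := \sum_i Num.bound ((2 * n)%:R / fine (p_ i)).
have pM i r : p_ i = r%:E -> (2 * n)%:R <= M%:R * r.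
  move=> pr; have r0 : 0 < r by have := p0_ i; rewrite pr lte_fin.
  rewrite -ler_pdivrMr//; apply: (@le_trans _ _ (Num.bound ((2 * n)%:R / fine (p_ i)))%:R).
    by rewrite pr /=; apply/ltW/archi_boundP; rewrite divr_ge0// ltW.
  by rewrite ler_nat /M (bigD1 i)//= leq_addr.
have [cH cH0 HH] := Hnorm_test_le j0 i0J a0 sPhi p0_ pM.
have [c c0 Hc] := cLnorm_test_ge K M j0 i0J a0 p0.
exists c => //; exists (`|C| * CW * \prod_i cH i) => k w aw.
set N : R := 2 ^+ k in aw *.
have N0 : 0 < N by rewrite exprn_gt0.
have N1 : 1 <= N by rewrite exprn_ege1// ler1n.
pose t i : R := if i == i0 then N else 1.
have t1 i : 1 <= t i by rewrite /t; case: ifP.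
have t0 i : 0 < t i by exact: lt_le_trans (t1 i).
have sE : test_symbol (n := n) i0 J K alpha N =
    symbol i0 J K (delta m alpha) (fun i => t i / N) (N *: const_mx alpha) by [].
have inW : in_W s (test_symbol (n := n) i0 J K alpha N).
  apply: le_lt_trans (HW (fun i => t i / N) (N *: const_mx alpha) _ _ _) (ltry _).
  - by move=> i; rewrite divr_gt0.
  - by move=> i ii; rewrite /t (negbTE ii) div1r invf_le1.
  - by rewrite /t eqxx divff// gt_eqF.
have W1 : (sup_Wnorm psi s (test_symbol (n := n) i0 J K alpha N) <=
    (CW * N `^ (\sum_(i in i0 |: J) s i - n%:R / 2))%R%:E)%E.
  rewrite sE; apply: le_trans (sup_Wnorm_symbol_le i0J K a0 aE s k psiP t1) _.
  have tE : \prod_(i < m) \prod_(j < n) t i = N ^+ n.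
    rewrite (bigD1 i0)//= {1}/t eqxx prodr_const card_ord big1 ?mulr1// => i ii.
    by rewrite /t (negbTE ii) prodr_const expr1n.
  have ti0 : t i0 = N by rewrite /t eqxx.
  apply: le_trans (HW t _ t0 _ _) _; rewrite ?ti0//.
    by move=> i ii; rewrite /t (negbTE ii).
  rewrite lee_fin -mulrA tE; apply: ler_wpM2l => //.
  rewrite -powR_mulrn ?(ltW N0)// -powRrM.
  rewrite -powRD; last by rewrite (gt_eqF N0) implybT.
  by rewrite mulrN.
have Wge0 : (0 <= sup_Wnorm psi s (test_symbol (n := n) i0 J K alpha N))%E.
  apply: le_trans (ereal_sup_ubound _); last by exists 0.
  exact: Wnorm_ge0.
pose f := test_fun M j0 alpha N w.
have fs i : schwartz (f i).
  exact: packet_schwartz (admissible_gt0 i aw).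
have fH i : (Hnorm Phi (p_ i) (f i) < +oo)%E.
  exact: le_lt_trans (HH _ _ i aw) (ltry _).
have := le_trans (Hc _ _ aw) (HC f fs fH _ inW).
set e := N `^ _; set P := \prod_i w i `^ _ => Hle.
rewrite -lee_fin; apply: le_trans Hle _.
have PH : (\prod_i Hnorm Phi (p_ i) (f i) <=
    (\prod_i (cH i * w i `^ (n%:R * fine ((p_ i)^-1)%E)))%:E)%E.
  by apply: lee_prod_ge0 => i; [exact: Hnorm_ge0|exact: HH].
have PH0 : (0 <= \prod_i Hnorm Phi (p_ i) (f i))%E.
  by apply: prode_ge0 => i _; exact: Hnorm_ge0.
have -> : `|C| * CW * \prod_i cH i * e * P =
    `|C| * (CW * e) * \prod_i (cH i * w i `^ (n%:R * fine ((p_ i)^-1)%E)).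
  by rewrite big_split /= -/P; ring.
have C1 : (C%:E * sup_Wnorm psi s (test_symbol (n := n) i0 J K alpha N) <=
    `|C|%:E * sup_Wnorm psi s (test_symbol (n := n) i0 J K alpha N))%E.
  by apply: lee_wpmul2r => //; rewrite lee_fin; exact: ler_norm.
apply: le_trans (lee_wpmul2r PH0 C1) _.
rewrite [leRHS]EFinM [(`|C| * (CW * e))%:E]EFinM.
apply: lee_pmul => //; first by apply: mule_ge0; rewrite ?lee_fin.
by apply: lee_wpmul2l; rewrite ?lee_fin.
Qed.

End necessity.

Theorem theorem5p1 (R : realType) (m n : nat) (m_gt0 : (0 < m)%N)
  (n_gt0 : (0 < n)%N)
  (psi : 'M[R]_(m, n) -> R[i]) (psi_cutoff : dyadic_cutoff psi)
  (Phi : 'rV[R]_n -> R[i]) (Phi_schwartz : schwartz Phi)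
  (Phi_mean : fourier Phi 0 != 0)
  (p_ : 'I_m -> \bar R) (p : R) (s : 'I_m -> R)
  (p_gt0_ : forall i, (0 < p_ i)%E) (p_gt0 : 0 < p)
  (s_gt0 : forall i, 0 < s i) :
  (exists C : R,
     forall f : 'I_m -> 'rV[R]_n -> R[i],
     (forall i, schwartz (f i)) ->
     (forall i, (Hnorm Phi (p_ i) (f i) < +oo)%E) ->
     forall sigma : 'M[R]_(m, n) -> R[i], in_W s sigma ->
     (cLnorm p%:E (multiplier_op sigma f) <=
        C%:E * sup_Wnorm psi s sigma * \prod_i Hnorm Phi (p_ i) (f i))%E) ->
  (forall i, n%:R / 2 <= s i) /\
  (forall J : {set 'I_m},
     - (1 / 2) <= \sum_(i in J) (s i / n%:R - fine ((p_ i)^-1)%E)).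
Proof.
move=> [C HC].
pose j0 : 'I_n := Ordinal n_gt0.
have N1 k : 1 <= 2 ^+ k :> R by rewrite exprn_ege1// ler1n.
have N0 k : 0 < 2 ^+ k :> R by exact: lt_le_trans (N1 k).
have test i0 J i0J := @test_inequality R m n i0 J j0 psi Phi p_ p s C i0J
  psi_cutoff Phi_schwartz p_gt0_ p_gt0 s_gt0 HC.
have n0 : 0 < n%:R :> R by rewrite ltr0n.
split=> [i|J].
  have i0J : i \notin (finset.set0 : {set 'I_m}) by rewrite inE.
  have [c c0 [B HB]] := test i finset.set0 i0J.
  (* With [J] empty and all widths 1, the only power of N left is s_i - n/2. *)
  rewrite -subr_ge0; apply: (power_bound_ge0 (D := B) c0) => k.
  have := HB k (fun=> 1); rewrite expr1n mulr1 finset.setU0 big_set1.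
  rewrite [\prod_(_ < m) _]big1 ?mulr1 => [|l _]; last by rewrite powR1.
  by apply; split=> //; [move=> l; rewrite inE|right].
have [->|[i0 i0J]] := finset.set_0Vmem J; first by rewrite big_set0 oppr_le0.
have iJ : i0 \notin J :\ i0 by rewrite !inE eqxx.
have [c c0 [B HB]] := test i0 (J :\ i0) iJ.
rewrite finset.setD1K// in HB.
set S := \sum_(i in J) s i in HB.
pose P : R := \sum_(i in J) fine ((p_ i)^-1)%E.
(* The total exponent of N, where the last n comes from dividing by w_i0^n = N^-n; dividing it by n
   gives the claim. *)
suff e0 : 0 <= S - n%:R / 2 - n%:R * P + n%:R.
  rewrite sumrB -mulr_suml -/S -/P.
  have -> : S / n%:R - P = (S - n%:R * P) / n%:R.
    by rewrite mulrBl [n%:R * P]mulrC mulfK// gt_eqF.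
  rewrite ler_pdivlMr//; lra.
apply: (power_bound_ge0 (D := B) c0) => k; set N : R := 2 ^+ k.
pose w i : R := if i \in J then N^-1 else 1.
have aw : admissible i0 (J :\ i0) N w.
  split; rewrite /w ?finset.setD1K//.
  - exact: N1.
  - by move=> i; rewrite !inE => /andP[_ ->].
  - by move=> i /negbTE ->.
  - by left; rewrite i0J.
have := HB k w aw; rewrite -/N {1}/w i0J => H.
have Nn : 0 < N^-1 ^+ n by rewrite exprn_gt0// invr_gt0 N0.
rewrite -(ler_pM2r Nn); apply: le_trans H _.
have wP i : w i `^ (n%:R * fine ((p_ i)^-1)%E) =
    N `^ (if i \in J then - (n%:R * fine ((p_ i)^-1)%E) else 0).
  rewrite /w; case: ifP => _; last by rewrite powR1 powRr0.
  by rewrite -(powR_inv1 (ltW (N0 k))) -powRrM mulN1r.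
rewrite (eq_bigr _ (fun i _ => wP i)) prod_powR ?N0// -big_mkcond /= sumrN -mulr_sumr -/P.
rewrite -(powR_inv1 (ltW (N0 k))) -[_ `^ (-1) ^+ n]powR_mulrn ?powR_ge0// -powRrM.
rewrite -!mulrA -!powRD ?(gt_eqF (N0 k)) ?implybT//.
by rewrite le_eqVlt; apply/orP; left; apply/eqP; congr (_ * _ `^ _); ring.
Qed.
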